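(* Let $(E,h^E)$ be a Hermitian holomorphic vector bundle of rank $r$ over a complex manifold $X$ of dimension $n$, and assume that $(E,h^E)$ is strongly decomposably positive of type II. Then for every $k\in\mathbb{N}$ with $1\le k\leq n$ and every partition $\lambda\in\Lambda(k,r)$, the Schur form $P_\lambda(c(E,h^E))$ is a positive $(k,k)$-form on $X$.
   Context: Curvature. $R^E\in A^{1,1}(X,\mathrm{End}(E))$ is the Chern curvature of $(E,h^E)$. For a local holomorphic frame $\{e_i\}_{1\le i\le r}$ of $E$ and local holomorphic coordinates $\{z^\alpha\}_{1\le\alpha\le n}$ of $X$, with $h_{i\bar j}=h^E(e_i,e_j)$, $\partial_\alpha=\partial/\partial z^\alpha$, $\partial_{\bar\beta}=\partial/\partial\bar z^\beta$, set $$R_{i\bar j\alpha\bar\beta}=-\partial_\alpha\partial_{\bar\beta}h_{i\bar j}+h^{\bar l k}\,\partial_\alpha h_{i\bar l}\,\partial_{\bar\beta}h_{k\bar j}.$$ The Einstein summation convention is used. Type II positivity. $(E,h^E)$ is strongly decomposably positive of type II if for every $x\in X$ there is an $h^E$-orthogonal decomposition $E_x=E_{1,x}\oplus E_{2,x}$ (either summand may be zero) with respect to which the Chern curvature is block diagonal, $$R^E_x=\begin{pmatrix}R^E_x|_{E_{1,x}}&0\\0&R^E_x|_{E_{2,x}}\end{pmatrix},$$ and such that $R_{i\bar j\alpha\bar\beta}u^{i\alpha}\overline{u^{j\beta}}>0$ for every non-zero $u=u^{i\alpha}e_i\otimes\partial_\alpha\in E_{1,x}\otimes T^{1,0}_xX$,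 and $R_{i\bar j\alpha\bar\beta}v^{i\bar\beta}\overline{v^{j\bar\alpha}}>0$ for every non-zero $v=v^{i\bar\beta}e_i\otimes\partial_{\bar\beta}\in E_{2,x}\otimes T^{0,1}_xX$. Schur forms. The Chern forms are defined by $\sum_{i=0}^r c_i(E,h^E)=\det\left(\mathrm{Id}_E+\frac{\sqrt{-1}}{2\pi}R^E\right)$, with $c_i(E,h^E)$ of degree $2i$, $c_0=1$, and $c_i=0$ for $i\notin[0,r]$. $\Lambda(k,r)$ is the set of $\lambda=(\lambda_1,\dots,\lambda_k)$ of integers with $r\ge\lambda_1\ge\cdots\ge\lambda_k\ge0$ and $\sum_i\lambda_i=k$. For $\lambda\in\Lambda(k,r)$, $$P_\lambda(c(E,h^E))=\det\left(c_{\lambda_i-i+j}(E,h^E)\right)_{1\le i,j\le k}.$$ Positivity. A real $(k,k)$-form $u$ on $X$ is positive if at every point $x\in X$, for every non-zero $(n-k,0)$-form $\beta\in\Lambda^{n-k}(T^{1,0}_xX)^*$ (not necessarily decomposable), the form $u_x\wedge(\sqrt{-1})^{(n-k)^2}\beta\wedge\overline\beta$ is a positive volume form, i.e. of the form $\tau\,\sqrt{-1}e^1\wedge\overline{e}^1\wedge\cdots\wedge\sqrt{-1}e^n\wedge\overline{e}^n$ with $\tau>0$, for a basis $(e^1,\dots,e^n)$ of $(T^{1,0}_xX)^*$. *)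

(* Defs.v *)
From HB Require Import structures.
From mathcomp Require Import all_boot all_order all_algebra.
Set Implicit Arguments.
Unset Strict Implicit.
Unset Printing Implicit Defensive.
Import Order.TTheory GRing.Theory Num.Theory Num.Def.
Local Open Scope ring_scope.

(* Exterior algebra of K^m. The coefficient of u on e_{s_1} /\ ... /\ e_{s_p},
   s_1 < ... < s_p, is u [set s_1; ...; s_p]; the ring product is the wedge. *)
Definition extalg (K : fieldType) (m : nat) := {ffun {set 'I_m} -> K}.

HB.instance Definition _ (K : fieldType) (m : nat) :=
  GRing.Lmodule.copy (extalg K m) {ffun {set 'I_m} -> K^o}.

Section ExteriorAlgebra.
Variables (K : fieldType) (m : nat).
Implicit Types (u v w : extalg K m) (A B D S : {set 'I_m}).

(* e_A /\ e_B = (-1) ^+ ninv A B *: e_(A :|: B) when A and B are disjoint. *)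
Definition ninv A B : nat := (\sum_(a in A) \sum_(b in B) (b < a))%N.

Definition ext_basis A : extalg K m := [ffun S => (S == A)%:R].

Definition wedge u v : extalg K m :=
  [ffun S : {set 'I_m} => \sum_(A : {set 'I_m} | A \subset S)
     (-1) ^+ ninv A (S :\: A) * (u A * v (S :\: A))].

Lemma ninv0l B : ninv set0 B = 0%N.
Proof. by rewrite /ninv big_set0. Qed.

Lemma ninv0r A : ninv A set0 = 0%N.
Proof. by rewrite /ninv big1 // => a _; rewrite big_set0. Qed.

Lemma ninvUl A B D : [disjoint A & B] ->
  ninv (A :|: B) D = (ninv A D + ninv B D)%N.
Proof. by move=> dAB; rewrite /ninv -bigU //; apply: eq_bigl => a; rewrite !inE. Qed.

Lemma ninvUr A B D : [disjoint B & D] ->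
  ninv A (B :|: D) = (ninv A B + ninv A D)%N.
Proof.
move=> dBD; rewrite /ninv -big_split /=; apply: eq_bigr => a _.
by rewrite -bigU //; apply: eq_bigl => b; rewrite !inE.
Qed.

Lemma wedgeA : associative wedge.
Proof.
move=> u v w; apply/ffunP => S; rewrite !ffunE.
under [RHS]eq_bigr => D _.
  rewrite ffunE mulr_suml mulr_sumr.
  over.
rewrite (exchange_big_dep (fun A : {set 'I_m} => A \subset S)) /=; last first.
  by move=> D A DS AD; apply: subset_trans DS.
apply: eq_bigr => A AS; rewrite ffunE !mulr_sumr.
rewrite [RHS](reindex_onto (fun B : {set 'I_m} => A :|: B)
                           (fun D : {set 'I_m} => D :\: A)) /=; last first.
  by move=> D /andP[_ AD]; rewrite setDE setUIr setUCr setIT; apply/setUidPr.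
apply: eq_big => [B|B BSA].
  rewrite subsetUl andbT subUset AS /= subsetD; congr (_ && _).
  rewrite setDUl setDv set0U; apply/idP/eqP => [/setDidPl //|<-].
  by rewrite -setI_eq0 setIDAC -setIDA setDv setI0.
have /andP[BS dBA] : (B \subset S) && [disjoint B & A] by rewrite -subsetD.
have eD : (A :|: B) :\: A = B.
  by rewrite setDUl setDv set0U; apply/setDidPl.
rewrite eD -setDDl.
have dC : [disjoint B & S :\: A :\: B] by rewrite -setI_eq0 setIC setIDAC -setIDA setDv setI0.
have dAB : [disjoint A & B] by rewrite disjoint_sym.
have -> : ninv A (S :\: A) = (ninv A B + ninv A (S :\: A :\: B))%N.
  rewrite -ninvUr //; congr ninv.
  by rewrite -{1}(setIidPr BSA) setID.
rewrite ninvUl // !exprD.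
rewrite -!mulrA.
set a := (-1) ^+ ninv A B; set b := (-1) ^+ ninv A _; set c := (-1) ^+ ninv B _.
by rewrite mulrCA; congr (_ * _); rewrite [RHS]mulrCA [u A * _]mulrCA; congr (_ * _); rewrite [RHS]mulrCA.
Qed.

Lemma wedge1l : left_id (ext_basis set0) wedge.
Proof.
move=> u; apply/ffunP => S; rewrite ffunE (bigD1 set0) ?sub0set //=.
rewrite ninv0l expr0 mul1r ffunE eqxx mul1r setD0 big1 ?addr0 // => A /andP[_ A0].
by rewrite ffunE (negPf A0) mul0r mulr0.
Qed.

Lemma wedge1r : right_id (ext_basis set0) wedge.
Proof.
move=> u; apply/ffunP => S; rewrite ffunE (bigD1 S) //=.
rewrite setDv ninv0r expr0 mul1r ffunE eqxx mulr1 big1 ?addr0 // => A /andP[AS AnS].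
rewrite ffunE setD_eq0; have /negPf-> : ~~ (S \subset A).
  by apply: contra AnS => SA; rewrite eqEsubset AS.
by rewrite !mulr0.
Qed.

Lemma wedgeDl : left_distributive wedge +%R.
Proof.
move=> u v w; apply/ffunP => S; rewrite !ffunE -big_split; apply: eq_bigr => A _.
by rewrite ffunE mulrDl mulrDr.
Qed.

Lemma wedgeDr : right_distributive wedge +%R.
Proof.
move=> u v w; apply/ffunP => S; rewrite !ffunE -big_split; apply: eq_bigr => A _.
by rewrite ffunE !mulrDr.
Qed.

Lemma ext_basis_neq0 A : ext_basis A != 0.
Proof.
by apply/eqP => /ffunP/(_ A) /eqP; rewrite !ffunE eqxx oner_eq0.
Qed.

HB.instance Definition _ := GRing.Zmodule_isNzRing.Build (extalg K m)
  wedgeA wedge1l wedge1r wedgeDl wedgeDr (ext_basis_neq0 set0).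

Lemma wedgeZl (c : K) u v : c *: (u * v) = (c *: u) * v.
Proof.
apply/ffunP => S; rewrite !ffunE /GRing.scale /= mulr_sumr; apply: eq_bigr => A _.
by rewrite !ffunE !mulrA; congr (_ * _); rewrite -!mulrA mulrCA.
Qed.

Lemma wedgeZr (c : K) u v : c *: (u * v) = u * (c *: v).
Proof.
apply/ffunP => S; rewrite !ffunE /GRing.scale /= mulr_sumr; apply: eq_bigr => A _.
by rewrite !ffunE mulrCA; congr (_ * _); rewrite mulrCA.
Qed.

HB.instance Definition _ :=
  GRing.Lmodule_isLalgebra.Build K (extalg K m) wedgeZl.
HB.instance Definition _ :=
  GRing.Lalgebra_isAlgebra.Build K (extalg K m) wedgeZr.

End ExteriorAlgebra.

Definition ext_part (K : fieldType) (m d : nat) (u : extalg K m) : extalg K m :=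
  [ffun S : {set 'I_m} => if #|S| == d then u S else 0].

(* Complex exterior forms at a point of an n-dimensional complex manifold, in
   local coordinates: the generators of index < n are the dz^alpha, those of
   index >= n are the d\bar z^alpha. *)
Section Forms.
Variables (C : numClosedFieldType) (n : nat).

Definition form := extalg C (n + n).

Definition dz (a : 'I_n) : form := ext_basis C [set lshift n a]%SET.
Definition dzbar (a : 'I_n) : form := ext_basis C [set rshift n a]%SET.

Definition bidegree (p q : nat) (u : form) : Prop :=
  forall S : {set 'I_(n + n)}, u S != 0 ->
    #|[set a : 'I_n | lshift n a \in S]%SET| = p /\
    #|[set a : 'I_n | rshift n a \in S]%SET| = q.

(* The basis form of index S is the product of the dz^a with lshift n a \in S
   followed by the product of the d\bar z^a with rshift n a \in S. *)
Definition form_conj (u : form) : form :=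
  \sum_(S : {set 'I_(n + n)})
    (u S)^* *: (\prod_(a < n | lshift n a \in S) dzbar a *
                \prod_(a < n | rshift n a \in S) dz a).

Definition coframe (e : 'I_n -> form) : Prop :=
  exists2 P : 'M[C]_n, P \in unitmx & forall i, e i = \sum_j P i j *: dz j.

Definition positive_volume (w : form) : Prop :=
  exists tau : C, exists e : 'I_n -> form,
    [/\ 0 < tau, coframe e &
        w = tau *: \prod_(i < n) ('i *: (e i * form_conj (e i)))].

Definition positive_form (k : nat) (u : form) : Prop :=
  [/\ bidegree k k u, form_conj u = u &
      forall beta : form, bidegree (n - k) 0 beta -> beta != 0 ->
        positive_volume
          (u * ('i ^+ ((n - k) ^ 2) *: (beta * form_conj beta)))].

End Forms.

From mathcomp Require Import all_classical all_reals all_analysis.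
From mathcomp Require Import complex.
Import numFieldNormedType.Exports.
Local Open Scope classical_set_scope.

(* R[i] with the topology of its norm. *)
HB.instance Definition _ (R : realType) := PseudoMetric.copy R[i] R[i]^o.
HB.instance Definition _ (R : realType) := Pointed.copy R[i] R[i]^o.
HB.instance Definition _ (R : realType) := NormedModule.copy R[i] R[i]^o.

Section ComplexCalculus.
Variables (R : realType) (n : nat).
Implicit Types (U : set 'rV[R[i]]_n) (f : 'rV[R[i]]_n -> R[i]).

(* Differentiability is complex: the scalars are R[i]. *)
Definition holomorphic_on (V W : normedModType R[i]) (U : set V) (f : V -> W) :
  Prop := forall x, U x -> differentiable f x.

(* Derivatives along the real line t |-> x + t v, so that v and 'i v are
   independent directions. *)
Definition rderivable f (v x : 'rV[R[i]]_n) : Prop :=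
  derivable (fun t : R => Re (f (x + t%:C%C *: v))) 0 1 /\
  derivable (fun t : R => Im (f (x + t%:C%C *: v))) 0 1.

Definition rderive f (v x : 'rV[R[i]]_n) : R[i] :=
  Complex ((fun t : R => Re (f (x + t%:C%C *: v)))^`() 0)
          ((fun t : R => Im (f (x + t%:C%C *: v)))^`() 0).

Fixpoint continuously_rderivable (k : nat) U f : Prop :=
  (forall x, U x -> {for x, continuous f}) /\
  match k with
  | 0 => True
  | k'.+1 => forall v, (forall x, U x -> rderivable f v x) /\
                       continuously_rderivable k' U (rderive f v)
  end.

Definition smooth_on U f : Prop := forall k, continuously_rderivable k U f.

Definition d_z (a : 'I_n) f (x : 'rV[R[i]]_n) : R[i] :=
  (rderive f (delta_mx 0 a) x - 'i * rderive f ('i *: delta_mx 0 a) x) / 2.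

Definition d_zbar (a : 'I_n) f (x : 'rV[R[i]]_n) : R[i] :=
  (rderive f (delta_mx 0 a) x + 'i * rderive f ('i *: delta_mx 0 a) x) / 2.

End ComplexCalculus.

Record complexManifold (R : realType) (n : nat) := ComplexManifold {
  mpoint :> topologicalType;
  m_hausdorff : hausdorff_space mpoint;
  m_second_countable : @second_countable mpoint;
  chartI : Type;
  chart_dom : chartI -> set mpoint;
  chart : chartI -> mpoint -> 'rV[R[i]]_n;
  chart_inv : chartI -> 'rV[R[i]]_n -> mpoint;
  chart_dom_open : forall a, open (chart_dom a);
  chart_dom_cover : forall x, exists a, chart_dom a x;
  chart_img_open : forall a, open (chart a @` chart_dom a);
  chartK : forall a x, chart_dom a x -> chart_inv a (chart a x) = x;
  chart_continuous : forall a x, chart_dom a x ->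
    {for x, continuous (chart a)};
  chart_inv_continuous : forall a z, (chart a @` chart_dom a) z ->
    {for z, continuous (chart_inv a)};
  chart_holomorphic : forall a b,
    holomorphic_on (chart a @` (chart_dom a `&` chart_dom b))
                   (chart b \o chart_inv a) }.

(* A holomorphic vector bundle is given by its fibres and by local frames with
   holomorphic transition functions; these determine the complex structure of
   the total space. *)
Record holomorphicBundle (R : realType) (n r : nat) (X : complexManifold R n) :=
  HolomorphicBundle {
  fiber :> X -> vectType R[i];
  frameI : Type;
  frame_dom : frameI -> set X;
  frame : frameI -> forall x, r.-tuple (fiber x);
  frame_dom_open : forall b, open (frame_dom b);
  frame_dom_cover : forall x, exists b, frame_dom b x;
  frame_basis : forall b x, frame_dom b x -> basis_of fullv (frame b x);
  frame_holomorphic : forall (a : chartI X) b c (i j : 'I_r),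
    holomorphic_on
      (chart a @` (chart_dom a `&` (frame_dom b `&` frame_dom c)))
      (fun z => coord (frame b (chart_inv a z)) i
                      (tnth (frame c (chart_inv a z)) j)) }.

Record hermitianMetric (R : realType) (n r : nat) (X : complexManifold R n)
    (E : holomorphicBundle r X) := HermitianMetric {
  hprod :> forall x, {dot E x for (@conjC R[i])};
  hprod_smooth : forall (a : chartI X) (b : frameI E) (i j : 'I_r),
    smooth_on (chart a @` (chart_dom a `&` frame_dom b))
      (fun z => hprod (chart_inv a z) (tnth (frame b (chart_inv a z)) i)
                                      (tnth (frame b (chart_inv a z)) j)) }.

Section Curvature.
Variables (R : realType) (n r : nat) (X : complexManifold R n).
Variables (E : holomorphicBundle r X) (h : hermitianMetric E).
Variables (a : chartI X) (b : frameI E).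

Definition hmx (z : 'rV[R[i]]_n) : 'M[R[i]]_r :=
  \matrix_(i, j) h (chart_inv a z) (tnth (frame b (chart_inv a z)) i)
                                   (tnth (frame b (chart_inv a z)) j).

(* R_{i \bar j alpha \bar beta} at x; h^{\bar l k} is invmx (hmx _) l k. *)
Definition curv (x : X) (i j : 'I_r) (al be : 'I_n) : R[i] :=
  let z := chart a x in
  - d_z al (d_zbar be (fun w => hmx w i j)) z +
  \sum_(k < r) \sum_(l < r) invmx (hmx z) l k *
     d_z al (fun w => hmx w i l) z * d_zbar be (fun w => hmx w k j) z.

(* R^E = R_i^l_{alpha \bar beta} dz^alpha /\ d\bar z^beta (x) e^i (x) e_l, with
   R_i^l_{alpha \bar beta} = R_{i \bar j alpha \bar beta} h^{\bar j l}. *)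
Definition curv_end (x : X) (i l : 'I_r) (al be : 'I_n) : R[i] :=
  \sum_(j < r) curv x i j al be * invmx (hmx (chart a x)) j l.

Definition curv_op (x : X) (al be : 'I_n) (v : E x) : E x :=
  \sum_(i < r) \sum_(l < r)
    (coord (frame b x) i v * curv_end x i l al be) *: tnth (frame b x) l.

Definition curv_mx (x : X) : 'M[form R[i] n]_r :=
  \matrix_(i, l) \sum_al \sum_be curv_end x i l al be *: (dz _ al * dzbar _ be).

(* The entries are sums of even forms, which commute, so that \det over the
   non-commutative ring of forms is unambiguous; likewise in schur_form. *)
Definition total_chern (x : X) : form R[i] n :=
  \det (1%:M + map_mx ( *:%R ('i / (2 * (pi : R)%:C%C))) (curv_mx x)).

Definition chern (x : X) (m : int) : form R[i] n :=
  if m is Posz p then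
    if (p <= r)%N then ext_part p.*2 (total_chern x) else 0
  else 0.

Definition schur_form (k : nat) (lam : k.-tuple nat) (x : X) : form R[i] n :=
  \det (\matrix_(i < k, j < k)
          chern x ((tnth lam i)%:Z - (i : nat)%:Z + (j : nat)%:Z)).

(* u i alpha and v i beta are the coefficients u^{i alpha} and v^{i \bar beta}. *)
Definition type1_positive (x : X) (E1 : {vspace E x}) : Prop :=
  forall u : 'M[R[i]]_(r, n), u != 0 ->
    (forall al, \sum_(i < r) u i al *: tnth (frame b x) i \in E1) ->
    0 < \sum_(i < r) \sum_(j < r) \sum_(al < n) \sum_(be < n)
          curv x i j al be * u i al * (u j be)^*.

Definition type2_positive (x : X) (E2 : {vspace E x}) : Prop :=
  forall v : 'M[R[i]]_(r, n), v != 0 ->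
    (forall be, \sum_(i < r) v i be *: tnth (frame b x) i \in E2) ->
    0 < \sum_(i < r) \sum_(j < r) \sum_(al < n) \sum_(be < n)
          curv x i j al be * v i be * (v j al)^*.

End Curvature.

(* The conditions are tensorial: they do not depend on the chart a and the
   frame b around x in which they are written. *)
Definition strongly_decomposably_positive2 (R : realType) (n r : nat)
    (X : complexManifold R n) (E : holomorphicBundle r X)
    (h : hermitianMetric E) : Prop :=
  forall x : X, exists E1 E2 : {vspace E x},
    [/\ (E1 + E2)%VS = fullv,
        forall v w, v \in E1 -> w \in E2 -> h x v w = 0 &
        forall (a : chartI X) (b : frameI E),
          chart_dom a x -> frame_dom b x ->
          [/\ forall al be v, v \in E1 -> curv_op h a b al be v \in E1,
              forall al be v, v \in E2 -> curv_op h a b al be v \in E2,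
              type1_positive h a b E1 &
              type2_positive h a b E2]].

(* Lambda(k, r) *)
Definition bounded_partition (k r : nat) (lam : k.-tuple nat) : bool :=
  [&& sorted geq lam, all (fun m => (m <= r)%N) lam & sumn lam == k].

(* Main.v *)
(* At a point, the Jacobi-Trudi determinant gives
     k! P_lambda = \sum_(s in S_k) sgn(s) f(s) \prod_(c cycle of s) tr(R^|c|),
   where f = \sum_w sgn(w) h_(lambda_i - i + w(i)) is a signed sum of permutation
   characters of S_k.  Counting integer matrices with prescribed margins and using
   the bialternant formula, f has norm one, so f is plus or minus an irreducible
   character and f * f = (k! / d) f for the convolution product, with d = f(1).
   In an orthonormal frame adapted to E1 + E2, the curvature is
     R_il = \sum_s w_is /\ conj(w_ls) on E1, R_il = \sum_s w_ls /\ conj(w_is) on E2,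
   with (1,0)-forms w.  Hence the cycle products become pairings
   Phi(s z) /\ conj(Phi(z)) of products Phi(z) of w's, for an action of a Young-type
   subgroup that permutes the indices s on the E1 positions and the indices i on the
   E2 positions; by the convolution identity P_lambda is then, up to the factor
   i^(k^2), a sum of terms c Psi /\ conj(Psi) with c > 0.  For strictness, some
   coefficient of the Schur polynomial of lambda is positive, since at x_i = t^(2i+1)
   its expansion starts with a positive power of t; the corresponding averages of the
   forms Psi recover all products of the dz^a. *)

From HB Require Import structures.
From mathcomp Require Import all_boot all_order all_algebra.
From mathcomp Require Import all_fingroup all_solvable all_field all_character.
From mathcomp Require Import zify ring lra.
From mathcomp Require mpoly.
Require Import Defs.

Set Implicit Arguments.
Unset Strict Implicit.
Unset Printing Implicit Defensive.
Import Order.TTheory GRing.Theory Num.Theory.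
Local Open Scope ring_scope.

(** Norm one determines f only up to sign, hence also d = f(1), while positivity of the final sum
    needs d > 0. The coloring K behind strictness settles this too: if H is its stabilizer, then d
    times a sum of squares equals k! |H| times the positive sum of sgn(s) f(s) over H. The squares
    have to survive the mixture of the two blocks. Permutations that send an E1 position to an E2
    position contribute 0, because the curvature is block diagonal. On the remaining group, sorting
    the conjugated one-forms leaves, together with sgn(s), the sign of s on the E2 positions, again
    a character with values 1 and -1, which drops out of squares. Cycle types never appear: a
    product of traces over the cycles of s is a sum over index maps J of the product of the N(J a,
    J(s a)), and s acts on it by reindexing. Forms do not commute, so identities between
    determinants are proved in the commutative subring of even forms and carried over. *)

(** * Permutations transported along an injection *)

Section PermExtension.
Variables (T T' : finType) (J : T -> T').
Hypothesis injJ : injective J.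
Implicit Types (s : {perm T}) (u : {perm T'}).

Definition ext_fun s (x : T') : T' :=
  if [pick a | J a == x] is Some a then J (s a) else x.

Lemma ext_fun_in s a : ext_fun s (J a) = J (s a).
Proof.
rewrite /ext_fun; case: pickP => [b /eqP/injJ-> //|/(_ a)].
by rewrite eqxx.
Qed.

Lemma ext_fun_out s x : x \notin [set J a | a in T] -> ext_fun s x = x.
Proof.
move=> xJ; rewrite /ext_fun; case: pickP => // a /eqP def_x.
by rewrite -def_x imset_f in xJ.
Qed.

Lemma ext_fun_inj s : injective (ext_fun s).
Proof.
have imJ x : ext_fun s x \in [set J a | a in T] -> x \in [set J a | a in T].
  move=> h; apply/negPn/negP => hx; rewrite ext_fun_out // in h.
  by rewrite h in hx.
move=> x y e; case: (boolP (x \in [set J a | a in T])) => hx.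
  have hy : y \in [set J a | a in T].
    by apply: imJ; rewrite -e; case/imsetP: hx => a _ ->; rewrite ext_fun_in imset_f.
  case/imsetP: hx e => a _ ->; case/imsetP: hy => b _ ->.
  by rewrite !ext_fun_in => /injJ/perm_inj->.
have hy : y \notin [set J a | a in T].
  apply/negP => hy; move/negP: hx; apply; apply: imJ; rewrite e.
  by case/imsetP: hy => a _ ->; rewrite ext_fun_in imset_f.
by rewrite !ext_fun_out // in e.
Qed.

Definition ext_perm s := perm (@ext_fun_inj s).

Lemma ext_permE s a : ext_perm s (J a) = J (s a).
Proof. by rewrite permE ext_fun_in. Qed.

Lemma ext_perm_out s x : x \notin [set J a | a in T] -> ext_perm s x = x.
Proof. by rewrite permE; apply: ext_fun_out. Qed.

Lemma ext_perm_on s : perm_on [set J a | a in T] (ext_perm s).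
Proof.
by apply/subsetP => x; rewrite inE; apply: contraR => /ext_perm_out/eqP.
Qed.

Lemma ext_permM : {morph ext_perm : s1 s2 / (s1 * s2)%g}.
Proof.
move=> s1 s2; apply/permP => x; rewrite permM.
case: (boolP (x \in [set J a | a in T])) => [/imsetP[a _ ->]|hx].
  by rewrite !ext_permE permM.
by rewrite !ext_perm_out.
Qed.

Lemma ext_perm1 : ext_perm 1 = 1%g.
Proof. by apply: (@mulgI _ (ext_perm 1)); rewrite -ext_permM !mulg1. Qed.

Lemma ext_tperm a b : ext_perm (tperm a b) = tperm (J a) (J b).
Proof.
apply/permP => x; case: (boolP (x \in [set J a | a in T])) => [/imsetP[c _ ->]|hx].
  by rewrite ext_permE inj_tperm.
rewrite ext_perm_out // tpermD //; apply: contraNneq hx => <-; exact: imset_f.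
Qed.

(** A product of transpositions is transported to a product of as many transpositions. *)
Lemma odd_ext_perm s : odd_perm (ext_perm s) = odd_perm s.
Proof.
have [ts -> dts] := prod_tpermP s; elim: ts dts => [_|t ts IH] /=.
  by rewrite big_nil ext_perm1 !odd_perm1.
case/andP=> dt dts; rewrite big_cons ext_permM !odd_permM IH // ext_tperm.
by rewrite !odd_tperm (inj_eq injJ).
Qed.

Lemma ext_perm_inj : injective ext_perm.
Proof.
move=> s1 s2 /permP e; apply/permP => a; apply: injJ.
by rewrite -!ext_permE e.
Qed.

Lemma ext_perm_onto u : perm_on [set J a | a in T] u -> exists s, u = ext_perm s.
Proof.
move=> uJ.
have hP a : exists b, u (J a) == J b.
  have : u (J a) \in [set J a | a in T] by rewrite perm_closed // imset_f.
  by case/imsetP=> b _ ->; exists b.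
pose g a := xchoose (hP a).
have gE a : u (J a) = J (g a) by apply/eqP; exact: (xchooseP (hP a)).
have ginj : injective g by move=> a b e; apply: injJ; apply: (@perm_inj _ u); rewrite !gE e.
exists (perm ginj); apply/permP => x.
case: (boolP (x \in [set J a | a in T])) => [/imsetP[a _ ->]|hx].
  by rewrite ext_permE permE gE.
by rewrite ext_perm_out // (out_perm uJ).
Qed.

End PermExtension.

(** * Principal minors and products of traces *)

Section PrincipalMinors.
Variable A : comNzRingType.

(* Elementary symmetric functions of the eigenvalues, as sums of principal minors. *)
Definition elsym m (N : 'M[A]_m) (j : nat) : A :=
  \sum_(B : {set 'I_m} | #|B| == j)
    \sum_(s : 'S_m | perm_on B s) (-1) ^+ s * \prod_(a in B) N a (s a).

(** Expanding each factor [N i (s i) + (i == s i)%:R] chooses the set B of rows that use N; the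
    Kronecker factors force s to fix every row outside B. *)
Lemma det1D m (N : 'M[A]_m) : \det (1%:M + N) = \sum_(j < m.+1) elsym N j.
Proof.
rewrite /determinant.
transitivity (\sum_(s : 'S_m) \sum_(B : {set 'I_m} | perm_on B s)
    (-1) ^+ s * \prod_(a in B) N a (s a)).
  apply: eq_bigr => s _.
  have -> : \prod_i (1%:M + N) i (s i) = \prod_i (N i (s i) + (i == s i)%:R).
    by apply: eq_bigr => i _; rewrite !mxE addrC; case: eqP => //=.
  rewrite bigA_distr mulr_sumr (bigID (fun B => perm_on B s)) /=.
  rewrite [X in _ + X]big1 ?addr0; last first.
    move=> B /subsetPn[i]; rewrite inE => si iB.
    rewrite (bigD1 i) //= (negPf iB) eq_sym (negPf si) mul0r mulr0 //.
  apply: eq_bigr => B Bs; congr (_ * _).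
  rewrite (bigID (fun a => a \in B)) /= [X in _ * X]big1 ?mulr1.
    by apply: eq_bigr => i ->.
  by move=> i iB; rewrite (negPf iB) (out_perm Bs iB) eqxx.
rewrite (exchange_big_dep xpredT) //=.
rewrite (partition_big (fun B : {set 'I_m} => inord #|B| : 'I_m.+1) xpredT) //=.
apply: eq_bigr => j _; rewrite /elsym; apply: eq_bigl => B.
have lB : (#|B| < m.+1)%N by rewrite ltnS -[X in (_ <= X)%N]card_ord max_card.
by rewrite -val_eqE /= inordK.
Qed.

(* The product over the cycles of s of tr (N ^ length). *)
Definition ptr m k (N : 'M[A]_m) (s : 'S_k) : A :=
  \sum_(J : {ffun 'I_k -> 'I_m}) \prod_a N (J a) (J (s a)).

(** For fixed J the signed sum over s is the determinant of N read along J, which has two equal rows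
    unless J is injective. A k-element set is the image of k! injections, and each of them gives the
    same principal minor. *)
Lemma elsym_ptr m k (N : 'M[A]_m) :
  \sum_(s : 'S_k) (-1) ^+ s * ptr N s = elsym N k *+ k`!.
Proof.
transitivity (\sum_(J : {ffun 'I_k -> 'I_m}) \det (\matrix_(a, b) N (J a) (J b))).
  under eq_bigr do rewrite mulr_sumr.
  rewrite exchange_big /=; apply: eq_bigr => J _; apply: eq_bigr => s _.
  by congr (_ * _); apply: eq_bigr => a _; rewrite mxE.
rewrite (bigID (fun J : {ffun 'I_k -> 'I_m} => injectiveb J)) /=.
rewrite [X in _ + X]big1 ?addr0; last first.
  move=> J /injectivePn[a [b neq_ab eJ]].
  by apply: (determinant_alternate neq_ab) => c; rewrite !mxE eJ.
rewrite (partition_big (fun J : {ffun 'I_k -> 'I_m} => [set J a | a in 'I_k])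
           (fun B => #|B| == k)) /=; last first.
  by move=> J /injectiveP injJ; rewrite card_imset // card_ord.
rewrite /elsym -sumrMnl; apply: eq_bigr => B /eqP cardB.
set D := (X in _ = X *+ _).
transitivity (\sum_(J : {ffun 'I_k -> 'I_m} |
                injectiveb J && ([set J a | a in 'I_k] == B)) D).
  apply: eq_bigr => J /andP[/injectiveP injJ /eqP defB].
  (* A left inverse of [ext_perm]; the default 1 is never reached on permutations supported in the
     image of J. *)
  pose inv (u : 'S_m) : 'S_k := odflt 1%g [pick s | u == ext_perm injJ s].
  rewrite /D; rewrite [RHS](reindex_onto (ext_perm injJ : 'S_k -> 'S_m) inv) /=; last first.
    rewrite /inv => u; rewrite -defB => /(ext_perm_onto injJ)[s ->].
    by case: pickP => [s' /eqP//|/(_ s)]; rewrite eqxx.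
  apply: eq_big => [s|s _].
    rewrite /inv -defB ext_perm_on; case: pickP => [s' /eqP/ext_perm_inj-> |/(_ s)].
      by rewrite eqxx.
    by rewrite eqxx.
  rewrite odd_ext_perm; congr (_ * _); rewrite -defB big_imset /=; last first.
    by move=> a b _ _; apply: injJ.
  by apply: eq_bigr => a _; rewrite mxE ext_permE.
rewrite sumr_const; congr (_ *+ _).
have -> : k`! = (#|mem B| ^_ #|'I_k|)%N by rewrite card_ord cardB ffactnn.
rewrite -card_inj_ffuns_on; apply: eq_card => J; rewrite !inE.
apply/idP/idP.
  rewrite unfold_in => /andP[-> /eqP<-]; rewrite andbT; apply/ffun_onP => a; exact: imset_f.
case/andP=> /ffun_onP hJ injJ; rewrite unfold_in injJ /= eqEcard cardB.
rewrite card_imset ?card_ord ?leqnn ?andbT; last exact/injectiveP.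
by apply/subsetP => x /imsetP[a _ ->].
Qed.

End PrincipalMinors.

Lemma det_mxdiag (A : comNzRingType) n (p_ : 'I_n -> nat) (B_ : forall i, 'M[A]_(p_ i)) :
  \det (\mxdiag_i B_ i) = \prod_i \det (B_ i).
Proof.
have det_cast m m' (e1 e2 : m = m') (M : 'M[A]_m) : \det (castmx (e1, e2) M) = \det M.
  by case: _ / e1 e2 => e2; rewrite castmx_id.
elim: n p_ B_ => [|n IH] p_ B_.
  (* With no blocks the size is an empty sum that does not reduce to 0, hence the detour through an
     equation on the size. *)
  have det0 q (M : 'M[A]_q) : q = 0 -> \det M = 1 by move=> q0; subst q; apply: det_mx00.
  by rewrite det0 !big_ord0.
by rewrite mxdiag_recl det_cast det_ublock IH big_ord_recl.
Qed.

Definition colored n k (mu : 'I_n -> int) (ka : {ffun 'I_k -> 'I_n}) : bool :=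
  [forall c, #|[set a | ka a == c]|%:Z == mu c].

Definition fixes n k (s : 'S_k) (ka : {ffun 'I_k -> 'I_n}) : bool :=
  [forall a, ka (s a) == ka a].

(* The character at s of S_k acting on the colorings of content mu, which is 0 when
   mu has a negative entry. *)
Definition hfix n k (mu : 'I_n -> int) (s : 'S_k) : nat :=
  #|[set ka : {ffun 'I_k -> 'I_n} | fixes s ka & colored mu ka]|.

Lemma elsym_gt (A : comNzRingType) m (N : 'M[A]_m) j : (m < j)%N -> elsym N j = 0.
Proof.
move=> lt_mj; rewrite /elsym big_pred0 // => B; apply: contraTF lt_mj => /eqP<-.
by rewrite -leqNgt -[X in (_ <= X)%N]card_ord max_card.
Qed.

Lemma elsymZ (A : comNzRingType) m (N : 'M[A]_m) c j : elsym (c *: N) j = c ^+ j * elsym N j.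
Proof.
rewrite /elsym mulr_sumr; apply: eq_bigr => B /eqP <-; rewrite mulr_sumr.
apply: eq_bigr => s _; rewrite mulrCA; congr (_ * _).
by rewrite -prodr_const -big_split /=; apply: eq_bigr => a _; rewrite mxE.
Qed.

Lemma elsym_map (A A' : comNzRingType) (f : {rmorphism A -> A'}) m (N : 'M[A]_m) j :
  elsym (map_mx f N) j = f (elsym N j).
Proof.
rewrite rmorph_sum; apply: eq_bigr => B _; rewrite rmorph_sum; apply: eq_bigr => s _.
rewrite rmorphM rmorph_sign rmorph_prod; congr (_ * _); apply: eq_bigr => a _.
by rewrite mxE.
Qed.

(** * Products of elementary symmetric functions as signed character sums *)

Section EsymProduct.
Import mpoly.
Variables (A : comNzRingType) (m n k : nat) (N : 'M[A]_m) (mu : 'I_n -> nat).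
Hypothesis sum_mu : (\sum_c mu c)%N = k.

Let P := {mpoly A[n]}.
(** The c-th copy of N is scaled by its own variable, so that monomials record how many indices fall
    in each copy. *)
Let Nhat : 'M[P]_(\sum_(c < n) m) := \mxdiag_(c < n) ('X_c *: map_mx (@mpolyC n A) N).
Let mm : 'X_{1..n} := [multinom mu i | i < n].

Let NhatE u v : Nhat u v = if tagnat.sig1 u == tagnat.sig1 v then
   'X_(tagnat.sig1 u) * (N (tagnat.sig2 u) (tagnat.sig2 v))%:MP else 0.
Proof.
rewrite /Nhat mxE; case: eqVneq => [e|_]; last by rewrite mxE.
by rewrite conform_mx_id !mxE e.
Qed.

Let mcoeffXC (q : A) (e : 'X_{1..n}) : ('X_[e] * q%:MP : P)@_mm = (e == mm)%:R * q.
Proof. by rewrite mulrC mcoeffCM mcoeffX mulrC. Qed.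

Let mdeg_mm : mdeg mm = k.
Proof. by rewrite mdegE -sum_mu; apply: eq_bigr => i _; rewrite mnmE. Qed.

(** The j-th elementary symmetric function of [Nhat] is homogeneous of degree j in the variables,
    while [mm] has degree k. *)
Let mcoeff_elsym j : j != k -> (elsym Nhat j)@_mm = 0.
Proof.
move=> neq_jk; rewrite /elsym raddf_sum big1 // => B /eqP cardB.
rewrite raddf_sum big1 //= => s _.
rewrite mulr_sign (fun_if (mcoeff mm)) mcoeffN.
suff -> : (\prod_(a in B) Nhat a (s a))@_mm = 0 by rewrite oppr0 if_same.
case: (boolP [forall (a | a \in B), tagnat.sig1 a == tagnat.sig1 (s a)]) => [/forall_inP h|]; last first.
  by move/forall_inPn=> [a aB ha]; rewrite (bigD1 a) //= NhatE (negPf ha) mul0r mcoeff0.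
under eq_bigr => a aB do rewrite NhatE h //.
rewrite big_split /= mprodXE -rmorph_prod mcoeffXC; case: eqP => [e|]; last by rewrite mul0r.
case/eqP: neq_jk; rewrite -mdeg_mm -e mdeg_sum -cardB -sum1_card.
by apply: eq_bigr => a _; rewrite mdeg1.
Qed.

(** The determinant factors over the blocks, the c-th factor being a polynomial in 'X_c with
    coefficients [elsym N j]. At most one choice of degrees gives [mm]; there is none when some
    [mu c] exceeds m, and then the right-hand side vanishes as well. *)
Let mcoeff_det : (\det (1%:M + Nhat))@_mm = \prod_c elsym N (mu c).
Proof.
have -> : 1%:M + Nhat = \mxdiag_(c < n) (1%:M + 'X_c *: map_mx (@mpolyC n A) N).
  by rewrite mxdiagD mxdiagZ.
rewrite det_mxdiag.
under eq_bigr => c _.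
  rewrite det1D.
  under eq_bigr => j _ do rewrite elsymZ (elsym_map (@mpolyC n A)).
  over.
rewrite bigA_distr_bigA raddf_sum /=.
have E (f : {ffun 'I_n -> 'I_m.+1}) : (\prod_i ('X_i ^+ f i * (elsym N (f i))%:MP) : P)@_mm
    = ([multinom (f i : nat) | i < n] == mm)%:R * \prod_i elsym N (f i).
  rewrite big_split /= -rmorph_prod -mcoeffXC; congr (_ * _)@__.
  by rewrite mpolyXE_id; apply: eq_bigr => i _; rewrite mnmE.
under eq_bigr do rewrite E.
case: (boolP [forall c, (mu c < m.+1)%N]) => [/forallP h|/forallPn[c]].
  pose f0 := [ffun c => Ordinal (h c)].
  rewrite (bigD1 f0) //= [X in _ + X]big1 ?addr0; last first.
    move=> f nf; case: eqP => [/mnmP e|]; last by rewrite mul0r.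
    by move/negP: nf; case; apply/eqP/ffunP => c; apply: val_inj; rewrite ffunE /=; have := e c; rewrite !mnmE.
  have -> : [multinom (f0 i : nat) | i < n] = mm by apply/mnmP => c; rewrite !mnmE ffunE.
  by rewrite eqxx mul1r; apply: eq_bigr => c _; rewrite ffunE.
rewrite -leqNgt => lt; rewrite (bigD1 c) //= elsym_gt // mul0r big1 // => f _.
case: eqP => [/mnmP/(_ c)|]; last by rewrite mul0r.
by rewrite !mnmE => e; have := ltn_ord (f c); rewrite e ltnS leqNgt lt.
Qed.

Let mcoeff_elsymk : (elsym Nhat k)@_mm = \prod_c elsym N (mu c).
Proof.
rewrite -mcoeff_det det1D [RHS]raddf_sum /=.
have [lt_k|le_k] := ltnP k (\sum_(c < n) m).+1.
  rewrite (bigD1 (Ordinal lt_k)) //= [X in _ = _ + X]big1 ?addr0 // => j nj.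
  exact: mcoeff_elsym.
rewrite [RHS]big1 => [|j _]; first by rewrite elsym_gt ?mcoeff0.
by apply: mcoeff_elsym; rewrite neq_ltn (leq_trans (ltn_ord j)).
Qed.

(** An index map into the block matrix is a coloring together with a map J. Off-diagonal blocks
    vanish, so the coloring must be constant along the cycles of s, and the monomial is then its
    content. *)
Let ptr_Nhat (s : 'S_k) : (ptr Nhat s)@_mm = (hfix (fun c => (mu c)%:Z) s)%:R * ptr N s.
Proof.
pose join (x : {ffun 'I_k -> 'I_n} * {ffun 'I_k -> 'I_m}) : {ffun 'I_k -> 'I_(\sum_(c < n) m)} :=
  [ffun a => tagnat.Rank (p_ := fun=> m) (x.1 a) (x.2 a)].
have sJ (x1 : {ffun 'I_k -> 'I_n}) (x2 : {ffun 'I_k -> 'I_m}) a :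
   (tagnat.sig1 (join (x1, x2) a) = x1 a) * (tagnat.sig2 (join (x1, x2) a) = x2 a).
  split; first by rewrite ffunE tagnat.Rank1K.
  by apply: val_inj; rewrite ffunE tagnat.Rank2K.
rewrite /ptr (reindex join) /=; last first.
  exists (fun J => ([ffun a => tagnat.sig1 (J a)], [ffun a => tagnat.sig2 (J a)])).
    by move=> [x1 x2] _; congr pair; apply/ffunP => a; rewrite ffunE !sJ.
  by move=> J _; apply/ffunP => a; rewrite !ffunE tagnat.sig2K.
rewrite -(pair_bigA _ (fun i j => \prod_a Nhat (join (i, j) a) (join (i, j) (s a)))) /=.
rewrite raddf_sum /= (bigID (fun ka => fixes s ka && colored (fun c => (mu c)%:Z) ka)) /=.
rewrite [X in _ + X]big1 ?addr0.
  rewrite (eq_bigr (fun=> \sum_(J : {ffun 'I_k -> 'I_m}) \prod_a N (J a) (J (s a)))).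
    rewrite sumr_const -[LHS]mulr_natl; congr (_%:R * _).
    by rewrite /hfix; apply: eq_card => ka; rewrite inE.
  move=> ka /andP[/forallP fx /forallP col]; rewrite raddf_sum; apply: eq_bigr => J _ /=.
  under eq_bigr => a _ do rewrite NhatE !sJ eq_sym (eqP (fx a)) eqxx.
  rewrite big_split /= mprodXE -rmorph_prod mcoeffXC; case: eqP => [|[]]; rewrite ?mul1r //.
  apply/mnmP => c; rewrite mnm_sumE mnmE; apply/eqP; rewrite -eqz_nat -(eqP (col c)).
  apply/eqP; congr Posz; rewrite -sum1_card [RHS]big_mkcond; apply: eq_bigr => a _.
  by rewrite mnm1E inE; case: eqP.
move=> ka; rewrite negb_and => nka; rewrite raddf_sum big1 // => J _ /=.
case: (boolP (fixes s ka)) nka => [/forallP fx /=|/forallPn[a fa] _]; last first.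
  by rewrite (bigD1 a) //= NhatE !sJ eq_sym (negPf fa) mul0r mcoeff0.
under eq_bigr => a _ do rewrite NhatE !sJ eq_sym (eqP (fx a)) eqxx.
rewrite big_split /= mprodXE -rmorph_prod mcoeffXC; case: eqP => [|_]; last by rewrite mul0r.
move=> /mnmP e /forallPn[c]; case/eqP; have := e c; rewrite mnm_sumE mnmE => <-.
congr Posz; rewrite -sum1_card [LHS]big_mkcond; apply: eq_bigr => a _.
by rewrite mnm1E inE; case: eqP.
Qed.

(* The coefficient of 'X_[mu] in det (1 + diag('X_c) (x) N), computed in two ways. *)
Lemma prod_elsym : (\prod_c elsym N (mu c)) *+ k`! =
  \sum_(s : 'S_k) (-1) ^+ s * (hfix (fun c => (mu c)%:Z) s)%:R * ptr N s.
Proof.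
rewrite -mcoeff_elsymk -mcoeffMn -elsym_ptr raddf_sum /=; apply: eq_bigr => s _.
by rewrite -mulrA -ptr_Nhat !mulr_sign; case: (odd_perm s); rewrite ?mcoeffN.
Qed.

End EsymProduct.

(** * The class function attached to a partition *)

Definition shifted k (lam : 'I_k -> nat) (w : 'S_k) (i : 'I_k) : int :=
  (lam i)%:Z - (i : nat)%:Z + (w i : nat)%:Z.

Definition nat_ext (A : nmodType) (c : nat -> A) (z : int) : A :=
  if z is Posz p then c p else 0.

(** The determinantal formula for the character of S_k indexed by [lam], with permutation characters
    of Young type. The conjugation of partitions caused by using elementary instead of complete
    functions shows up as the sign of s in [jacobi_trudi_ptr]. *)
Definition schur_class k (lam : 'I_k -> nat) (s : 'S_k) : int :=
  \sum_(w : 'S_k) (-1) ^+ w * (hfix (shifted lam w) s)%:Z.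

Lemma sum_shifted k (lam : 'I_k -> nat) (w : 'S_k) :
  \sum_i shifted lam w i = (\sum_i lam i)%N%:Z.
Proof.
rewrite /shifted big_split sumrB /=.
have <- : \sum_(i < k) (i : nat)%:Z = \sum_i (w i : nat)%:Z by rewrite (reindex_perm w).
by rewrite subrK; elim/big_ind2: _ => // x1 x2 y1 y2 -> ->.
Qed.

Lemma hfix_neg n k (mu : 'I_n -> int) (s : 'S_k) c : mu c < 0 -> hfix mu s = 0.
Proof.
move=> mu_c; apply: eq_card0 => ka; rewrite !inE; apply/negP => /andP[_ /forallP/(_ c)].
by move/eqP => e; rewrite -e ltNge in mu_c.
Qed.

Lemma eq_hfix n k (mu nu : 'I_n -> int) (s : 'S_k) : mu =1 nu -> hfix mu s = hfix nu s.
Proof.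
move=> e; apply: eq_card => ka; rewrite !inE; congr (_ && _).
by apply: eq_forallb => c; rewrite e.
Qed.

(** [prod_elsym] applies to each term w of the determinant; if some shifted index is negative, that
    term vanishes on both sides, by [nat_ext] on one and by [hfix_neg] on the other. *)
Lemma jacobi_trudi_ptr (A : comNzRingType) m k (N : 'M[A]_m) (lam : 'I_k -> nat) :
  (\sum_i lam i)%N = k ->
  \det (\matrix_(i < k, j < k) nat_ext (elsym N) ((lam i)%:Z - (i : nat)%:Z + (j : nat)%:Z)) *+ k`!
  = \sum_(s : 'S_k) (-1) ^+ s * (schur_class lam s)%:~R * ptr N s.
Proof.
move=> sum_lam; rewrite /determinant -sumrMnl.
transitivity (\sum_(w : 'S_k) \sum_(s : 'S_k)
   (-1) ^+ w * ((-1) ^+ s * (hfix (shifted lam w) s)%:R * ptr N s)).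
  apply: eq_bigr => w _; rewrite -mulr_sumr -mulrnAr; congr (_ * _).
  under eq_bigr do rewrite mxE.
  case: (boolP [forall i, 0 <= shifted lam w i]) => [/forallP h|/forallPn[i]].
    have e i : shifted lam w i = `|shifted lam w i|%N%:Z by rewrite gez0_abs.
    rewrite (eq_bigr (fun i => elsym N `|shifted lam w i|%N)); last first.
      by move=> i _; rewrite -/(shifted lam w i) {1}e.
    rewrite (@prod_elsym _ _ _ k).
      by apply: eq_bigr => s _; rewrite -(eq_hfix _ e).
    apply: etrans sum_lam; apply/eqP; rewrite -eqz_nat -(sum_shifted lam w).
    rewrite (eq_bigr (fun i => `|shifted lam w i|%N%:Z)) //.
    by apply/eqP; elim/big_ind2: _ => // x1 x2 y1 y2 <- <-.
  rewrite -ltNge => h; rewrite (bigD1 i) //= -/(shifted lam w i).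
  rewrite [RHS]big1 => [|s _]; last by rewrite (hfix_neg s h) mulr0 mul0r.
  by case: (shifted lam w i) h => //= p _; rewrite mul0r mul0rn.
rewrite exchange_big; apply: eq_bigr => s _ /=.
rewrite /schur_class rmorph_sum [X in _ = X * _]mulr_sumr mulr_suml; apply: eq_bigr => w _.
by rewrite rmorphM rmorph_sign /= [in RHS]mulrCA !mulrA.
Qed.

(** * Orbits of S_k on maps, and inner products of permutation characters *)

Section Burnside.
Variables (X : finType) (k D : nat).
Hypothesis le_kD : (k <= D)%N.

(** Multiplicities live in ['I_D.+1] so that contents form a finite type; [k <= D] keeps [inord]
    from truncating. *)
Definition content (g : {ffun 'I_k -> X}) : {ffun X -> 'I_D.+1} :=
  [ffun x => inord #|[set a | g a == x]|].

Lemma contentE g x : content g x = #|[set a | g a == x]| :> nat.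
Proof.
rewrite ffunE inordK // ltnS (leq_trans _ le_kD) //.
by rewrite -[X in (_ <= X)%N]card_ord max_card.
Qed.

Lemma content_perm (g : {ffun 'I_k -> X}) (s : 'S_k) : content [ffun a => g (s a)] = content g.
Proof.
apply/ffunP => x; apply: val_inj; rewrite /= !contentE -!sum1dep_card.
rewrite [RHS](reindex_inj (@perm_inj _ s)) /=; apply: eq_bigl => a; by rewrite ffunE.
Qed.

Lemma content_inj_perm (g g' : {ffun 'I_k -> X}) : content g = content g' ->
  exists s : 'S_k, g' = [ffun a => g (s a)].
Proof.
move=> e.
have /tuple_permP[s es] : perm_eq [tuple g' a | a < k] [tuple g a | a < k].
  have cnt (f : {ffun 'I_k -> X}) x : count_mem x [tuple f a | a < k] = content f x.
    rewrite contentE -sum1dep_card -sum1_count big_map big_enum_cond /=.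
    by apply: eq_bigl => a; rewrite ?inE.
  by rewrite /perm_eq; apply/allP => x _ /=; rewrite !cnt e.
exists s; apply/ffunP => a; rewrite ffunE.
by have := congr1 (fun t => tnth t a) (val_inj es); rewrite !tnth_mktuple.
Qed.

Lemma content_onto (nu : {ffun X -> 'I_D.+1}) : (\sum_x nu x)%N = k ->
  exists g, content g = nu.
Proof.
move=> sum_nu; pose q := flatten [seq nseq (nu x) x | x <- enum X].
have size_q : size q == k.
  rewrite size_flatten sumnE big_map -sum_nu big_map big_enum /=.
  by apply/eqP; apply: eq_bigr => x _; rewrite size_nseq.
exists [ffun a => tnth (Tuple size_q) a]; apply/ffunP => x; apply: val_inj.
rewrite /= contentE -sum1dep_card.
under eq_bigl do rewrite ffunE.
transitivity (count_mem x (Tuple size_q)); first by rewrite -sum1_count big_tuple.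
rewrite /= count_flatten sumnE big_map big_map big_enum /= (bigD1 x) //= count_nseq /= eqxx mul1n.
rewrite big1 ?addn0 // => y /negPf ny; by rewrite count_nseq /= ny.
Qed.

(** The maps of content nu form a single orbit. The stabilizer of g is a translate of the set of
    permutations that carry a base point g0 to g, and these sets partition S_k as g runs over the
    orbit. *)
Lemma burnside (nu : {ffun X -> 'I_D.+1}) : (\sum_x nu x)%N = k ->
  (\sum_(g | content g == nu) #|[set s : 'S_k | [ffun a => g (s a)] == g]|)%N = k`!.
Proof.
case/content_onto=> g0 def_nu.
transitivity (\sum_(g | content g == nu) #|[set u : 'S_k | [ffun a => g0 (u a)] == g]|)%N.
  apply: eq_bigr => g /eqP cg.
  have [t def_g] : exists t : 'S_k, g = [ffun a => g0 (t a)].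
    by apply: content_inj_perm; rewrite def_nu cg.
  rewrite -(card_imset _ (@mulIg _ t)); apply: eq_card => u; rewrite inE.
  apply/imsetP/eqP => [[s]|].
    rewrite inE => /eqP e ->; rewrite -[RHS]e; apply/ffunP => a.
    by rewrite def_g !ffunE permM.
  move=> e; exists (u * t^-1)%g; last by rewrite mulgKV.
  rewrite inE; apply/eqP/ffunP => a.
  by rewrite -[in RHS]e def_g !ffunE permM permKV.
under eq_bigr do rewrite -sum1dep_card.
rewrite (exchange_big_dep xpredT) //= -[RHS](card_Sn k) -sum1_card.
apply: eq_big => [u|u _]; first by rewrite inE.
rewrite (big_pred1 [ffun a => g0 (u a)]) // => g /=.
apply/andP/eqP => [[_]|->]; first by move/eqP->.
by rewrite content_perm def_nu !eqxx.
Qed.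

End Burnside.

Definition margins k D (mu nu : 'I_k -> int) (F : {ffun 'I_k * 'I_k -> 'I_D.+1}) : bool :=
  [forall i, (\sum_c F (i, c))%N%:Z == mu i] && [forall c, (\sum_i F (i, c))%N%:Z == nu c].

(* D only bounds the entries, to keep the type of matrices finite. *)
Definition nmat k D (mu nu : 'I_k -> int) : nat := #|[set F | @margins k D mu nu F]|.

Lemma nmat_neg k D (mu nu : 'I_k -> int) c : nu c < 0 -> nmat D mu nu = 0.
Proof.
move=> nu_c; apply: eq_card0 => F; rewrite !inE; apply/negP => /andP[_ /forallP/(_ c)].
by move/eqP => e; rewrite -e ltNge in nu_c.
Qed.

(** A pair of colorings fixed by s is one s-invariant map into pairs of colors. Its content is a
    matrix with margins mu and nu, and [burnside] gives k! for each such matrix. *)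
Lemma sum_hfix2 k D (mu nu : 'I_k -> int) : (k <= D)%N -> \sum_i mu i = k%:Z ->
  (\sum_(s : 'S_k) hfix mu s * hfix nu s)%N = (nmat D mu nu * k`!)%N.
Proof.
move=> le_kD sum_mu.
pose fst_ (g : {ffun 'I_k -> 'I_k * 'I_k}) := [ffun a => (g a).1].
pose snd_ (g : {ffun 'I_k -> 'I_k * 'I_k}) := [ffun a => (g a).2].
pose good (g : {ffun 'I_k -> 'I_k * 'I_k}) := colored mu (fst_ g) && colored nu (snd_ g).
have goodE g : good g = margins mu nu (content D g).
  congr (_ && _); apply: eq_forallb => i; congr (Posz _ == _).
    under [RHS]eq_bigr do rewrite contentE // -sum1dep_card.
    rewrite -sum1dep_card (partition_big (snd_ g) xpredT) //=.
    by apply: eq_bigr => c _; apply: eq_bigl => a; rewrite !ffunE.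
  under [RHS]eq_bigr do rewrite contentE // -sum1dep_card.
  rewrite -sum1dep_card (partition_big (fst_ g) xpredT) //=.
  by apply: eq_bigr => c _; apply: eq_bigl => a; rewrite !ffunE andbC.
transitivity (\sum_(s : 'S_k) \sum_(g | good g) ([ffun a => g (s a)] == g : nat))%N.
  apply: eq_bigr => s _; rewrite /hfix -!sum1dep_card big_distrlr /=.
  rewrite pair_big /= -big_mkcondr /=.
  rewrite (reindex (fun g => (fst_ g, snd_ g))) /=; last first.
    exists (fun x : {ffun 'I_k -> 'I_k} * {ffun 'I_k -> 'I_k} => [ffun a => (x.1 a, x.2 a)]).
      by move=> g _; apply/ffunP => a; rewrite !ffunE; case: (g a).
    by case=> x1 x2 _; congr pair; apply/ffunP => a; rewrite !ffunE.
  apply: eq_big => [g|//]; rewrite /good.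
  have -> : ([ffun a => g (s a)] == g) = fixes s (fst_ g) && fixes s (snd_ g).
    apply/eqP/andP => [e|[/forallP h1 /forallP h2]].
      by split; apply/forallP => a; rewrite !ffunE -{2}e ffunE.
    apply/ffunP => a; rewrite ffunE; move/eqP: (h1 a); move/eqP: (h2 a).
    by rewrite !ffunE; case: (g a) (g (s a)) => ? ? [? ?] /= -> ->.
  by rewrite andbACA andbC.
rewrite exchange_big /=.
transitivity (\sum_(g | good g) #|[set s : 'S_k | [ffun a => g (s a)] == g]|)%N.
  by apply: eq_bigr => g _; rewrite -sum1dep_card [RHS]big_mkcond.
rewrite (partition_big (content D) (margins mu nu)) => [|g]; last by rewrite goodE.
rewrite /nmat -sum1dep_card big_distrl /=; apply: eq_bigr => F mF; rewrite mul1n.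
rewrite -(burnside le_kD (nu := F)) /=.
  apply: eq_bigl => g; rewrite goodE; case: eqP => [->|_]; by rewrite ?mF ?andbF.
apply/eqP; rewrite -eqz_nat -sum_mu; apply/eqP.
case/andP: mF => /forallP h _.
have -> : (\sum_x F x)%N = (\sum_i \sum_c F (i, c))%N by rewrite pair_bigA; apply: eq_bigr => -[].
rewrite [RHS](eq_bigr (fun i => (\sum_c F (i, c))%N%:Z)) => [|i _]; last by rewrite (eqP (h i)).
by elim/big_ind2: _ => // x1 x2 y1 y2 <- <-.
Qed.

Lemma det_unitrig (A : comNzRingType) k (M : 'M[A]_k) :
  (forall i j : 'I_k, (j < i)%N -> M i j = 0) -> (forall i, M i i = 1) -> \det M = 1.
Proof.
move=> M0 M1; rewrite -det_tr det_trig; first by rewrite big1 // => i _; rewrite mxE M1.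
by apply/is_trig_mxP => i j ij; rewrite mxE M0.
Qed.

(** * The bialternant formula *)

Section JacobiTrudi.
Variables (A : comNzRingType) (k D : nat) (x : 'I_k -> A).

(* Truncated generating series of the complete symmetric functions: exact up to
   degree D. *)
Definition hpoly : {poly A} := \prod_c \sum_(s < D.+1) (x c *: 'X) ^+ s.

(* Its coefficients are the signed elementary symmetric functions of the x c, c != m. *)
Definition omit (m : 'I_k) : {poly A} := \prod_(c | c != m) (1 - x c *: 'X).

(** This bound makes the coefficient matrix of the polynomials [omit m] square. *)
Lemma size_omit m : (size (omit m) <= k)%N.
Proof.
rewrite /omit; apply: leq_trans (size_poly_prod_leq _ _) _.
have le2 : (\sum_(c | c != m) size (1 - x c *: 'X)%R <= \sum_(c | c != m) 2)%N.
  apply: leq_sum => c _; apply: leq_trans (size_polyD _ _) _.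
  rewrite size_polyN geq_max size_poly1 /=.
  by apply: leq_trans (size_scale_leq _ _) _; rewrite size_polyX.
have ck : #|[pred c | c != m]|.+1 = k.
  by have := cardC1 m; rewrite card_ord => ->; rewrite (ltn_predK (ltn_ord m)).
rewrite leq_subLR; apply: leq_trans (_ : (\sum_(c | c != m) 2).+1 <= _)%N => //.
rewrite sum_nat_const muln2 -addnn -addnS leq_add2l.
by have -> : #|(fun c => c != m)| = #|[pred c | c != m]| by []; rewrite ck.
Qed.

(** Each factor with c != m telescopes to [1 - (x c *: 'X) ^+ D.+1], which is 1 up to degree D; only
    the geometric sum of [x m] remains. *)
Lemma hpoly_omit m l : (l <= D)%N -> (hpoly * omit m)`_l = x m ^+ l.
Proof.
move=> le_lD; rewrite /hpoly (bigD1 m) //= -mulrA /omit -big_split /=.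
have [R ->] : exists R, \prod_(c | c != m) ((\sum_(s < D.+1) (x c *: 'X) ^+ s) * (1 - x c *: 'X))
     = 1 + 'X^(D.+1) * R :> {poly A}.
  elim/big_ind: _ => [|p q [R1 ->] [R2 ->]|c _].
  - by exists 0; rewrite mulr0 addr0.
  - exists (R1 + R2 + R1 * ('X^(D.+1) * R2)).
    by rewrite mulrDl mul1r mulrDr mulr1 !mulrDr -!addrA !mulrA; congr (_ + _); rewrite addrCA.
  exists (- (x c ^+ D.+1)%:P).
  by rewrite mulrC -opprB mulNr -subrX1 opprB exprZn mulrN mulrC mul_polyC.
rewrite mulrDr mulr1 coefD mulrCA coefXnM ltnS le_lD addr0 coef_sum.
rewrite (bigD1 (Ordinal (le_lD : (l < D.+1)%N))) //= exprZn coefZ coefXn eqxx mulr1.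
rewrite big1 ?addr0 // => s ns; rewrite exprZn coefZ coefXn.
by rewrite eq_sym (negPf (ns : (s : nat) != l)) mulr0.
Qed.

Definition jt_mx (lam : 'I_k -> nat) : 'M[A]_k :=
  \matrix_(i, j) nat_ext (fun p => hpoly`_p) ((lam i)%:Z - (i : nat)%:Z + (j : nat)%:Z).

Definition alternant (lam : 'I_k -> nat) : 'M[A]_k :=
  \matrix_(i, m) x m ^+ (lam i + (k - i.+1)).

Let omit_mx : 'M[A]_k := \matrix_(j, m) (omit m)`_(k - j.+1).

(** Entry (i, m) is a convolution, namely the coefficient of degree lam_i + k - 1 - i of
    [hpoly * omit m]. The bound on lam keeps this degree within the truncation. *)
Lemma jt_mx_omit (lam : 'I_k -> nat) : (forall i, lam i + k <= D)%N ->
  jt_mx lam *m omit_mx = alternant lam.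
Proof.
move=> lamD; apply/matrixP => i m; rewrite !mxE; set l := (lam i + (k - i.+1))%N.
pose G s := nat_ext (fun p => hpoly`_p) (l%:Z - s%:Z) * (omit m)`_s.
(* Both cut-offs are harmless: G vanishes from k on by the degree of [omit m], and beyond l because
   the index of [hpoly] is negative. The sums of k and of l + 1 terms are compared through one of k
   + l + 1 terms. *)
have sumG a b : (forall s, (a <= s)%N -> G s = 0) -> \sum_(s < a) G s = \sum_(s < a + b) G s.
  move=> G0; rewrite big_split_ord /= [X in _ = _ + X]big1 ?addr0 // => s _.
  by rewrite G0 // leq_addr.
transitivity (\sum_(s < k) G s).
  rewrite (reindex_inj rev_ord_inj) /=; apply: eq_bigr => s _; rewrite !mxE /G.
  rewrite [(k - _)%N](congr1 val (rev_ordK s) : _ = s :> nat) /=.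
  congr (nat_ext _ _ * _); have := ltn_ord i; have := ltn_ord s; rewrite /l; lia.
rewrite (sumG k l.+1); last by move=> s le_ks; rewrite /G nth_default ?mulr0 // (leq_trans (size_omit m)).
rewrite addnC -sumG; last first.
  move=> s lt_ls; rewrite /G -opprB subzn; last exact: ltnW.
  by case: (s - l)%N (subn_gt0 l s) => [|p _]; rewrite ?lt_ls //= mul0r.
rewrite -(@hpoly_omit m l); last by rewrite (leq_trans _ (lamD i)) // leq_add2l leq_subr.
rewrite coefMr; apply: eq_bigr => s _; rewrite /G subzn ?leq_ord //.
Qed.

(** [jt_mx_omit] is used twice: for lam, and for the zero partition, whose Jacobi-Trudi matrix is
    unitriangular. The second use identifies the determinant of [omit_mx] with the Vandermonde
    determinant. *)
Lemma det_jt_mx (lam : 'I_k -> nat) : (forall i, lam i + k <= D)%N ->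
  \det (jt_mx lam) * \det (alternant (fun=> 0%N)) = \det (alternant lam).
Proof.
move=> lamD; rewrite -(jt_mx_omit lamD) det_mulmx; congr (_ * _).
rewrite -jt_mx_omit => [|i]; last by rewrite (leq_trans _ (lamD i)) // leq_addl.
rewrite det_mulmx det_unitrig ?mul1r // => [i j ij|i]; rewrite mxE sub0r addrC.
  rewrite -opprB subzn; last exact: ltnW.
  by case: (i - j)%N (subn_gt0 j i); rewrite ?ij.
rewrite subrr /= /hpoly -horner_coef0 horner_prod big1 // => c _.
rewrite horner_sum big_ord_recl expr0 hornerC big1 ?addr0 // => s _.
by rewrite exprS hornerM hornerZ hornerX mulr0 mul0r.
Qed.

End JacobiTrudi.

(** * Norm of the class function *)

Section Norm.
Import mpoly.
Variables (k : nat) (lam : 'I_k -> nat).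
Hypothesis lam_anti : forall i j : 'I_k, (i <= j)%N -> (lam j <= lam i)%N.
Hypothesis sum_lam : (\sum_i lam i)%N = k.

(** Since every [lam i] is at most k, this covers the degrees [lam i + k] of the bialternant
    formula. *)
Let D := (k + k)%N.
Let P := {mpoly int[k]}.
Let x (c : 'I_k) : P := 'X_c.
Let mnm_of (nu : {ffun 'I_k -> 'I_D.+1}) : 'X_{1..k} := [multinom (nu c : nat) | c < k].

Let hpolyE z : nat_ext (fun p => (hpoly D x)`_p) z =
  \sum_(nu : {ffun 'I_k -> 'I_D.+1} | (\sum_c nu c)%N%:Z == z) 'X_[mnm_of nu].
Proof.
have E : hpoly D x = \sum_(nu : {ffun 'I_k -> 'I_D.+1}) 'X_[mnm_of nu] *: 'X^(\sum_c nu c).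
  rewrite /hpoly bigA_distr_bigA /=; apply: eq_bigr => nu _.
  under eq_bigr do rewrite exprZn.
  rewrite scaler_prod mpolyXE_id -prodrXr; congr (_ *: _).
  by apply: eq_bigr => c _; rewrite mnmE.
case: z => [p|p] /=; last by rewrite big_pred0.
rewrite E coef_sum [RHS]big_mkcond; apply: eq_bigr => nu _.
by rewrite coefZ coefXn eqz_nat eq_sym; case: eqP; rewrite ?mulr1 ?mulr0.
Qed.

(** Choosing a monomial in each factor means choosing the rows of a matrix; its column sums are the
    exponents of the product. *)
Let mcoeff_hprod (mu : 'I_k -> int) (e : 'X_{1..k}) :
  (\prod_i nat_ext (fun p => (hpoly D x)`_p) (mu i))@_e = (nmat D mu (fun c => (e c)%:Z))%:Z.
Proof.
under eq_bigr do rewrite hpolyE.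
rewrite (bigA_distr_big_dep (fun i (nu : {ffun 'I_k -> 'I_D.+1}) => (\sum_c nu c)%N%:Z == mu i)) /= raddf_sum /=.
under eq_bigr do rewrite mprodXE mcoeffX.
pose curry (F : {ffun 'I_k * 'I_k -> 'I_D.+1}) : {ffun 'I_k -> {ffun 'I_k -> 'I_D.+1}} :=
  [ffun i => [ffun c => F (i, c)]].
rewrite (reindex curry) /=; last first.
  exists (fun G : {ffun 'I_k -> {ffun 'I_k -> 'I_D.+1}} => [ffun y => G y.1 y.2]).
    by move=> F _; apply/ffunP => -[i c]; rewrite !ffunE.
  by move=> G _; apply/ffunP => i; apply/ffunP => c; rewrite !ffunE.
rewrite /nmat -sum1dep_card.
rewrite (big_morph Posz PoszD (erefl 0%:Z)) [LHS]big_mkcond [RHS]big_mkcond; apply: eq_bigr => F _.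
rewrite /margins; have -> : (curry F \in family (fun i (nu : {ffun 'I_k -> 'I_D.+1}) => (\sum_c nu c)%N%:Z == mu i)) =
   [forall i, (\sum_c F (i, c))%N%:Z == mu i].
  have E i : (\sum_c curry F i c)%N = (\sum_c F (i, c))%N by apply: eq_bigr => c _; rewrite !ffunE.
  by apply/familyP/forallP => h i; have := h i; rewrite -E.
case: [forall i, _] => //=.
have -> : ((\sum_i mnm_of (curry F i))%MM == e) = [forall c, (\sum_i F (i, c))%N%:Z == (e c)%:Z].
  apply/eqP/forallP => [<- c|h].
    by rewrite mnm_sumE eqz_nat; apply/eqP; apply: eq_bigr => i _; rewrite mnmE !ffunE.
  apply/mnmP => c; have := h c; rewrite eqz_nat => /eqP <-.
  by rewrite mnm_sumE; apply: eq_bigr => i _; rewrite mnmE !ffunE.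
by case: [forall c, _].
Qed.

Let lam_le i : (lam i <= k)%N.
Proof. by rewrite -[X in (_ <= X)%N]sum_lam (bigD1 i) //= leq_addr. Qed.

Let lamD i : (lam i + k <= D)%N.
Proof. by rewrite leq_add2r. Qed.

Let l : 'X_{1..k} := [multinom (lam i + (k - i.+1))%N | i < k].

Let l_inj : injective l.
Proof.
have mono (i j : 'I_k) : (i < j)%N -> (l j < l i)%N.
  move=> ij; rewrite !mnmE; have := lam_anti (ltnW ij); have := ltn_ord j; lia.
move=> i j e; apply: val_inj; case: (ltngtP i j) => // /mono; rewrite e; by rewrite ltnn.
Qed.

Let mcoeffMX_out (p : P) (e f : 'X_{1..k}) : ~~ (e <= f)%MM -> (p * 'X_[e])@_f = 0.
Proof.
move=> nle; rewrite mcoeffM big1 // => -[m1 m2] /= /eqP ef; rewrite mcoeffX.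
case: eqP => [e2|]; last by rewrite mulr0.
by case/negP: nle; rewrite ef -e2; apply/mnm_lepP => i; rewrite mnmDE leq_addl.
Qed.

(** The exponents lam_i + k - 1 - i are strictly decreasing, so permuting them nontrivially gives
    another monomial. *)
Let mcoeff_alternant : (\det (alternant x lam))@_l = 1.
Proof.
rewrite /determinant raddf_sum (bigD1 1%g) //= [X in _ + X]big1 ?addr0.
  rewrite odd_perm1 expr0 mul1r.
  rewrite (_ : \prod_i _ = 'X_[l]) ?mcoeffX ?eqxx //.
  by rewrite mpolyXE_id; apply: eq_bigr => i _; rewrite mxE perm1 mnmE.
move=> w nw; rewrite mulr_sign (fun_if (mcoeff l)) mcoeffN.
have -> : \prod_i alternant x lam i (w i) = 'X_[[multinom l ((w^-1)%g c) | c < k]].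
  rewrite mpolyXE_id [RHS](reindex_perm w); apply: eq_bigr => i _.
  by rewrite mxE !mnmE !permK.
rewrite mcoeffX; case: eqP => [/mnmP e|]; last by rewrite oppr0 if_same.
move/eqP: nw; case; apply/permP => c; rewrite perm1; apply: l_inj.
by have := e (w c); rewrite mnmE permK.
Qed.

(** Dividing the monomial [l] by the Vandermonde term of w leaves the exponents lam_c - c + w(c),
    that is [shifted lam w]. *)
Let mcoeff_det_mul (p : P) : (p * \det (alternant x (fun=> 0%N)))@_l =
  \sum_(w : 'S_k) (-1) ^+ w * (if [forall c, 0 <= shifted lam w c] then
     p@_[multinom `|shifted lam w c|%N | c < k] else 0).
Proof.
rewrite -det_tr /determinant mulr_sumr raddf_sum; apply: eq_bigr => w _ /=.
rewrite mulrCA !mulr_sign (fun_if (mcoeff l)) mcoeffN.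
have -> : \prod_i (alternant x (fun=> 0%N))^T i (w i) = 'X_[[multinom (k - (w c).+1)%N | c < k]].
  by rewrite mpolyXE_id; apply: eq_bigr => i _; rewrite !mxE add0n mnmE.
set e := [multinom _ | c < k].
suff -> : (p * 'X_[e])@_l = (if [forall c, 0 <= shifted lam w c] then
     p@_[multinom `|shifted lam w c|%N | c < k] else 0) by [].
case: (boolP [forall c, _]) => [/forallP h|/forallPn[c hc]].
  set f := [multinom _ | c < k].
  have -> : l = (e + f)%MM.
    apply/mnmP => c; rewrite mnmDE !mnmE; move: (h c); rewrite /shifted.
    have := ltn_ord (w c); have := ltn_ord c; lia.
  by rewrite mcoeffMX.
apply: mcoeffMX_out; apply/mnm_lepP => /(_ c); rewrite !mnmE.
move: hc; rewrite /shifted; have := ltn_ord (w c); have := ltn_ord c; lia.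
Qed.

(** The sum of squares expands into signed counts of matrices with margins [shifted lam w'] and
    [shifted lam w]. Together they form the coefficient at [l] of the Jacobi-Trudi determinant times
    the Vandermonde determinant, hence of the alternant of lam, where it is 1. *)
Lemma schur_class_norm : \sum_(s : 'S_k) schur_class lam s ^+ 2 = k`!%:Z.
Proof.
transitivity (\sum_(w : 'S_k) \sum_(w' : 'S_k) (-1) ^+ w * ((-1) ^+ w' *
    (nmat D (shifted lam w') (shifted lam w) * k`!)%N%:Z)).
  under eq_bigr do rewrite expr2 {1}/schur_class mulr_suml.
  rewrite exchange_big /=; apply: eq_bigr => w _.
  under eq_bigr do rewrite /schur_class mulr_sumr.
  rewrite exchange_big /=; apply: eq_bigr => w' _.
  under eq_bigr do rewrite mulrACA -mulrA.
  rewrite -mulr_sumr -mulr_sumr; congr (_ * (_ * _)).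
  rewrite -sum_hfix2 ?leq_addr //; last by rewrite sum_shifted sum_lam.
  rewrite (big_morph Posz PoszD (erefl 0%:Z)); apply: eq_bigr => s _.
  by rewrite mulrC.
transitivity ((\det (jt_mx D x lam) * \det (alternant x (fun=> 0%N)))@_l * k`!%:Z); last first.
  by rewrite det_jt_mx // mcoeff_alternant mul1r.
rewrite mcoeff_det_mul mulr_suml; apply: eq_bigr => w _.
rewrite -mulrA -mulr_sumr; congr (_ * _).
case: (boolP [forall c, _]) => [/forallP h|/forallPn[c]].
  rewrite raddf_sum /= mulr_suml; apply: eq_bigr => w' _.
  rewrite PoszM mulrA; congr (_ * _).
  rewrite !mulr_sign (fun_if (mcoeff _)) mcoeffN.
  under eq_bigr do rewrite mxE.
  rewrite (mcoeff_hprod (shifted lam w')).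
  have -> : nmat D (shifted lam w') (shifted lam w) =
     nmat D (shifted lam w') (fun c => [multinom `|shifted lam w c|%N | c < k] c) => //.
  apply: eq_card => F; rewrite !inE; congr (_ && _); apply: eq_forallb => c.
  by rewrite mnmE gez0_abs.
rewrite -ltNge => hc; rewrite mul0r big1 // => w' _.
by rewrite (nmat_neg _ _ hc) mul0n mulr0.
Qed.

End Norm.

(** * Permutation representations on colorings *)

Section PermRepr.
Variables (n k : nat) (mu : 'I_n -> int).

Let T := {ka : {ffun 'I_k -> 'I_n} | colored mu ka}.

Lemma colored_perm (ka : {ffun 'I_k -> 'I_n}) (s : 'S_k) :
  colored mu [ffun a => ka (s a)] = colored mu ka.
Proof.
apply: eq_forallb => c; congr (Posz _ == _).
rewrite -!sum1dep_card [RHS](reindex_perm s) /=.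
by apply: eq_bigl => a; rewrite ffunE.
Qed.

(** The inverse turns precomposition into a right action, as matrix representations on row vectors
    require. *)
Definition recolor (s : 'S_k) (t : T) : T :=
  exist _ [ffun a => sval t ((s^-1)%g a)]
    (etrans (colored_perm (sval t) s^-1) (svalP t)).

Lemma recolorM s s' t : recolor (s * s')%g t = recolor s' (recolor s t).
Proof. by apply: val_inj; apply/ffunP => a; rewrite !ffunE invMg permM. Qed.

Lemma recolor1 t : recolor 1%g t = t.
Proof. by apply: val_inj; apply/ffunP => a; rewrite !ffunE invg1 perm1. Qed.

Definition recolor_mx (s : 'S_k) : 'M[algC]_#|{: T}| :=
  \matrix_(i, j) (enum_val j == recolor s (enum_val i))%:R.

Lemma recolor_mx_repr : mx_repr [set: 'S_k] recolor_mx.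
Proof.
split=> [|s s' _ _]; apply/matrixP => i j; rewrite !mxE.
  by rewrite recolor1 (inj_eq enum_val_inj) eq_sym.
rewrite (bigD1 (enum_rank (recolor s (enum_val i)))) //= !mxE enum_rankK eqxx mul1r.
rewrite -recolorM big1 ?addr0 // => j' nj'; rewrite mxE; case: eqP => [e|_]; last by rewrite mul0r.
by rewrite -e enum_valK eqxx in nj'.
Qed.

Definition recolor_repr := MxRepresentation recolor_mx_repr.

Lemma recolor_char s : cfRepr recolor_repr s = (hfix mu s)%:R.
Proof.
rewrite cfunE inE mulr1n /mxtrace.
under eq_bigr do rewrite mxE.
rewrite -natr_sum; congr (_%:R).
rewrite (reindex enum_rank) /=; last exact: onW_bij (enum_rank_bij T).
under eq_bigr do rewrite enum_rankK.
rewrite -big_mkcond sum1dep_card /hfix -(card_imset _ val_inj).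
apply: eq_card => ka; rewrite !inE; apply/imsetP/andP.
  case=> t; rewrite inE => /eqP e ->; split; last exact: (svalP t).
  apply/forallP => a; move/(congr1 val)/ffunP/(_ (s a)): e => /=.
  by rewrite ffunE permK => ->.
case=> /forallP fx col; exists (exist _ ka col) => //; rewrite inE; apply/eqP.
by apply: val_inj; apply/ffunP => a; rewrite /= ffunE -[in LHS](permKV s a); apply/eqP/fx.
Qed.

End PermRepr.

(** * Irreducibility up to sign and the convolution identity *)

Section SchurChar.
Variables (k : nat) (lam : 'I_k -> nat).
Hypothesis lam_anti : forall i j : 'I_k, (i <= j)%N -> (lam j <= lam i)%N.
Hypothesis sum_lam : (\sum_i lam i)%N = k.

Lemma schur_classV s : schur_class lam s^-1 = schur_class lam s.
Proof.
apply: eq_bigr => w _; congr (_ * Posz _); apply: eq_card => ka; rewrite !inE; congr (_ && _).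
apply/forallP/forallP => h a.
  by have := h (s a); rewrite permK eq_sym.
by have := h ((s^-1)%g a); rewrite permKV eq_sym.
Qed.

Let phi : 'CF([set: 'S_k]) :=
  \sum_(w : 'S_k) (-1) ^+ w *: cfRepr (recolor_repr k (shifted lam w)).

Let phiE s : phi s = (schur_class lam s)%:~R.
Proof.
rewrite /phi sum_cfunE /schur_class rmorph_sum; apply: eq_bigr => w _.
by rewrite cfunE recolor_char rmorphM rmorph_sign.
Qed.

(** A virtual character of norm one is plus or minus an irreducible character. *)
Lemma schur_class_irr : exists (b : bool) (i : Iirr [set: 'S_k]), 
  forall s, (schur_class lam s)%:~R = (-1) ^+ b * 'chi_i s.
Proof.
have [||b [i def_phi]] := @vchar_norm1P _ _ phi.
- by apply: rpred_sum => w _; rewrite rpredZsign char_vchar // cfRepr_char.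
- rewrite cfdotE; under eq_bigr do rewrite phiE rmorph_int -intrM -expr2.
  have -> : \sum_(s in [set: 'S_k]) (schur_class lam s ^+ 2)%:~R =
     (\sum_(s : 'S_k) schur_class lam s ^+ 2)%:~R :> algC.
    by rewrite rmorph_sum; apply: eq_bigl => s; rewrite inE.
  rewrite schur_class_norm // cardsT card_Sn mulVf //.
  by rewrite pnatr_eq0 -lt0n fact_gt0.
by exists b, i => s; rewrite -phiE def_phi cfunE.
Qed.

(** Generalized orthogonality relation for one irreducible character. The sign b is unknown here, so
    d = f(1) is only known to be nonzero. *)
Lemma schur_class_conv : exists d : int, d != 0 /\
  forall y, d * \sum_x schur_class lam (x * y)%g * schur_class lam x = k`!%:Z * schur_class lam y.
Proof.
have [b [i fE]] := schur_class_irr.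
have chi1 : (schur_class lam 1%g)%:~R != 0 :> algC.
  by rewrite fE mulf_neq0 ?signr_eq0 ?irr1_neq0.
exists (schur_class lam 1%g); split=> [|y]; first by rewrite intr_eq0 in chi1.
have := generalized_orthogonality_relation y i i; rewrite eqxx mul1r cardsT card_Sn => E.
apply: (@intr_inj algC); rewrite !intrM [X in _ * X]rmorph_sum /= !fE.
transitivity ((-1) ^+ b * 'chi_i 1%g * \sum_(x in [set: 'S_k]) 'chi_i (x * y)%g * 'chi_i (x^-1)%g).
  congr (_ * _); apply: eq_big => [x|x _]; first by rewrite inE.
  (* Invariance under inversion supplies the inverse that the orthogonality relation expects, and
     the two signs cancel. *)
  rewrite intrM -(schur_classV x) !fE mulrACA -expr2 sqrr_sign mul1r //.
have kneq : k`!%:R != 0 :> algC by rewrite pnatr_eq0 -lt0n fact_gt0.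
rewrite -(mulVKf kneq (\sum_(x in _) _)) E.
rewrite -pmulrn; move: (irr1_neq0 i); set c := _ ^+ _; set u := 'chi_i 1%g.
by move=> u0; rewrite -mulrA [u * _]mulrC -mulrA [_ / u * u]divfK // mulrCA.
Qed.

End SchurChar.

(** * Lowest-order term of the Jacobi-Trudi determinant *)

Lemma leq_sum_perm_initial k (A : {set 'I_k}) (w : 'S_k) :
  (forall i j : 'I_k, (i <= j)%N -> j \in A -> i \in A) ->
  (\sum_(i in A) i <= \sum_(i in A) w i)%N.
Proof.
move=> downA; pose B := w @: A.
have -> : (\sum_(i in A) w i = \sum_(j in B) j)%N.
  by rewrite /B big_imset //= => a b _ _; apply: perm_inj.
have cAB : #|A :\: B| = #|B :\: A|.
  have cB : #|B| = #|A| by rewrite card_imset //; apply: perm_inj.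
  by apply/eqP; rewrite -(eqn_add2l #|A :&: B|) cardsID setIC cardsID cB.
rewrite [X in (X <= _)%N](big_setID B) [X in (_ <= X)%N](big_setID A) /= setIC leq_add2l.
have [AB0|[a0 a0AB]] := set_0Vmem (A :\: B); first by rewrite AB0 big_set0.
(* As A is downward closed, every element outside A exceeds [a], the largest element of A not in B;
   the two differences have equally many elements. *)
have [a aAB maxa] := arg_maxnP (fun i : 'I_k => i : nat) a0AB.
apply: (@leq_trans (\sum_(i in A :\: B) a)%N); first by apply: leq_sum => i /maxa.
rewrite sum_nat_const cAB -sum_nat_const; apply: leq_sum => j.
rewrite !inE => /andP[jA _]; rewrite leqNgt; apply: contra jA => lt_ja.
apply: downA (ltnW lt_ja) _; have : a \in A :\: B := aAB; by rewrite inE => /andP[].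
Qed.

Section Rearrangement.
Variables (k : nat) (lam : 'I_k -> nat).
Hypothesis lam_anti : forall i j : 'I_k, (i <= j)%N -> (lam j <= lam i)%N.

(** Rearrangement inequality by layers: lam is the sum of the indicators of the sets where
    [c < lam i], and these are initial segments. *)
Lemma leq_sum_mul_perm (w : 'S_k) : (\sum_i lam i * i <= \sum_i lam i * w i)%N.
Proof.
pose M := (\sum_i lam i)%N.
have lamE i : lam i = (\sum_(c < M) (c < lam i))%N.
  rewrite -big_mkcond /=.
  have le_M : (lam i <= M)%N by rewrite /M (bigD1 i) //= leq_addr.
  by rewrite -(big_ord_widen _ (fun=> 1%N) le_M) sum1_card card_ord.
have E (u : 'I_k -> nat) : (\sum_i lam i * u i = \sum_(c < M) \sum_(i in [set i | (c < lam i)%N]) u i)%N.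
  under eq_bigr do rewrite {1}lamE big_distrl /=.
  rewrite exchange_big /=; apply: eq_bigr => c _.
  rewrite [RHS]big_mkcond; apply: eq_bigr => i _; rewrite inE.
  by case: ltnP; rewrite ?mul1n ?mul0n.
rewrite (E (fun i => i)) (E (fun i => w i)); apply: leq_sum => c _.
apply: leq_sum_perm_initial => i j ij; rewrite !inE => /leq_trans; apply; exact: lam_anti.
Qed.

(* Makes the diagonal product the only term of lowest order in the Jacobi-Trudi
   determinant at x_i = t^(2i+1). *)
Lemma ltn_sum_sqr_shifted (w : 'S_k) : w != 1%g ->
  \sum_i (lam i)%:Z ^+ 2 < \sum_i shifted lam w i ^+ 2.
Proof.
move=> nw.
have -> : \sum_i shifted lam w i ^+ 2 =
   \sum_i (lam i)%:Z ^+ 2 + ((\sum_i lam i * w i)%N%:Z - (\sum_i lam i * i)%N%:Z) *+ 2 +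
   \sum_i ((w i : nat)%:Z - (i : nat)%:Z) ^+ 2.
  rewrite !(big_morph Posz PoszD (erefl 0%:Z)) -sumrB -sumrMnl -!big_split /=.
  apply: eq_bigr => i _; rewrite /shifted; lia.
have h1 : 0 <= (\sum_i lam i * w i)%N%:Z - (\sum_i lam i * i)%N%:Z.
  by rewrite subr_ge0 lez_nat leq_sum_mul_perm.
have h2 : 0 < \sum_i ((w i : nat)%:Z - (i : nat)%:Z) ^+ 2.
  have [i wi] : exists i, w i != i.
    apply/existsP; apply: contraR nw => /existsPn h; apply/eqP/permP => i.
    by rewrite perm1; apply/eqP; have := h i; rewrite negbK.
  rewrite (bigD1 i) //= ltr_wpDr ?sumr_ge0 // => [j _|]; first exact: sqr_ge0.
  by rewrite exprn_even_gt0 //= subr_eq0 eqz_nat.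
rewrite -addrA ltrDl ltr_wpDl // mulrn_wge0 //.
Qed.

End Rearrangement.

Lemma elsym_diag_coef (A : comNzRingType) r (x : 'I_r -> A) j :
  elsym (diag_mx (\row_i x i)) j = (\prod_i (1 + x i *: 'X) : {poly A})`_j.
Proof.
have -> : \prod_i (1 + x i *: 'X) = \det (1%:M + 'X *: map_mx polyC (diag_mx (\row_i x i))).
  have -> : 1%:M + 'X *: map_mx polyC (diag_mx (\row_i x i)) = diag_mx (\row_i (1 + x i *: 'X)).
    apply/matrixP => i i'; rewrite !mxE; case: (i == i'); rewrite ?mulr1n ?mulr0n ?mulr0 ?addr0 //.
    by rewrite mulrC mul_polyC.
  by rewrite det_diag; apply: eq_bigr => i _; rewrite mxE.
rewrite det1D coef_sum.
under eq_bigr do rewrite elsymZ (elsym_map (@polyC A)) mulrC mul_polyC coefZ coefXn.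
have [lt_j|le_j] := ltnP j r.+1.
  rewrite (bigD1 (Ordinal lt_j)) //= eqxx mulr1 big1 ?addr0 // => i ni.
  by rewrite eq_sym (negPf (ni : (i : nat) != j)) mulr0.
rewrite elsym_gt // big1 // => i _.
by rewrite gtn_eqF ?mulr0 // (leq_trans (ltn_ord i)).
Qed.

(* With x_i = t^(2i+1), the elementary symmetric function e_m is t^(m^2) (1 + O(t)). *)
Lemma coef_prod_geometric r m : (m <= r)%N ->
  exists2 g : {poly rat}, g.[0] = 1 &
    (\prod_(i < r) (1 + ('X^(i.*2.+1) : {poly rat}) *: 'X))`_m = 'X^(m ^ 2) * g.
Proof.
elim: r m => [|r IH] m.
  by rewrite leqn0 => /eqP->; exists 1; rewrite ?hornerC // big_ord0 coef1 expr0 mul1r.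
move=> le_m; rewrite big_ord_recr /= mulrDr mulr1 coefD -scalerAr coefZ.
have big_size : (size (\prod_(i < r) (1 + ('X^(i.*2.+1) : {poly rat}) *: 'X))%R <= r.+1)%N.
  apply: leq_trans (size_poly_prod_leq _ _) _; rewrite leq_subLR card_ord.
  have : (\sum_(i < r) size (1 + ('X^(i.*2.+1) : {poly rat}) *: 'X)%R <= \sum_(i < r) 2)%N.
    apply: leq_sum => c _; apply: leq_trans (size_polyD _ _) _.
    rewrite geq_max size_poly1 /=.
    by apply: leq_trans (size_scale_leq _ _) _; rewrite size_polyX.
  by rewrite sum_nat_const card_ord muln2 -addnn addnS ltnS.
case: m le_m => [|m] le_m.
  have [//|g g0 ->] := IH 0; exists g => //.
  by rewrite coefMX eqxx mulr0 addr0.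
rewrite coefMX /=.
have [//|g g0 ->] := IH m.
have [->|ne_mr] := eqVneq m r.
  exists g => //; rewrite nth_default // add0r mulrA -exprD.
  by congr ('X^_ * _); rewrite -addnn; lia.
have [|g' g'0 ->] := IH m.+1; first by lia.
(* The new variable adds t^(2r+1) e_m to e_(m+1); since m^2 + 2r + 1 = (m+1)^2 + 2(r - m), the added
   term has higher order when m < r. *)
exists (g' + 'X^((r - m).*2) * g).
  by rewrite hornerD g'0 hornerM hornerXn g0 mulr1 expr0n /= double_eq0 subn_eq0; have -> : (r <= m)%N = false by lia.
rewrite mulrDr; congr (_ + _); rewrite !mulrA -!exprD; congr ('X^_ * _).
by rewrite -!addnn; nia.
Qed.

Lemma poly_pos_near0 (g : {poly rat}) : 0 < g.[0] -> exists2 s, 0 < s & 0 < g.[s].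
Proof.
move=> g0; pose H := \sum_(i < size g) `|g`_i|.
have H0 : 0 <= H by apply: sumr_ge0.
(* Chosen so that s <= 1 and s H < g(0): the nonconstant terms amount to at most s H in absolute
   value and cannot cancel g(0). *)
pose s := g.[0] / (1 + H + g.[0]).
have s0 : 0 < s by rewrite divr_gt0 //; lra.
have s1 : s <= 1 by rewrite ler_pdivrMr ?mul1r; lra.
exists s => //.
have -> : g.[s] = g.[0] + s * \sum_(i < (size g).-1) g`_i.+1 * s ^+ i.
  rewrite !horner_coef; case: (size g) => [|n]; first by rewrite !big_ord0 mulr0 addr0.
  rewrite /= !big_ord_recl /= [X in _ = _ + X + _]big1 ?addr0 => [|i _]; last by rewrite expr0n mulr0.
  by rewrite !expr0 mulr_sumr; congr (_ + _); apply: eq_bigr => i _; rewrite exprS mulrCA.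
have le_H : `|\sum_(i < (size g).-1) g`_i.+1 * s ^+ i| <= H.
  apply: le_trans (ler_norm_sum _ _ _) _.
  apply: (@le_trans _ _ (\sum_(i < (size g).-1) `|g`_i.+1|)).
    apply: ler_sum => i _; rewrite normrM ler_piMr // normrX (gtr0_norm s0); exact: exprn_ile1 (ltW s0) s1.
  rewrite /H; case: (size g) => [|n] /=; first by rewrite !big_ord0.
  by rewrite big_ord_recl lerDr.
have : s * H < g.[0].
  by rewrite /s mulrAC ltr_pdivrMr ?ltr_pM2l; lra.
move: (\sum_(i < _) _) le_H => S; rewrite ler_norml => /andP[hS _].
have := ler_wpM2l (ltW s0) hS; rewrite mulrN; lra.
Qed.

(** * A rational point where the Schur polynomial is positive *)

Section SchurPositive.
Variables (k r : nat) (lam : 'I_k -> nat).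
Hypothesis lam_anti : forall i j : 'I_k, (i <= j)%N -> (lam j <= lam i)%N.
Hypothesis lam_le : forall i, (lam i <= r)%N.

Let xs (i : 'I_r) : {poly rat} := 'X^(i.*2.+1).
Let E := elsym (diag_mx (\row_i xs i)).
Let mx := \matrix_(i < k, j < k) nat_ext E ((lam i)%:Z - (i : nat)%:Z + (j : nat)%:Z).

(** Indices outside [0, r] get g = 0, so that one factorization covers all matrix entries; the
    leading coefficient is 1 for indices in [0, r]. *)
Let E_val z : exists g : {poly rat}, nat_ext E z = 'X^(`|z| ^ 2) * g /\
  (forall m, z = Posz m -> (m <= r)%N -> g.[0] = 1).
Proof.
case: z => m; last by exists 0; rewrite mulr0; split.
rewrite /= /E elsym_diag_coef.
have [le_m|lt_m] := leqP m r.
  have [g g0 eg] := coef_prod_geometric le_m; exists g; split=> // m' [<-] _; exact: g0.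
exists 0; split; last by move=> m' [<-]; rewrite leqNgt lt_m.
by rewrite -elsym_diag_coef elsym_gt ?mulr0.
Qed.

(** [ltn_sum_sqr_shifted] puts every term but the diagonal one in strictly higher order, and
    [lam_le] gives the diagonal entries leading coefficient 1. *)
Let detE : exists2 g : {poly rat}, g.[0] = 1 & \det mx = 'X^(\sum_i lam i ^ 2) * g.
Proof.
have [gg ggE] := fin_all_exists (fun i : 'I_k => fin_all_exists (fun j : 'I_k =>
   E_val ((lam i)%:Z - (i : nat)%:Z + (j : nat)%:Z))).
have prodE (w : 'S_k) : \prod_i mx i (w i) =
    'X^(\sum_i `|shifted lam w i| ^ 2) * \prod_i gg i (w i).
  under eq_bigr => i _ do rewrite mxE (proj1 (ggE i (w i))).
  by rewrite big_split /= prodrXr.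
exists (\prod_i gg i i + \sum_(w : 'S_k | w != 1%g) (-1) ^+ w *
    ('X^(\sum_i `|shifted lam w i| ^ 2 - \sum_i lam i ^ 2) * \prod_i gg i (w i))).
  rewrite hornerD horner_prod big1 => [|i _]; last first.
    by apply: (proj2 (ggE i i) (lam i)) => //; rewrite subrK.
  rewrite horner_sum big1 ?addr0 // => w nw.
  rewrite !hornerM hornerXn expr0n subn_eq0.
  have -> : (\sum_i `|shifted lam w i| ^ 2 <= \sum_i lam i ^ 2)%N = false.
    apply/negP; rewrite -lez_nat leNgt; apply/negP/negPn.
    rewrite !(big_morph Posz PoszD (erefl 0%:Z)).
    have := ltn_sum_sqr_shifted lam_anti nw; congr (_ < _); apply: eq_bigr => i _; lia.
  by rewrite mul0r mulr0.
rewrite /determinant (bigD1 1%g) //= odd_perm1 expr0 mul1r prodE mulrDr mulr_sumr.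
congr (_ * _ + _).
    by congr ('X^_); apply: eq_bigr => i _; rewrite /shifted perm1 subrK.
  by apply: eq_bigr => i _; rewrite perm1.
apply: eq_bigr => w nw; rewrite prodE [RHS]mulrCA; congr (_ * _); rewrite mulrA -exprD subnKC //.
rewrite -lez_nat !(big_morph Posz PoszD (erefl 0%:Z)) ltW //.
have := ltn_sum_sqr_shifted lam_anti nw; congr (_ < _); apply: eq_bigr => i _; lia.
Qed.

Lemma schur_det_gt0 : exists2 x : 'I_r -> rat, (forall i, 0 < x i) &
  0 < \det (\matrix_(i < k, j < k)
     nat_ext (elsym (diag_mx (\row_i x i))) ((lam i)%:Z - (i : nat)%:Z + (j : nat)%:Z)).
Proof.
have [g g0 eg] := detE.
have [|s s0 gs] := @poly_pos_near0 g; first by rewrite g0.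
exists (fun i : 'I_r => s ^+ i.*2.+1) => [i|]; first exact: exprn_gt0.
set D := \det _; suff -> : D = (\det mx).[s].
  by rewrite eg hornerM hornerXn mulr_gt0 // exprn_gt0.
rewrite -/(horner_eval s _) -det_map_mx; congr (\det _); apply/matrixP => i j; rewrite !mxE.
case: (_ + _) => m /=; last by rewrite rmorph0.
rewrite /E -elsym_map; congr (elsym _ _); apply/matrixP => a b; rewrite !mxE.
by rewrite rmorphMn /= /horner_eval hornerXn.
Qed.

End SchurPositive.

(** * Sign of the convolution constant *)

Section SchurClassPositive.
Variables (k r : nat) (lam : 'I_k -> nat).
Hypothesis lam_anti : forall i j : 'I_k, (i <= j)%N -> (lam j <= lam i)%N.
Hypothesis sum_lam : (\sum_i lam i)%N = k.
Hypothesis lam_le : forall i, (lam i <= r)%N.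

Local Notation f := (schur_class lam).

(** At a diagonal matrix the trace product of s is a sum over the colorings fixed by s, so the
    determinant is a combination of monomials weighted by these stabilizer sums. If none were
    positive, the determinant could not be positive at a point with positive coordinates. *)
Lemma exists_fixed_coloring : exists K : {ffun 'I_k -> 'I_r},
  0 < \sum_(s : 'S_k | fixes s K) (-1) ^+ s * f s.
Proof.
have [x x0 D0] := schur_det_gt0 lam_anti lam_le.
pose c (K : {ffun 'I_k -> 'I_r}) := \sum_(s : 'S_k | fixes s K) (-1) ^+ s * f s.
apply/existsP; apply: contraLR D0 => /existsPn h; rewrite -leNgt.
have k0 : 0 < k`!%:R :> rat by rewrite ltr0n fact_gt0.
rewrite -(pmulr_lle0 _ k0) mulr_natr jacobi_trudi_ptr //.
have -> : \sum_(s : 'S_k) (-1) ^+ s * (f s)%:~R * ptr (diag_mx (\row_i x i)) s =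
   \sum_(K : {ffun 'I_k -> 'I_r}) (\prod_a x (K a)) * (c K)%:~R.
  under eq_bigr do rewrite /ptr mulr_sumr.
  rewrite exchange_big /=; apply: eq_bigr => K _.
  rewrite /c rmorph_sum mulr_sumr [RHS]big_mkcond; apply: eq_bigr => s _.
  case: ifP => [/forallP fx|/negbT/forallPn[a fa]].
    rewrite rmorphM rmorph_sign /= mulrC; congr (_ * _); apply: eq_bigr => a _.
    by rewrite !mxE (eqP (fx a)) eqxx.
  by rewrite (bigD1 a) //= !mxE eq_sym (negPf fa) mul0r mulr0.
apply: sumr_le0 => K _; rewrite pmulr_rle0; last by apply: prodr_gt0.
by rewrite lerz0 leNgt h.
Qed.

(** With H the stabilizer of a coloring K as above, d times a sum over x of squares equals k! |H|
    times the positive sum attached to K; this forces d > 0. *)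
Lemma schur_class_conv_gt0 : exists2 d : int, 0 < d &
  forall s t, d * \sum_x f (x * s)%g * f (x * t)%g = k`!%:Z * f (s^-1 * t)%g.
Proof.
have [d [d0 conv]] := schur_class_conv lam_anti sum_lam.
(* Translating x by s reduces this form to [conv] at y = s^-1 t. *)
have conv2 s t : d * \sum_x f (x * s)%g * f (x * t)%g = k`!%:Z * f (s^-1 * t)%g.
  rewrite -conv; congr (_ * _); rewrite [RHS](reindex_inj (mulIg s)) /=.
  by apply: eq_bigr => x _; rewrite mulgA mulgK mulrC.
exists d => //; have [K cK] := exists_fixed_coloring.
have HM : group_set [set s : 'S_k | fixes s K].
  apply/group_setP; split=> [|s t]; rewrite !inE; first by apply/forallP => a; rewrite perm1.
  move=> /forallP hs /forallP ht; apply/forallP => a.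
  by rewrite permM (eqP (ht _)) (eqP (hs _)).
pose H := Group HM.
have HE s : (s \in H) = fixes s K by rewrite inE.
have E : d * \sum_x (\sum_(s in H) (-1) ^+ s * f (x * s)%g) ^+ 2 =
    (k`!%:Z * \sum_(s : 'S_k | fixes s K) (-1) ^+ s * f s) *+ #|H|.
  under [X in d * X]eq_bigr => x _.
    rewrite expr2 mulr_suml; under eq_bigr do rewrite mulr_sumr.
    over.
  rewrite exchange_big /= mulr_sumr -sumr_const; apply: eq_bigr => s sH.
  rewrite exchange_big /= !mulr_sumr (reindex_inj (mulgI s)) /=.
  apply: eq_big => [t|t _]; first by rewrite -HE; exact: (@groupMl _ H).
  rewrite odd_permM signr_addb.
  rewrite (eq_bigr (fun x => (-1) ^+ t * (f (x * s)%g * f (x * (s * t))%g))).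
    by rewrite -mulr_sumr mulrCA conv2 mulKg [RHS]mulrCA.
  by move=> x _; rewrite mulrACA; congr (_ * _); rewrite mulrA -expr2 sqrr_sign mul1r.
have : 0 < d * \sum_x (\sum_(s in H) (-1) ^+ s * f (x * s)%g) ^+ 2.
  by rewrite E pmulrn_lgt0 ?cardG_gt0 // mulr_gt0 // ltz_nat fact_gt0.
rewrite lt0r mulf_eq0 negb_or => /andP[/andP[_ S0]].
have Sgt0 : 0 < \sum_x (\sum_(s in H) (-1) ^+ s * f (x * s)%g) ^+ 2.
  by rewrite lt0r S0 sumr_ge0 // => x _; exact: sqr_ge0.
by rewrite pmulr_lge0 // lt0r d0.
Qed.

End SchurClassPositive.

(** * Signs in products of anticommuting elements *)

Section Anticommuting.
Variables (R : nzRingType) (m : nat) (g : 'I_m -> R).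
Hypothesis gC : forall i j, g i * g j = - (g j * g i).
Hypothesis gg : forall i, g i * g i = 0.
Implicit Types (A B : {set 'I_m}) (s t : seq 'I_m).

Definition gprod B : R := \prod_(j in B) g j.

Let gseq s B : R := \prod_(j <- s | j \in B) g j.

Let gprodE B : gprod B = gseq (enum 'I_m) B.
Proof. by rewrite /gprod /gseq [index_enum _]unlock -enumT. Qed.

Let lti : rel 'I_m := fun i j => (i < j)%N.

Let lti_trans : transitive lti.
Proof. by move=> i j l; apply: ltn_trans. Qed.

Let sorted_enum : sorted lti (enum 'I_m).
Proof. by have := iota_ltn_sorted 0 m; rewrite -val_enum_ord sorted_map. Qed.

(** On a sorted list, [g i] moves right past the smaller elements of B, one sign each, until it
    reaches its place. *)
Let seq_mul s i B : sorted lti s -> i \in s ->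
  g i * gseq s B = if i \in B then 0 else
     (-1) ^+ count (fun j => (j \in B) && (j < i)%N) s * gseq s (i |: B).
Proof.
rewrite /gseq; elim: s => // j s IH; rewrite /= (path_sortedE lti_trans) => /andP[/allP js srt_s].
rewrite inE; have [ij _|ne_ij /= i_s] := eqVneq i j.
  rewrite -{}ij in js *.
  have nis : i \notin s by apply/negP => /js; rewrite /lti ltnn.
  rewrite !big_cons setU11; case: ifP => iB; first by rewrite mulrA gg mul0r.
  rewrite /= add0n (eq_in_count (a2 := pred0)) ?count_pred0 ?expr0 ?mul1r => [|l /js li].
    congr (_ * _); rewrite big_seq_cond [RHS]big_seq_cond; apply: eq_bigl => l.
    by rewrite !inE; case: eqP => // ->; rewrite (negPf nis).
  by rewrite /= ltnNge (ltnW li) andbF.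
have ji : (j < i)%N by exact: js.
rewrite !big_cons !inE eq_sym (negPf ne_ij) ji andbT /=; have {}IH := IH srt_s i_s.
case: (boolP (j \in B)) => jB; last by rewrite IH add0n.
rewrite mulrA gC mulNr -mulrA IH; case: ifP; rewrite ?mulr0 ?oppr0 // => _.
by rewrite exprD expr1 mulN1r mulNr !mulrA; congr (- (_ * _)); apply: commr_sign.
Qed.

Lemma mul_gprod i B : g i * gprod B = if i \in B then 0 else
  (-1) ^+ (\sum_(b in B) (b < i)%N) * gprod (i |: B).
Proof.
rewrite !gprodE seq_mul ?mem_enum //; case: ifP => // _; congr (_ ^+ _ * _).
rewrite -sum1_count big_enum_cond [RHS]big_mkcond [LHS]big_mkcond.
apply: eq_bigr => b _; by rewrite /=; case: (b \in B); case: ltnP.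
Qed.

(** The multiplication rule of the exterior basis, for any anticommuting family with zero squares;
    it is what makes [ext_lift] multiplicative. *)
Lemma gprodM A B : gprod A * gprod B = if [disjoint A & B] then
  (-1) ^+ (\sum_(a in A) \sum_(b in B) (b < a)%N) * gprod (A :|: B) else 0.
Proof.
pose At t := [set a in A | a \in t].
suff seqM t : sorted lti t -> gseq t A * gprod B = if [disjoint At t & B] then
   (-1) ^+ (\sum_(a <- t | a \in A) \sum_(b in B) (b < a)%N) * gprod (At t :|: B) else 0.
  rewrite [gprod A]gprodE seqM // (_ : At _ = A); last by apply/setP => a; rewrite inE mem_enum andbT.
  by rewrite big_enum_cond.
rewrite /gseq; elim: t => [|j t IH] /=.
  have -> : At [::] = set0 by apply/setP => a; rewrite !inE andbF.
  by rewrite !big_nil set0U disjoints_subset sub0set.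
rewrite (path_sortedE lti_trans) => /andP[/allP jt srt_t]; rewrite !big_cons.
case: (boolP (j \in A)) => jA; last first.
  have -> : At (j :: t) = At t; last exact: IH.
  by apply/setP => a; rewrite !inE; case: eqP => // ->; rewrite (negPf jA).
have -> : At (j :: t) = j |: At t.
  by apply/setP => a; rewrite !inE; case: eqP => //= ->; rewrite jA.
have -> : [disjoint j |: At t & B] = (j \notin B) && [disjoint At t & B].
  by rewrite !disjoints_subset subUset sub1set inE.
rewrite -mulrA IH //; case: (boolP [disjoint At t & B]); last by rewrite andbF mulr0.
move=> dtB; rewrite andbT mulrA commr_sign -mulrA mul_gprod !inE.
have jNt : (j \in t) = false by apply/negP => /jt; rewrite /lti ltnn.
rewrite jNt andbF /=; case: ifP => jB /=; first by rewrite mulr0.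
rewrite mulrA -exprD setUA addnC; congr (_ ^+ (_ + _) * _).
rewrite (bigID (mem B)) /= [X in (_ + X)%N]big1 ?addn0; last first.
  move=> b /andP[]; rewrite !inE => /orP[/andP[_ /jt jb] _|->//].
  by apply/eqP; rewrite eqb0 -leqNgt ltnW.
by apply: eq_bigl => b; rewrite !inE andb_orl andbb andbC; case: (b \in B); rewrite ?orbT ?andbF ?andFb.
Qed.

End Anticommuting.

(** Pulling the factors i and j to the front costs a sign that depends on their positions alone, so
    the two products differ as [x i * x j] and [x j * x i] do. *)
Lemma prod_swap (R : nzRingType) k (x : 'I_k -> R) (i j : 'I_k) :
  (forall a b, x a * x b = - (x b * x a)) -> (forall a, x a * x a = 0) -> i != j ->
  \prod_a x (tperm i j a) = - \prod_a x a.
Proof.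
move=> xC xx ij.
have gT (y : 'I_k -> R) : \prod_a y a = gprod y setT by apply: eq_bigl => a; rewrite inE.
have main (y : 'I_k -> R) : (forall a b, y a * y b = - (y b * y a)) -> (forall a, y a * y a = 0) ->
   y i * (y j * gprod y (~: [set i; j])) =
   (-1) ^+ (\sum_(b in ~: [set i; j]) (b < j)%N + \sum_(b in ~: [set i]) (b < i)%N) * gprod y setT.
  move=> yC yy; rewrite mul_gprod // !inE eqxx orbT /=.
  have -> : j |: ~: [set i; j] = ~: [set i].
    by apply/setP => b; rewrite !inE; case: (eqVneq b j) => [->|] //=; rewrite ?orbF // eq_sym ij.
  rewrite mulrA commr_sign -mulrA mul_gprod // !inE eqxx /= mulrA -exprD.
  by congr (_ * gprod _ _); apply/setP => b; rewrite !inE orbN.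
have /= := main (fun a => x (tperm i j a)) (fun a b => xC _ _) (fun a => xx _).
rewrite tpermL tpermR mulrA xC mulNr -mulrA.
have -> : gprod (fun a => x (tperm i j a)) (~: [set i; j]) = gprod x (~: [set i; j]).
  by apply: eq_bigr => a; rewrite !inE negb_or => /andP[ai aj]; rewrite tpermD // eq_sym.
rewrite main // !gT; set e := (_ + _)%N => E.
by rewrite -[RHS](signrMK e) mulrN E signrMK.
Qed.

Lemma prod_perm (R : nzRingType) k (x : 'I_k -> R) (s : 'S_k) :
  (forall a b, x a * x b = - (x b * x a)) -> (forall a, x a * x a = 0) ->
  \prod_a x (s a) = (-1) ^+ s * \prod_a x a.
Proof.
have [ts -> dts] := prod_tpermP s; elim: ts dts x => [_ x|t ts IH /= /andP[dt dts] x].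
  by rewrite big_nil odd_perm1 expr0 mul1r => *; apply: eq_bigr => a _; rewrite perm1.
move=> xC xx; rewrite big_cons odd_permM odd_tperm dt signr_addb.
set u := (\prod_(i <- ts) _)%g in IH *.
under eq_bigr do rewrite permM.
by rewrite (@prod_swap _ _ (fun a => x (u a))) // IH // mulN1r mulNr.
Qed.

Lemma mul_prod_anti (R : nzRingType) k (x : 'I_k -> R) (z : R) :
  (forall a, z * x a = - (x a * z)) -> z * \prod_a x a = (-1) ^+ k * (\prod_a x a * z).
Proof.
elim: k x => [|k IH] x zx; first by rewrite !big_ord0 mulr1 !mul1r.
rewrite !big_ord_recl mulrA zx mulNr -[x _ * z * _]mulrA (IH (fun i => x (lift ord0 i))) // exprS mulN1r mulNr.
by rewrite !mulrA commr_sign.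
Qed.

(** Each z_a has to cross the x_b with b > a, which makes 'C(k, 2) crossings. *)
Lemma prod_interleave (R : nzRingType) k (x z : 'I_k -> R) :
  (forall a b, z a * x b = - (x b * z a)) ->
  \prod_a (x a * z a) = (-1) ^+ 'C(k, 2) * (\prod_a x a * \prod_a z a).
Proof.
elim: k x z => [|k IH] x z zx; first by rewrite !big_ord0 !mulr1.
rewrite !big_ord_recl (IH (fun i => x (lift ord0 i)) (fun i => z (lift ord0 i))) // binS bin1 exprD.
set PX := \prod_i x _; set PZ := \prod_i z _.
have h : PX * z ord0 = (-1) ^+ k * (z ord0 * PX) by rewrite mul_prod_anti // signrMK.
have -> : x ord0 * PX * (z ord0 * PZ) = x ord0 * (PX * z ord0) * PZ by rewrite !mulrA.
rewrite {}h -[_ ^+ 'C(k, 2)]signr_odd -[_ ^+ k]signr_odd.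
by case: (odd k); case: (odd _); rewrite ?expr0 ?expr1 ?(mulNr, mulrN, mul1r, opprK) !mulrA.
Qed.

Lemma scaler_expN1 (K : pzRingType) (R : lalgType K) n (x : R) :
  (-1) ^+ n *: x = (-1) ^+ n * x.
Proof. by rewrite -[in LHS]signr_odd -[in RHS]signr_odd scaler_sign mulr_sign. Qed.

(** * Basis and universal property of the exterior algebra *)

Section ExtBasis.
Variables (K : fieldType) (m : nat).
Implicit Types (u v : extalg K m) (A B S : {set 'I_m}).
Local Notation e := (ext_basis K).

Lemma ext_scaleE (c : K) u S : (c *: u) S = c * u S.
Proof. by rewrite ffunE. Qed.

Lemma ext_addE u v S : (u + v) S = u S + v S.
Proof. by rewrite ffunE. Qed.

Lemma ext_zeroE S : (0 : extalg K m) S = 0.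
Proof. by rewrite ffunE. Qed.

Lemma ext_sumE (I : Type) (r : seq I) (P : pred I) (F : I -> extalg K m) S :
  (\sum_(i <- r | P i) F i) S = \sum_(i <- r | P i) F i S.
Proof.
elim/big_ind2: _ => [|x1 x2 y1 y2 <- <-|] //; first exact: ext_zeroE.
exact: ext_addE.
Qed.

Lemma ext_mulE u v S :
  (u * v) S = \sum_(A : {set 'I_m} | A \subset S) (-1) ^+ ninv A (S :\: A) * (u A * v (S :\: A)).
Proof. by rewrite /GRing.mul /= ffunE. Qed.

Lemma ext_decomp u : u = \sum_S u S *: e S.
Proof.
apply/ffunP => S; rewrite ext_sumE (bigD1 S) //= big1 ?addr0 => [|A nAS].
  by rewrite ext_scaleE ffunE eqxx mulr1.
by rewrite ext_scaleE ffunE eq_sym (negPf nAS) mulr0.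
Qed.

Lemma ext_basisM A B : e A * e B =
  if [disjoint A & B] then (-1) ^+ ninv A B *: e (A :|: B) else 0.
Proof.
apply/ffunP => S; rewrite ext_mulE.
rewrite (eq_bigr (fun A' => ((A' == A) && (S :\: A' == B))%:R * (-1) ^+ ninv A B)); last first.
  move=> A' _; rewrite !ffunE; case: (eqVneq A' A) => [->|_]; last by rewrite !mul0r mulr0.
  by case: (eqVneq (S :\: A) B) => [->|_]; rewrite ?mulr0 ?mul0r ?mulr1 ?mul1r.
case: ifP => dAB; last first.
  rewrite big1 ?ext_zeroE // => A' A'S; case: eqP => [eA|]; last by rewrite mul0r.
  case: eqP => [eB|]; last by rewrite mul0r.
  by move: dAB; rewrite -eB eA -setI_eq0 setIDA setIC -setIDA setDv setI0 eqxx.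
rewrite ext_scaleE ffunE; case: (eqVneq S (A :|: B)) => [->|nS].
  rewrite mulr1 (bigD1 A) ?subsetUl //= eqxx big1 ?addr0.
    rewrite setDUl setDv set0U; have -> : B :\: A = B by apply/setDidPl; rewrite disjoint_sym.
    by rewrite eqxx mul1r.
  by move=> A' /andP[_ /negPf->]; rewrite mul0r.
rewrite mulr0 big1 // => A' A'S; case: eqP => [eA|]; last by rewrite mul0r.
case: eqP => [eB|]; last by rewrite mul0r.
case/eqP: nS; rewrite -eA -eB; rewrite -[LHS](setID S A') setIC; congr (_ :|: _).
exact/setIidPl.
Qed.

Definition gen (i : 'I_m) : extalg K m := e [set i].

Lemma gen_anti i j : gen i * gen j = - (gen j * gen i).
Proof.
rewrite /gen !ext_basisM !disjoints1 !inE eq_sym.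
case: eqVneq => [_|nij]; rewrite ?oppr0 //= setUC -scaleNr; congr (_ *: _).
rewrite /ninv !big_set1; case: ltngtP nij => //= [_|/val_inj->]; rewrite ?eqxx // => _.
by rewrite expr0 expr1 opprK.
Qed.

Lemma gen_sq i : gen i * gen i = 0.
Proof. by rewrite /gen ext_basisM disjoints1 inE eqxx. Qed.

Lemma ext_basis0 : e set0 = 1 :> extalg K m.
Proof. by []. Qed.

(** Both sides obey the same recursion when an element i of S is pulled out, with the same sign. *)
Lemma gprod_gen S : gprod gen S = e S.
Proof.
have [n leS] := ubnP #|S|; elim: n => // n IH in S leS *.
have [->|[i iS]] := set_0Vmem S; first by rewrite /gprod big_set0 ext_basis0.
have [E1 E2] : gen i * gprod gen (S :\ i) = (-1) ^+ ninv [set i] (S :\ i) * gprod gen S /\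
   gen i * e (S :\ i) = (-1) ^+ ninv [set i] (S :\ i) * e S.
  rewrite (mul_gprod gen_anti gen_sq) {1}/gen ext_basisM !inE eqxx /= disjoints1 !inE eqxx /= setD1K //.
  by rewrite /ninv !big_set1 scaler_expN1.
rewrite -[LHS](signrMK (ninv [set i] (S :\ i))) -E1 IH ?E2 ?signrMK //.
by move: leS; rewrite (cardsD1 i S) iS.
Qed.

End ExtBasis.

Section ExtLift.
Variables (K : fieldType) (m : nat) (theta : {rmorphism K -> K}) (R : algType K).
Variable g : 'I_m -> R.
Hypothesis gC : forall i j, g i * g j = - (g j * g i).
Hypothesis gg : forall i, g i * g i = 0.

(** The universal property in semilinear form: [theta] twists the scalars, so that conjugation of
    forms is an instance. *)
Definition ext_lift (u : extalg K m) : R := \sum_S theta (u S) *: gprod g S.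

Lemma ext_liftD u v : ext_lift (u + v) = ext_lift u + ext_lift v.
Proof.
by rewrite /ext_lift -big_split; apply: eq_bigr => S _; rewrite ext_addE rmorphD scalerDl.
Qed.

Lemma ext_liftZ c u : ext_lift (c *: u) = theta c *: ext_lift u.
Proof.
by rewrite /ext_lift scaler_sumr; apply: eq_bigr => S _; rewrite ext_scaleE rmorphM scalerA.
Qed.

Lemma ext_lift0 : ext_lift 0 = 0.
Proof. by rewrite -[X in ext_lift X](scale0r (0 : extalg K m)) ext_liftZ rmorph0 scale0r. Qed.

Lemma ext_lift_sum (I : Type) (r : seq I) (P : pred I) (F : I -> extalg K m) :
  ext_lift (\sum_(i <- r | P i) F i) = \sum_(i <- r | P i) ext_lift (F i).
Proof. by apply: big_morph; [exact: ext_liftD | exact: ext_lift0]. Qed.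

Lemma ext_lift_basis S : ext_lift (ext_basis K S) = gprod g S.
Proof.
rewrite /ext_lift (bigD1 S) //= big1 ?addr0 => [|A nAS]; rewrite ffunE.
  by rewrite eqxx rmorph1 scale1r.
by rewrite (negPf nAS) rmorph0 scale0r.
Qed.

Lemma ext_liftM u v : ext_lift (u * v) = ext_lift u * ext_lift v.
Proof.
rewrite {1}[u]ext_decomp {1}[v]ext_decomp mulr_suml ext_lift_sum [RHS]mulr_suml.
apply: eq_bigr => A _; rewrite mulr_sumr ext_lift_sum mulr_sumr; apply: eq_bigr => B _.
rewrite -scalerAl -scalerAr !ext_liftZ -scalerAl -[in RHS]scalerAr; congr (_ *: (_ *: _)).
rewrite ext_basisM gprodM //; case: ifP => _; last exact: ext_lift0.
by rewrite ext_liftZ ext_lift_basis rmorphXn rmorphN1 scaler_expN1.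
Qed.

End ExtLift.

Import Num.Def.

(** * Even forms as a commutative ring *)

Section EvenPart.
Variables (K : fieldType) (m : nat).
Implicit Types (u v : extalg K m) (A B S : {set 'I_m}).

Definition ext_even : {pred extalg K m} :=
  fun u => [forall S : {set 'I_m}, (u S == 0) || ~~ odd #|S|].

Lemma ext_evenP u : reflect (forall S, u S != 0 -> ~~ odd #|S|) (u \in ext_even).
Proof.
apply: (iffP forallP) => h S; have := h S; first by case/orP => [/eqP->|->//]; rewrite eqxx.
by case: eqP => //= _; apply.
Qed.

Lemma ext_mul_neq0 u v S : (u * v) S != 0 ->
  exists A : {set 'I_m}, [/\ A \subset S, u A != 0 & v (S :\: A) != 0].
Proof.
rewrite ext_mulE => h.
have [A /andP[AS hA]] : exists A : {set 'I_m}, (A \subset S) && (u A * v (S :\: A) != 0).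
  apply/existsP; apply: contraR h => /existsPn h; rewrite big1 // => A AS.
  by have := h A; rewrite AS /= negbK => /eqP->; rewrite mulr0.
by exists A; move: hA; rewrite mulf_eq0 negb_or => /andP[].
Qed.

Lemma ext_even_subring : subring_closed ext_even.
Proof.
split=> [|u v /ext_evenP hu /ext_evenP hv|u v /ext_evenP hu /ext_evenP hv]; apply/ext_evenP => S.
- rewrite -ext_basis0 ffunE; case: (eqVneq S set0) => [-> _|]; first by rewrite cards0.
  by rewrite eqxx.
- rewrite ext_addE => h; have [u0|/hu//] := eqVneq (u S) 0.
  by apply: hv; apply: contraNneq h => v0; rewrite ffunE u0 v0 subr0.
case/ext_mul_neq0=> A [AS /hu oA /hv oB].
by rewrite -(cardsID A S) (setIidPr AS) oddD negb_add (negPf oA) (negPf oB).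
Qed.

HB.instance Definition _ := GRing.isSubringClosed.Build _ ext_even ext_even_subring.

(* Determinants of forms of even degree are computed in this commutative subring. *)
Record evenalg := Even { even_val : extalg K m; _ : even_val \in ext_even }.
HB.instance Definition _ := [isSub for even_val].
HB.instance Definition _ := [Choice of evenalg by <:].
HB.instance Definition _ := [SubChoice_isSubNzRing of evenalg by <:].

Lemma ninvC A B : [disjoint A & B] -> (ninv A B + ninv B A = #|A| * #|B|)%N.
Proof.
move=> dAB; rewrite /ninv [X in (_ + X)%N]exchange_big /= -big_split /=.
rewrite -sum_nat_const; apply: eq_bigr => a aA; rewrite -big_split /= -sum1_card.
apply: eq_bigr => b bB; have: b != a by apply: contraTneq bB => ->; rewrite (disjointFr dAB).
by rewrite -val_eqE /=; case: ltngtP.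
Qed.

(** By [ninvC], exchanging basis forms of degrees p and q costs (-1)^(pq), and p is even. *)
Lemma ext_even_comm u v : u \in ext_even -> u * v = v * u.
Proof.
move=> /ext_evenP hu; rewrite [u]ext_decomp [v]ext_decomp mulr_suml mulr_sumr.
apply: eq_bigr => A _; rewrite mulr_suml mulr_sumr; apply: eq_bigr => B _.
rewrite -!scalerAl -!scalerAr scalerA mulrC -scalerA.
have [->|/hu oA] := eqVneq (u A) 0; first by rewrite !scale0r !scaler0.
congr (_ *: (_ *: _)); rewrite !ext_basisM disjoint_sym; case: ifP => // dAB.
rewrite setUC; congr (_ *: _); apply: (can_inj (signrMK (ninv B A))).
rewrite -!exprD addnn ninvC // -[LHS]signr_odd -[RHS]signr_odd odd_double.
by rewrite oddM (negPf oA) andbF.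
Qed.

Lemma evenalg_mulC : commutative (@GRing.mul evenalg).
Proof. by move=> u v; apply: val_inj; apply: ext_even_comm; apply: valP. Qed.

HB.instance Definition _ := GRing.PzRing_hasCommutativeMul.Build evenalg evenalg_mulC.

End EvenPart.

(** * Conjugation and bidegree of forms *)

Section FormConj.
Variables (C : numClosedFieldType) (n : nat).
Local Notation form := (form C n).
Implicit Types (u v : form) (S : {set 'I_(n + n)}).

Definition conj_gen (i : 'I_(n + n)) : form :=
  match split i with inl a => dzbar C a | inr a => dz C a end.

Let swap (i : 'I_(n + n)) : 'I_(n + n) :=
  match split i with inl a => rshift n a | inr a => lshift n a end.

Let conj_genE i : conj_gen i = gen C (swap i).
Proof. by rewrite /conj_gen /swap; case: (split i). Qed.

Lemma conj_gen_anti i j : conj_gen i * conj_gen j = - (conj_gen j * conj_gen i).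
Proof. by rewrite !conj_genE gen_anti. Qed.

Lemma conj_gen_sq i : conj_gen i * conj_gen i = 0.
Proof. by rewrite conj_genE gen_sq. Qed.

(** The dz^a precede all d\bar z^a in the index order, so the ordered product splits as in
    [form_conj]. Multiplicativity of conjugation then follows from [ext_liftM]. *)
Lemma form_conjE u : form_conj u = ext_lift conjC conj_gen u.
Proof.
apply: eq_bigr => S _; congr (_ *: _); rewrite /gprod big_split_ord /=.
by congr (_ * _); apply: eq_bigr => a _; rewrite /conj_gen ?(unsplitK (inl _)) ?(unsplitK (inr _)).
Qed.

Lemma form_conjZ c u : form_conj (c *: u) = c^* *: form_conj u.
Proof. by rewrite !form_conjE ext_liftZ. Qed.

Lemma form_conj_sum (I : Type) (r : seq I) (P : pred I) (F : I -> form) :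
  form_conj (\sum_(i <- r | P i) F i) = \sum_(i <- r | P i) form_conj (F i).
Proof. by rewrite form_conjE ext_lift_sum; apply: eq_bigr => i _; rewrite form_conjE. Qed.

Lemma form_conjM u v : form_conj (u * v) = form_conj u * form_conj v.
Proof. by rewrite !form_conjE (ext_liftM _ conj_gen_anti conj_gen_sq). Qed.

Lemma form_conj1 : form_conj 1 = 1 :> form.
Proof. by rewrite form_conjE -ext_basis0 ext_lift_basis /gprod big_set0. Qed.

Lemma form_conj_prod (I : Type) (r : seq I) (P : pred I) (F : I -> form) :
  form_conj (\prod_(i <- r | P i) F i) = \prod_(i <- r | P i) form_conj (F i).
Proof. by apply: big_morph; [exact: form_conjM | exact: form_conj1]. Qed.

Let form_conj_gen i : form_conj (gen C i) = gen C (swap i).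
Proof. by rewrite form_conjE ext_lift_basis /gprod big_set1 conj_genE. Qed.

Lemma form_conj_dz (a : 'I_n) : form_conj (dz C a) = dzbar C a.
Proof. by rewrite (form_conj_gen (lshift n a)) /swap (unsplitK (inl _)). Qed.

Lemma form_conjK u : form_conj (form_conj u) = u.
Proof.
rewrite {1}[u]ext_decomp (form_conj_sum _ _ (fun S => u S *: ext_basis C S)).
rewrite (form_conj_sum _ _ (fun S => form_conj (u S *: ext_basis C S))) [RHS]ext_decomp.
apply: eq_bigr => S _.
rewrite !form_conjZ conjCK; congr (_ *: _); rewrite -gprod_gen /gprod !form_conj_prod.
apply: eq_bigr => i _; rewrite !form_conj_gen; congr gen.
by case: (split_ordP i) => a ->; rewrite /swap !(unsplitK (inl _), unsplitK (inr _)).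
Qed.

End FormConj.

Section Bidegree.
Variables (C : numClosedFieldType) (n : nat).
Local Notation form := (form C n).
Implicit Types (u v : form) (S : {set 'I_(n + n)}).

Lemma bidegreeD p q u v : bidegree p q u -> bidegree p q v -> bidegree p q (u + v).
Proof.
move=> hu hv S; rewrite ext_addE => h; have [u0|/hu//] := eqVneq (u S) 0.
by apply: hv; rewrite u0 add0r in h.
Qed.

Lemma bidegree0 p q : bidegree p q (0 : form).
Proof. by move=> S; rewrite ext_zeroE eqxx. Qed.

Lemma bidegreeZ p q c u : bidegree p q u -> bidegree p q (c *: u).
Proof. by move=> hu S; rewrite ext_scaleE mulf_eq0 negb_or => /andP[_ /hu]. Qed.

Lemma bidegree_sum p q (I : Type) (r : seq I) (P : pred I) (F : I -> form) :
  (forall i, P i -> bidegree p q (F i)) -> bidegree p q (\sum_(i <- r | P i) F i).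
Proof.
by move=> h; apply: big_ind => //; [exact: bidegree0 | exact: bidegreeD].
Qed.

Lemma bidegreeM p q p' q' u v : bidegree p q u -> bidegree p' q' v ->
  bidegree (p + p') (q + q') (u * v).
Proof.
move=> hu hv S /ext_mul_neq0[A [AS /hu[<- <-] /hv[<- <-]]].
have cardD (f : 'I_n -> 'I_(n + n)) : #|[set a | f a \in S]| =
    (#|[set a | f a \in A]| + #|[set a | f a \in S :\: A]|)%N.
  rewrite -(cardsID [set a | f a \in A]); congr (_ + _)%N; apply: eq_card => a; rewrite !inE //.
  by apply/andP/idP => [[]//|h]; split=> //; apply: (subsetP AS).
by split; apply: cardD.
Qed.

Lemma bidegree1 : bidegree 0 0 (1 : form).
Proof.
move=> S; rewrite -ext_basis0 ffunE; case: (eqVneq S set0) => [-> _|_]; last by rewrite eqxx.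
by split; apply: eq_card0 => a; rewrite !inE.
Qed.

Lemma bidegree_dz (a : 'I_n) : bidegree 1 0 (dz C a).
Proof.
move=> S; rewrite ffunE; case: (eqVneq S _) => [-> _|_]; last by rewrite eqxx.
split; first by rewrite -(cards1 a); apply: eq_card => b; rewrite !inE (inj_eq (@lshift_inj _ _)).
by apply: eq_card0 => b; rewrite !inE eq_rlshift.
Qed.

Lemma bidegree_dzbar (a : 'I_n) : bidegree 0 1 (dzbar C a).
Proof.
move=> S; rewrite ffunE; case: (eqVneq S _) => [-> _|_]; last by rewrite eqxx.
split; last by rewrite -(cards1 a); apply: eq_card => b; rewrite !inE (inj_eq (@rshift_inj _ _)).
by apply: eq_card0 => b; rewrite !inE eq_lrshift.
Qed.

Lemma bidegree_prod (I : Type) (r : seq I) (P : pred I) (F : I -> form) p q :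
  (forall i, P i -> bidegree p q (F i)) ->
  bidegree (\sum_(i <- r | P i) p) (\sum_(i <- r | P i) q) (\prod_(i <- r | P i) F i).
Proof.
move=> h; elim: r => [|i r IH]; first by rewrite !big_nil; apply: bidegree1.
rewrite !big_cons; case: ifP => Pi //; apply: bidegreeM => //; exact: h.
Qed.

Lemma card_form_index S : #|S| = (#|[set a : 'I_n | lshift n a \in S]| + #|[set a : 'I_n | rshift n a \in S]|)%N.
Proof. by rewrite -!sum1dep_card -[LHS]sum1_card big_split_ord. Qed.

Lemma bidegree_even p u : bidegree p p u -> u \in @ext_even C (n + n).
Proof.
by move=> hu; apply/ext_evenP => S /hu[h1 h2]; rewrite card_form_index h1 h2 addnn odd_double.
Qed.

Lemma ext_part_bidegree d p u : bidegree p p u -> ext_part d u = if d == p.*2 then u else 0.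
Proof.
move=> hu; apply/ffunP => S; rewrite ffunE.
have [u0|/hu[h1 h2]] := eqVneq (u S) 0.
  by rewrite u0 if_same; case: eqP; rewrite ?u0 ?ext_zeroE.
by rewrite card_form_index h1 h2 addnn eq_sym; case: eqP => //; rewrite ext_zeroE.
Qed.

End Bidegree.

(** * Sums of squares of forms are positive *)

Section PositiveSum.
Variables (C : numClosedFieldType) (n : nat).
Local Notation form := (form C n).
Implicit Types (u v : form) (S : {set 'I_(n + n)}).

(** From k + 2 C(k, 2) = k^2: the sign of interleaving k one-forms with their conjugates turns i^k
    into i^(k^2). *)
Lemma iexp_sqr k : 'i ^+ k * (-1) ^+ 'C(k, 2) = 'i ^+ (k ^ 2) :> C.
Proof.
rewrite -sqrCi -exprM -exprD; congr (_ ^+ _).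
elim: k => // k IH; rewrite binS bin1.
by move: IH; rewrite !expnS !expn0 !muln1; lia.
Qed.

Lemma bidegree_comm p q p' q' u v : bidegree p q u -> bidegree p' q' v ->
  u * v = (-1) ^+ ((p + q) * (p' + q')) * (v * u).
Proof.
move=> hu hv; rewrite [u]ext_decomp [v]ext_decomp mulr_suml [in RHS]mulr_sumr mulr_sumr.
apply: eq_bigr => A _; rewrite mulr_sumr mulr_suml mulr_sumr; apply: eq_bigr => B _.
have [->|/hu[a1 a2]] := eqVneq (u A) 0; first by rewrite !scale0r !mul0r !mulr0.
have [->|/hv[b1 b2]] := eqVneq (v B) 0; first by rewrite !scale0r !mul0r !mulr0.
rewrite -!scalerAl -!scalerAr [LHS]scalerA [RHS]scalerA mulrC; congr (_ *: _).
rewrite !ext_basisM [X in if X then _ else _]disjoint_sym; case: ifP => dAB; last by rewrite mulr0.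
rewrite !scaler_expN1 setUC mulrA -exprD; congr (_ * _).
rewrite -a1 -a2 -b1 -b2 -!card_form_index mulnC -(ninvC dAB).
by rewrite -signr_odd -[RHS]signr_odd !oddD addbAC addbb.
Qed.

Definition dz_top : form := \prod_(a < n) dz C a.

Lemma dz_topE : dz_top = ext_basis C [set i : 'I_(n + n) | (i < n)%N].
Proof.
rewrite -gprod_gen /gprod big_split_ord /= [X in _ * X]big1 ?mulr1 => [|a].
  rewrite /dz_top [RHS]big_mkcond; apply: eq_bigr => a _; by rewrite inE /= ltn_ord.
by rewrite inE /= ltnNge leq_addr.
Qed.

Lemma bidegree_top u : bidegree n 0 u -> u = u [set i : 'I_(n + n) | (i < n)%N] *: dz_top.
Proof.
move=> hu; rewrite dz_topE; apply/ffunP => S; rewrite ext_scaleE ffunE.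
case: (eqVneq S _) => [->|nS]; first by rewrite mulr1.
rewrite mulr0; apply/eqP; apply: contraTT nS => /hu[h1 h2]; rewrite negbK; apply/eqP/setP => i.
rewrite inE; case: (split_ordP i) => a ->; rewrite /= ?ltn_ord.
  have : a \in [set a | lshift n a \in S].
    have -> : [set a | lshift n a \in S] = setT.
      by apply/eqP; rewrite eqEcard subsetT cardsT card_ord h1 leqnn.
    by rewrite inE.
  by rewrite inE.
have : a \notin [set a | rshift n a \in S] by rewrite (cards0_eq h2) inE.
by rewrite inE => /negPf ->.
Qed.

Lemma prod_volume : \prod_(a < n) ('i *: (dz C a * form_conj (dz C a))) =
  'i ^+ (n ^ 2) *: (dz_top * form_conj dz_top).
Proof.
rewrite scaler_prod prodr_const card_ord -iexp_sqr -scalerA; congr (_ *: _).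
rewrite scaler_expN1 form_conj_prod prod_interleave // => a b.
by rewrite !form_conj_dz; apply: gen_anti.
Qed.

Lemma bidegree_conj p q u : bidegree p q u -> bidegree q p (form_conj u).
Proof.
move=> hu; rewrite /form_conj; apply: bidegree_sum => S _.
have [->|/hu[<- <-]] := eqVneq (u S) 0; first by rewrite conjC0 scale0r; apply: bidegree0.
apply: bidegreeZ.
have h1 := @bidegree_prod C n _ (index_enum 'I_n) (fun a => lshift n a \in S) (fun a => dzbar C a) 0 1
  (fun a _ => @bidegree_dzbar C n a).
have h2 := @bidegree_prod C n _ (index_enum 'I_n) (fun a => rshift n a \in S) (fun a => dz C a) 1 0
  (fun a _ => @bidegree_dz C n a).
have := bidegreeM h1 h2; rewrite !sum_nat_cond_const !muln0 !muln1 add0n addn0.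
by rewrite !cardsE.
Qed.

Variables (k : nat) (J : finType) (c : J -> C) (Psi : J -> form).
Hypothesis le_kn : (k <= n)%N.
Hypothesis c_gt0 : forall j, 0 < c j.
Hypothesis bidegPsi : forall j, bidegree k 0 (Psi j).
Hypothesis detect : forall beta : form, bidegree (n - k) 0 beta -> beta != 0 ->
  exists j, Psi j * beta != 0.

(** Against beta each square becomes, up to a sign that the powers of i absorb, the square of the
    (n, 0)-form [Psi j * beta], a multiple [g j] of the top form; [detect] makes some [g j]
    nonzero. *)
Lemma positive_form_sum :
  positive_form k ('i ^+ (k ^ 2) *: \sum_j c j *: (Psi j * form_conj (Psi j))).
Proof.
split.
- apply/bidegreeZ/bidegree_sum => j _; apply: bidegreeZ.
  have := bidegreeM (@bidegPsi j) (bidegree_conj (@bidegPsi j)).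
  by rewrite addn0.
- rewrite form_conjZ (form_conj_sum _ _ (fun j => c j *: (Psi j * form_conj (Psi j)))).
  rewrite !scaler_sumr; apply: eq_bigr => j _.
  rewrite form_conjZ form_conjM form_conjK (geC0_conj (ltW (c_gt0 j))).
  (* Exchanging the two factors gives (-1)^(k^2), which cancels the conjugation of i^(k^2). *)
  rewrite (bidegree_comm (bidegree_conj (@bidegPsi j)) (@bidegPsi j)) add0n addn0.
  rewrite -scaler_expN1 rmorphXn /= conjCi !scalerA; congr (_ *: _).
  by rewrite [_ * c j]mulrC -!mulrA mulnn -exprMn mulrN1 opprK mulrC.
move=> beta hb nb.
have hg j : bidegree n 0 (Psi j * beta).
  by have := bidegreeM (@bidegPsi j) hb; rewrite subnKC.
pose g j := (Psi j * beta) [set i : 'I_(n + n) | (i < n)%N].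
exists (\sum_j c j * `|g j| ^+ 2), (fun a => dz C a); split.
- have [j nj] := detect hb nb; have gj : g j != 0.
    apply: contraNneq nj => g0; rewrite (bidegree_top (hg j)).
    by rewrite -/(g j) g0 scale0r.
  rewrite (bigD1 j) //= ltr_wpDr ?sumr_ge0 // => [i _|].
    by rewrite mulr_ge0 ?exprn_ge0 // (ltW (c_gt0 i)).
  by rewrite mulr_gt0 // exprn_gt0 // normr_gt0.
- exists 1%:M; first exact: unitmx1.
  move=> i; rewrite (bigD1 i) //= big1 ?addr0 => [|j nj]; rewrite mxE ?eqxx ?scale1r //.
  by rewrite eq_sym (negPf nj) scale0r.
rewrite prod_volume -scalerAl -scalerAr scalerA mulr_suml.
rewrite [RHS]scalerA [X in _ = X *: _]mulrC -[RHS]scalerA scaler_suml !scaler_sumr; apply: eq_bigr => j _.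
rewrite -scalerAl.
have -> : Psi j * form_conj (Psi j) * (beta * form_conj beta) =
    (-1) ^+ (k * (n - k)) * ((Psi j * beta) * form_conj (Psi j * beta)).
  rewrite form_conjM -!mulrA [form_conj _ * (beta * _)]mulrA.
  rewrite (bidegree_comm (bidegree_conj (@bidegPsi j)) hb) add0n addn0.
  by rewrite -!mulrA -!scaler_expN1 -scalerAr.
rewrite [Psi j * beta](bidegree_top (hg j)) -/(g j) form_conjZ -scaler_expN1 -!scalerAl -!scalerAr !scalerA.
congr (_ *: _); rewrite normCK -exprD.
(* From n^2 = k^2 + (n-k)^2 + 2k(n-k); the sign cancels the one produced by moving beta past the
   conjugate of [Psi j]. *)
have -> : 'i ^+ (n ^ 2) = 'i ^+ (k ^ 2 + (n - k) ^ 2) * (-1) ^+ (k * (n - k)) :> C.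
  rewrite -sqrCi -exprM -exprD; congr (_ ^+ _).
  by rewrite -{1}(subnKC le_kn) sqrnD mulnA.
by rewrite -!mulrA; congr (_ * _); rewrite mulrCA.
Qed.

End PositiveSum.

(** * Schur forms of a matrix of (1,1)-forms *)

Section SchurPoint.
Variables (C : numClosedFieldType) (n r : nat).
Local Notation form := (form C n).
Local Notation even := (evenalg C (n + n)).
Implicit Types (M : 'M[form]_r).

(** [chern] for an arbitrary matrix of forms at one point, with the constant i/(2 pi) absorbed in M,
    so that the frame can be changed. *)
Definition point_chern M (z : int) : form :=
  if z is Posz p then
    if (p <= r)%N then ext_part p.*2 (\det (1%:M + M)) else 0
  else 0.

Definition point_schur k (lam : 'I_k -> nat) M : form :=
  \det (\matrix_(i < k, j < k) point_chern M ((lam i)%:Z - (i : nat)%:Z + (j : nat)%:Z)).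

Definition deg11 M := forall i j, bidegree 1 1 (M i j).

Lemma deg11_even M : deg11 M -> exists Me : 'M[even]_r, M = map_mx val Me.
Proof.
move=> hM; exists (\matrix_(i, j) insubd 0 (M i j)).
apply/matrixP => i j; rewrite !mxE insubdK //; exact: bidegree_even (hM i j).
Qed.

Lemma even_scal_proof (c : C) : (c *: 1 : extalg C (n + n)) \in @ext_even C (n + n).
Proof.
apply/ext_evenP => S; rewrite ext_scaleE -ext_basis0 ffunE.
by case: (eqVneq S set0) => [->|_]; rewrite ?cards0 // mulr0 eqxx.
Qed.

Definition even_scal (c : C) : even := Even (even_scal_proof c).

(** [elsym Me j] has bidegree (j, j), so [ext_part p.*2] picks exactly the p-th term of [det1D]. *)
Lemma point_chernE (Me : 'M[even]_r) z : deg11 (map_mx val Me) ->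
  point_chern (map_mx val Me) z = val (nat_ext (elsym Me) z).
Proof.
move=> hM; case: z => p; rewrite [nat_ext _ _]/= /point_chern; last by rewrite rmorph0.
have helsym j : bidegree j j (val (elsym Me j)).
  rewrite /elsym rmorph_sum; apply: bidegree_sum => B /eqP cB.
  rewrite rmorph_sum; apply: bidegree_sum => s _.
  rewrite rmorphM rmorph_sign -scaler_expN1; apply: bidegreeZ.
  rewrite rmorph_prod -cB.
  have := @bidegree_prod C n _ (index_enum 'I_r) (mem B) (fun a => val (Me a (s a))) 1 1.
  by rewrite sum1_card; apply => a _; have := hM a (s a); rewrite mxE.
case: leqP => [le_pr|lt_rp]; last by rewrite elsym_gt ?rmorph0.
have -> : 1%:M + map_mx val Me = map_mx val (1%:M + Me).
  by rewrite map_mxD map_mx1.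
rewrite det_map_mx det1D rmorph_sum.
have partD (u v : form) d : ext_part d (u + v) = ext_part d u + ext_part d v.
  by apply/ffunP => S; rewrite ext_addE !ffunE; case: ifP; rewrite ?addr0.
have part0 d : ext_part d 0 = 0 :> form.
  by apply/ffunP => S; rewrite ffunE ext_zeroE if_same.
rewrite (big_morph _ (fun u v => partD u v p.*2) (part0 p.*2)).
rewrite (bigD1 (Ordinal (le_pr : (p < r.+1)%N))) //= (ext_part_bidegree _ (helsym p)) eqxx.
rewrite big1 ?addr0 // => j nj; rewrite (ext_part_bidegree _ (helsym j)).
by case: eqP => // /double_inj e; case/eqP: nj; apply: val_inj; rewrite /= e.
Qed.

(** The last hypothesis reads G M = M' G. In the even subring it equates the two determinants
    multiplied by the invertible scalar det G. *)
Lemma det1D_conj M M' (G : 'M[C]_r) :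
  deg11 M -> deg11 M' -> G \in unitmx ->
  (forall i j, \sum_l G i l *: M l j = \sum_l G l j *: M' i l) ->
  \det (1%:M + M) = \det (1%:M + M').
Proof.
move=> hM hM' uG eGM.
have [Me eM] := deg11_even hM; have [Me' eM'] := deg11_even hM'.
pose Ge : 'M[even]_r := map_mx even_scal G.
pose Hinv : 'M[even]_r := map_mx even_scal (invmx G).
have scalM (A B : 'M[C]_r) : map_mx even_scal A *m map_mx even_scal B = map_mx even_scal (A *m B).
  apply/matrixP => i j; rewrite !mxE; apply: val_inj; rewrite rmorph_sum /= scaler_suml.
  apply: eq_bigr => l _; rewrite !mxE.
  by rewrite -scalerAl mul1r scalerA.
have scal1 : map_mx even_scal (1%:M : 'M[C]_r) = 1%:M.
  apply/matrixP => i j; rewrite !mxE; apply: val_inj.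
  by case: (i == j); rewrite /= ?scale1r ?scale0r.
have eGMe : Ge *m Me = Me' *m Ge.
  apply/matrixP => i j; rewrite !mxE; apply: val_inj; rewrite !rmorph_sum.
  have := eGM i j; rewrite eM eM'; congr (_ = _); apply: eq_bigr => l _; rewrite !mxE rmorphM /=.
    by rewrite -scalerAl mul1r.
  by rewrite -scalerAr mulr1.
rewrite eM eM' -!(map_mx1 (\val : {rmorphism even -> form})) -!map_mxD !det_map_mx.
congr (val _).
have H1 : \det Ge * \det Hinv = 1 by rewrite -det_mulmx scalM mulmxV // scal1 det1.
have E : \det Ge * \det (1%:M + Me) = \det (1%:M + Me') * \det Ge.
  by rewrite -!det_mulmx mulmxDr mulmxDl mulmx1 mul1mx eGMe.
by rewrite -[LHS]mul1r -[X in X * _]H1 mulrAC E -mulrA H1 mulr1.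
Qed.

Lemma point_schur_conj k (lam : 'I_k -> nat) M M' (G : 'M[C]_r) :
  deg11 M -> deg11 M' -> G \in unitmx ->
  (forall i j, \sum_l G i l *: M l j = \sum_l G l j *: M' i l) ->
  point_schur lam M = point_schur lam M'.
Proof.
move=> hM hM' uG eGM; rewrite /point_schur.
by under eq_mx do rewrite /point_chern (det1D_conj hM hM' uG eGM).
Qed.

Lemma point_schur_ptr k (lam : 'I_k -> nat) M : deg11 M -> (\sum_i lam i)%N = k ->
  k`!%:R *: point_schur lam M = \sum_(s : 'S_k) ((-1) ^+ s * (schur_class lam s)%:~R) *:
     \sum_(I : {ffun 'I_k -> 'I_r}) \prod_a M (I a) (I (s a)).
Proof.
move=> hM sum_lam; have [Me eM] := deg11_even hM; rewrite eM in hM *.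
have -> : point_schur lam (map_mx val Me) = val (\det (\matrix_(i < k, j < k)
     nat_ext (elsym Me) ((lam i)%:Z - (i : nat)%:Z + (j : nat)%:Z))).
  rewrite -det_map_mx; congr (\det _); apply/matrixP => i j; rewrite !mxE.
  exact: point_chernE.
rewrite scaler_nat -rmorphMn jacobi_trudi_ptr // rmorph_sum; apply: eq_bigr => s _.
rewrite -scalerA scaler_sign scaler_int.
rewrite -mulrA rmorphM rmorph_sign mulr_sign rmorphM rmorph_int mulrzl.
have <- : val (ptr Me s) = \sum_(I : {ffun 'I_k -> 'I_r}) \prod_a (map_mx val Me) (I a) (I (s a)).
  rewrite /ptr rmorph_sum; apply: eq_bigr => I _; rewrite rmorph_prod.
  by apply: eq_bigr => a _; rewrite mxE.
by case: (odd_perm s).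
Qed.

End SchurPoint.

(** * The action on index pairs, and detection of nonzero forms *)

Section PartialAction.
Variables (k : nat) (T : {set 'I_k}).

Definition stab : {group 'S_k} := 'N(T | 'P)%G.

Lemma stabP (s : 'S_k) : reflect (forall a, (s a \in T) = (a \in T)) (s \in stab).
Proof.
apply: (iffP idP) => [sN a|h]; first exact: (astabs_act a sN).
by apply/setIdP; split; rewrite ?inE //; apply/subsetP => a aT; rewrite inE /= apermE h.
Qed.

Lemma restr_permE_if s a : s \in stab -> restr_perm T s a = if a \in T then s a else a.
Proof.
move=> sG; case: ifP => aT; first exact: restr_permE.
by rewrite (out_perm (restr_perm_on T s)) ?aT.
Qed.

Variables (X Y : finType).
Implicit Type z : {ffun 'I_k -> X} * {ffun 'I_k -> Y}.

(* z.1 a and z.2 a index the form w at position a; T is the set of E1 positions. *)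
Definition twist (s : 'S_k) z : {ffun 'I_k -> X} * {ffun 'I_k -> Y} :=
  ([ffun a => if a \in T then z.1 a else z.1 (s a)],
   [ffun a => if a \in T then z.2 (s a) else z.2 a]).

Lemma twistM s u z : s \in stab -> twist (s * u)%g z = twist s (twist u z).
Proof.
move=> /stabP hs; congr pair; apply/ffunP => a; rewrite !ffunE ?permM; case: ifP => // aT.
  by rewrite hs aT.
by rewrite hs aT.
Qed.

Lemma twist1 z : twist 1 z = z.
Proof. by case: z => I S; congr pair; apply/ffunP => a; rewrite !ffunE perm1 if_same. Qed.

(** On [stab] this is the sign of s on the complement of T; the factor from T records a reordering
    of conjugated one-forms. *)
Definition twist_sign (s : 'S_k) : int := (-1) ^+ s * (-1) ^+ restr_perm T s.

Lemma twist_signM s u : s \in stab -> u \in stab ->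
  twist_sign (s * u)%g = twist_sign s * twist_sign u.
Proof.
move=> sG uG; rewrite /twist_sign (morphM (restr_perm_morphism T)) // !odd_permM !signr_addb.
by rewrite mulrACA.
Qed.

Lemma twist_sign_sqr s : twist_sign s * twist_sign s = 1.
Proof. by rewrite -expr2 exprMn !sqrr_sign mulr1. Qed.

End PartialAction.

(** The sign is left unspecified because [dz_detect] needs only nonvanishing. *)
Lemma prod_gen_inj (K : fieldType) m k (g : 'I_k -> 'I_m) : injective g ->
  exists e, \prod_a gen K (g a) = (-1) ^+ e *: ext_basis K [set g a | a : 'I_k].
Proof.
elim: k g => [|k IH] g injg.
  exists 0; rewrite big_ord0 expr0 scale1r -ext_basis0; congr ext_basis.
  by apply/setP => x; rewrite in_set0; case: imsetP => // -[[]].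
have [|e E] := IH (fun a => g (lift ord0 a)); first by move=> a b /injg/lift_inj.
exists (ninv [set g ord0] [set g (lift ord0 a) | a : 'I_k] + e)%N.
rewrite big_ord_recl E -scalerAr ext_basisM disjoints1.
have -> : g ord0 \notin [set g (lift ord0 a) | a : 'I_k].
  by apply/imsetP => -[a _ /injg/eqP]; rewrite (negPf (neq_lift _ _)).
rewrite scalerA addnC -exprD; congr (_ *: ext_basis _ _).
apply/setP => x; rewrite !inE; apply/orP/imsetP => [[/eqP->|/imsetP[a _ ->]]|[a _ ->]].
- by exists ord0.
- by exists (lift ord0 a).
by case: (unliftP ord0 a) => [b|] ->; [right; apply: imset_f | left].
Qed.

(** Wedging with the dz^a missing from S isolates the coefficient of beta at S, so one nonzero
    coefficient suffices, however many terms beta has. *)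
Lemma dz_detect (C : numClosedFieldType) n k (beta : form C n) : (k <= n)%N ->
  bidegree (n - k) 0 beta -> beta != 0 ->
  exists al : 'I_k -> 'I_n, (\prod_a dz C (al a)) * beta != 0.
Proof.
move=> le_kn hb nb.
have [S nS] : exists S, beta S != 0.
  apply/existsP; apply: contraR nb => /existsPn h; apply/eqP/ffunP => S.
  by rewrite ext_zeroE; apply/eqP; have := h S; rewrite negbK.
have [cS rS] := hb S nS.
pose A := ~: [set a : 'I_n | lshift n a \in S].
have cA : #|A| = k by rewrite cardsCs setCK cS card_ord subKn.
pose al (a : 'I_k) : 'I_n := enum_val (cast_ord (esym cA) a).
have al_inj : injective al by move=> a b /enum_val_inj/cast_ord_inj.
have [|e E] := @prod_gen_inj C (n + n) k (fun a => lshift n (al a)).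
  by move=> a b /lshift_inj/al_inj.
exists al; rewrite E -scalerAl scaler_eq0 signr_eq0 /=.
set B := [set _ | _ in _].
have dBS : [disjoint B & S].
  apply/pred0P => x /=; apply/negP => /andP[/imsetP[a _ ->]] lS.
  by have := enum_valP (cast_ord (esym cA) a); rewrite !inE lS.
apply/eqP => /ffunP/(_ (B :|: S)); rewrite ext_zeroE ext_mulE (bigD1 B) ?subsetUl //=.
rewrite big1 ?addr0 => [|A' /andP[_ /negPf nA']]; last by rewrite ffunE nA' mul0r mulr0.
rewrite ffunE eqxx mul1r setDUl setDv set0U.
have -> : S :\: B = S by apply/setDidPl; rewrite disjoint_sym.
by move/eqP; rewrite mulf_eq0 signr_eq0 (negPf nS).
Qed.

(** * Positivity for a block matrix in normal form *)

Section BlockPositivity.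
Variables (C : numClosedFieldType) (n r k N : nat).
Local Notation form := (form C n).
Variables (t : 'I_r -> bool) (W : 'I_r -> 'I_N -> 'I_n -> C) (kap : C).
Variable lam : 'I_k -> nat.
Hypothesis kap_gt0 : 0 < kap.
Hypothesis lam_anti : forall i j : 'I_k, (i <= j)%N -> (lam j <= lam i)%N.
Hypothesis sum_lam : (\sum_i lam i)%N = k.
Hypothesis lam_le : forall i, (lam i <= r)%N.
Hypothesis le_kn : (k <= n)%N.

Let w (i : 'I_r) (s : 'I_N) : form := \sum_a W i s a *: dz C a.

(** A dual family: within the block of i0 the weights extract dz^(a0) from the index i0 and kill the
    other indices. This is the nondegeneracy behind strictness. *)
Hypothesis span : forall (i0 : 'I_r) (a0 : 'I_n), exists cs : 'I_N -> C,
  forall i, t i = t i0 -> \sum_s cs s *: w i s = if i == i0 then dz C a0 else 0.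

Definition block_mx_form : 'M[form]_r := \matrix_(i, j) (('i * kap) *:
  (if t i == t j then \sum_s (if t i then w i s * form_conj (w j s) else w j s * form_conj (w i s))
   else 0)).

Local Notation M := block_mx_form.
Local Notation f := (schur_class lam).
Local Notation Z := ({ffun 'I_k -> 'I_r} * {ffun 'I_k -> 'I_N})%type.

Let types (I : {ffun 'I_k -> 'I_r}) : {set 'I_k} := [set a | t (I a)].
Let Phi (z : Z) : form := \prod_a w (z.1 a) (z.2 a).

Let bideg_w i s : bidegree 1 0 (w i s).
Proof. by apply: bidegree_sum => a _; apply/bidegreeZ/bidegree_dz. Qed.

Let anti10 (u v : form) : bidegree 1 0 u -> bidegree 1 0 v -> u * v = - (v * u).
Proof. by move=> hu hv; rewrite (bidegree_comm hu hv) expr1 mulN1r. Qed.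

Let dz_lin_sq (c : 'I_n -> C) : (\sum_a c a *: dz C a) * (\sum_a c a *: dz C a) = 0.
Proof.
set u := \sum_a _; have hu : bidegree 1 0 u.
  by apply: bidegree_sum => a _; apply/bidegreeZ/bidegree_dz.
have /eqP := anti10 hu hu; rewrite -addr_eq0 -mulr2n -scaler_nat scaler_eq0 pnatr_eq0 /=.
by move/eqP.
Qed.

Let Phi_perm (x : 'I_k -> 'I_r) (y : 'I_k -> 'I_N) (s : 'S_k) :
  \prod_a w (x (s a)) (y (s a)) = (-1) ^+ s * \prod_a w (x a) (y a).
Proof.
rewrite (prod_perm s (x := fun a => w (x a) (y a))) // => [a b|a]; last exact: dz_lin_sq.
exact: anti10.
Qed.

Let deg11M : deg11 M.
Proof.
move=> i j; rewrite mxE; apply: bidegreeZ; case: ifP => _; last exact: bidegree0.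
apply: bidegree_sum => s _.
by case: (t i); apply: (bidegreeM (p := 1) (q := 0) (p' := 0) (q' := 1)) => //; apply: bidegree_conj.
Qed.

Let sig : C := ('i * kap) ^+ k * (-1) ^+ 'C(k, 2).

(** A permutation that mixes E1 and E2 positions meets an off-diagonal block. *)
Let prodM_out (I : {ffun 'I_k -> 'I_r}) (s : 'S_k) : s \notin stab (types I) ->
  \prod_a M (I a) (I (s a)) = 0.
Proof.
move=> sG; have [a ha] : exists a, t (I a) != t (I (s a)).
  apply/existsP; apply: contraR sG => /existsPn h; apply/stabP => a.
  by rewrite !inE; move: (h a); rewrite negbK => /eqP ->.
have Ma : M (I a) (I (s a)) = 0 by rewrite mxE (negPf ha) scaler0.
(* Forms do not commute, so the zero factor is isolated by induction on the list instead of being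
   moved to the front. *)
have [c1 [c2 E]] : exists c1 c2, \prod_a M (I a) (I (s a)) = c1 * M (I a) (I (s a)) * c2.
  have : a \in index_enum 'I_k by [].
  elim: (index_enum _) => // b l IH; rewrite inE big_cons => /orP[/eqP<-|/IH[c1 [c2 ->]]].
    by exists 1; eexists; rewrite mul1r.
  by exists (M (I b) (I (s b)) * c1), c2; rewrite !mulrA.
by rewrite E Ma mulr0 mul0r.
Qed.

(** In an E1 factor s acts on the conjugated index i, in an E2 factor on the unconjugated one.
    Reindexing S by the restriction of s to T makes the conjugated product a permuted copy of that
    of [Phi (I, S)], hence a sign, and leaves the action of s on the other product as [twist]. *)
Let prodM_in (I : {ffun 'I_k -> 'I_r}) (s : 'S_k) : s \in stab (types I) ->
  \prod_a M (I a) (I (s a)) = (sig * (-1) ^+ restr_perm (types I) s) *: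
     \sum_S Phi (twist (types I) s (I, S)) * form_conj (Phi (I, S)).
Proof.
move=> sG; set T := types I; have /stabP hs := sG.
have E a : M (I a) (I (s a)) = ('i * kap) *: \sum_y
    (w (if a \in T then I a else I (s a)) y * form_conj (w (if a \in T then I (s a) else I a) y)).
  have := hs a; rewrite mxE !inE => ->; rewrite eqxx; congr (_ *: _).
  by case: (t (I a)).
under eq_bigr do rewrite E.
rewrite scaler_prod prodr_const card_ord bigA_distr_bigA /=.
under eq_bigr => S _.
  rewrite prod_interleave; last first.
    move=> a b; rewrite (bidegree_comm (bidegree_conj (@bideg_w _ _)) (@bideg_w _ _)) //.
    by rewrite expr1 mulN1r.
  over.
rewrite -mulr_sumr -scaler_expN1 scalerA -/sig -scalerA; congr (_ *: _).
pose s1 := restr_perm T s.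
rewrite (reindex (fun S : {ffun 'I_k -> 'I_N} => [ffun a => S (s1 a)])) /=; last first.
  exists (fun S : {ffun 'I_k -> 'I_N} => [ffun a => S ((s1^-1)%g a)]) => S _;
  by apply/ffunP => a; rewrite !ffunE ?permK ?permKV.
rewrite scaler_sumr; apply: eq_bigr => S _.
have -> : \prod_a w (if a \in T then I a else I (s a)) ([ffun a => S (s1 a)] a) =
    Phi (twist T s (I, S)).
  apply: eq_bigr => a _; rewrite !ffunE /= /s1 restr_permE_if //.
  by case: ifP.
have -> : \prod_a form_conj (w (if a \in T then I (s a) else I a) ([ffun a => S (s1 a)] a)) =
    (-1) ^+ s1 * form_conj (Phi (I, S)).
  rewrite -form_conj_prod -scaler_expN1 -[(-1) ^+ s1 in RHS](rmorph_sign conjC) -form_conjZ.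
  rewrite scaler_expN1 /Phi -Phi_perm; congr form_conj; apply: eq_bigr => a _.
  by rewrite ffunE /s1 restr_permE_if //; case: ifP.
by rewrite -!scaler_expN1 -scalerAr.
Qed.

Let schur_sum : k`!%:R *: point_schur lam M = sig *: \sum_(z : Z) \sum_(s in stab (types z.1))
   (twist_sign (types z.1) s * f s)%:~R *: (Phi (twist (types z.1) s z) * form_conj (Phi z)).
Proof.
rewrite point_schur_ptr //.
under eq_bigr do rewrite scaler_sumr.
rewrite exchange_big /= -(pair_bigA _ (fun I S => \sum_(s in stab (types I))
   (twist_sign (types I) s * f s)%:~R *: (Phi (twist (types I) s (I, S)) * form_conj (Phi (I, S))))) /=.
rewrite scaler_sumr; apply: eq_bigr => I _; rewrite exchange_big /= scaler_sumr.
rewrite [RHS]big_mkcond; apply: eq_bigr => s _; case: ifP => sG; last first.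
  by rewrite prodM_out ?sG ?scaler0.
rewrite prodM_in // scalerA -scaler_sumr scalerA; congr (_ *: _).
rewrite mulrCA; congr (_ * _); rewrite /twist_sign !rmorphM !rmorph_sign /=.
by rewrite mulrAC.
Qed.

(** The first index runs over all of S_k although s stays in the stabilizer, so the convolution
    identity of S_k applies without restricting f to a subgroup. *)
Let Psi (j : 'S_k * Z) : form := \sum_(s in stab (types j.2.1))
  (twist_sign (types j.2.1) s * f (j.1 * s^-1)%g)%:~R *: Phi (twist (types j.2.1) s j.2).

Let types_twist (T : {set 'I_k}) s (z : Z) : s \in stab T -> types z.1 = T ->
  types (twist T s z).1 = T.
Proof.
move=> /stabP hs zT; apply/setP => a; rewrite inE ffunE; case: ifP => aT.
  by move: aT; rewrite -{1}zT inE.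
by have := hs a; rewrite aT -[in X in X = _]zT inE.
Qed.

(** Summing over x merges the two weights into f(s u^-1). The substitutions of s u for s and of
    [twist T u^-1 z] for z then make the terms of all u equal, whence the factor [#|stab T|];
    [twist_sign] disappears because it is multiplicative with square 1. *)
Let square_sum (d : int) :
  (forall s u, d * \sum_x f (x * s)%g * f (x * u)%g = k`!%:Z * f (s^-1 * u)%g) ->
  forall T : {set 'I_k}, d%:~R *: \sum_x \sum_(z : Z | types z.1 == T) Psi (x, z) * form_conj (Psi (x, z))
  = (k`! * #|stab T|)%:R *: \sum_(z : Z | types z.1 == T) \sum_(s in stab T)
     (twist_sign T s * f s)%:~R *: (Phi (twist T s z) * form_conj (Phi z)).
Proof.
move=> conv T.
have convV s u : d * \sum_x f (x * s^-1)%g * f (x * u^-1)%g = k`!%:Z * f (s * u^-1)%g.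
  by rewrite conv invgK.
transitivity (\sum_(u in stab T) \sum_(s in stab T) (k`!%:Z * (twist_sign T s * twist_sign T u * f (s * u^-1)%g))%:~R *:
   \sum_(z : Z | types z.1 == T) Phi (twist T s z) * form_conj (Phi (twist T u z))).
  transitivity (d%:~R *: \sum_x \sum_(u in stab T) \sum_(s in stab T)
    (twist_sign T s * twist_sign T u * (f (x * s^-1)%g * f (x * u^-1)%g))%:~R *:
    \sum_(z : Z | types z.1 == T) Phi (twist T s z) * form_conj (Phi (twist T u z))).
    congr (_ *: _); apply: eq_bigr => x _.
    under [RHS]eq_bigr do under eq_bigr do rewrite scaler_sumr.
    under [RHS]eq_bigr do rewrite exchange_big /=.
    rewrite [RHS]exchange_big /=; apply: eq_bigr => z /eqP zT.
    rewrite /Psi /= zT (form_conj_sum _ _ (fun s => (twist_sign T s * f (x * s^-1)%g)%:~R *: Phi (twist T s z))).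
    rewrite mulr_sumr; apply: eq_bigr => u _; rewrite mulr_suml; apply: eq_bigr => s _.
    rewrite form_conjZ -scalerAl -scalerAr scalerA rmorph_int -rmorphM; congr (_%:~R *: _).
    by rewrite mulrACA.
  rewrite exchange_big /= scaler_sumr; apply: eq_bigr => u _.
  rewrite exchange_big /= scaler_sumr; apply: eq_bigr => s _.
  rewrite -scaler_suml scalerA; congr (_ *: _).
  rewrite -rmorph_sum -rmorphM; congr (_%:~R).
  by rewrite -mulr_sumr mulrCA convV mulrCA.
transitivity (\sum_(u in stab T) k`!%:R *: \sum_(z : Z | types z.1 == T) \sum_(s in stab T)
     (twist_sign T s * f s)%:~R *: (Phi (twist T s z) * form_conj (Phi z))); last first.
  by rewrite sumr_const -[LHS]scaler_nat scalerA mulrC natrM.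
apply: eq_bigr => u uG; rewrite (reindex_inj (mulIg u)) /= exchange_big /= scaler_sumr.
apply: eq_big => [s|s]; first by rewrite groupMr.
rewrite groupMr // => sG; rewrite mulgK twist_signM // -[_ * _ * twist_sign T u]mulrA twist_sign_sqr mulr1.
rewrite rmorphM -scalerA; congr (_ *: _); rewrite -scaler_sumr; congr (_ *: _).
rewrite [LHS](reindex (twist T u^-1)) /=; last first.
  exists (twist T u) => z _; rewrite -twistM ?groupV //; first by rewrite mulgV twist1.
  by rewrite mulVg twist1.
apply: eq_big => [z|z _].
  apply/eqP/eqP => h; last by apply: types_twist; rewrite ?groupV.
  rewrite -[z](twist1 T) -(mulgV u) twistM //; exact: types_twist.
by rewrite -!twistM ?groupM // mulgK mulgV twist1.
Qed.

Let bideg_Phi z : bidegree k 0 (Phi z).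
Proof.
have := @bidegree_prod C n _ (index_enum 'I_k) xpredT (fun a => w (z.1 a) (z.2 a)) 1 0 (fun a _ => @bideg_w _ _).
by rewrite sum1_card card_ord big1.
Qed.

Let bideg_Psi j : bidegree k 0 (Psi j).
Proof. by apply: bidegree_sum => s _; apply/bidegreeZ/bideg_Phi. Qed.

(** Contracting the [Psi (1, (K, S))] with the dual families of [span] leaves the positive sum
    attached to K times a product of dz^a. If every [Psi j * beta] vanished, so would this product
    against beta, contrary to the choice of [al]. *)
Let detect beta : bidegree (n - k) 0 beta -> beta != 0 -> exists j, Psi j * beta != 0.
Proof.
move=> hb nb; have [al nal] := dz_detect le_kn hb nb.
have [K K0] := exists_fixed_coloring lam_anti sum_lam lam_le.
apply/existsP; apply: contraR nal => /existsPn h.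
have [cs csE] := fin_all_exists (fun a : 'I_k => span (K a) (al a)).
pose T := types K.
have fixT s : fixes s K -> s \in stab T.
  by move=> /forallP fx; apply/stabP => a; rewrite !inE (eqP (fx a)).
(* The contraction replaces each one-form by some dz^a, or by 0 where s changes the color, so only
   the s fixing K survive. *)
have key s : s \in stab T -> \sum_(S : {ffun 'I_k -> 'I_N}) (\prod_a cs a (S a)) *: Phi (twist T s (K, S)) =
    if fixes s K then (-1) ^+ restr_perm T s *: \prod_a dz C (al a) else 0.
  move=> sG; pose s1 := restr_perm T s.
  have s1E a : s1 a = if a \in T then s a else a by rewrite /s1 restr_permE_if.
  transitivity (\sum_(S : {ffun 'I_k -> 'I_N}) \prod_a
      (cs (s1 a) (S a) *: w (if a \in T then K a else K (s a)) (S a))).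
    rewrite [RHS](reindex (fun S : {ffun 'I_k -> 'I_N} => [ffun a => S (s1 a)])) /=; last first.
      exists (fun S : {ffun 'I_k -> 'I_N} => [ffun a => S ((s1^-1)%g a)]) => S _;
      by apply/ffunP => a; rewrite !ffunE ?permK ?permKV.
    apply: eq_bigr => S _; rewrite scaler_prod (reindex_perm s1) /=; congr (_ *: _).
      by apply: eq_bigr => a _; rewrite ffunE.
    by apply: eq_bigr => a _; rewrite !ffunE s1E /=; case: ifP.
  rewrite -(bigA_distr_bigA (fun a y => cs (s1 a) y *: w (if a \in T then K a else K (s a)) y)) /=.
  have tJ a : t (if a \in T then K a else K (s a)) = t (K (s1 a)).
    have e : t (K (s a)) = t (K a) by have := elimT (stabP T s) sG a; rewrite /T !inE.
    by rewrite s1E; case: (a \in T); rewrite e.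
  under eq_bigr do rewrite csE //.
  case: ifP => [/forallP fx|/negbT/forallPn[a fa]].
    rewrite (eq_bigr (fun a => dz C (al (s1 a)))) => [|a _]; last first.
      by rewrite s1E; case: (a \in T); rewrite ?(eqP (fx a)) eqxx.
    rewrite (@prod_perm _ _ (fun a => dz C (al a))) ?scaler_expN1 // => [a b|a].
      exact: gen_anti.
    exact: gen_sq.
  have : a \in index_enum 'I_k by exact: mem_index_enum.
  elim: (index_enum _) => // b l IH; rewrite inE big_cons => /orP[/eqP<-|/IH->].
    rewrite s1E; case: (a \in T); last by rewrite (negPf fa) mul0r.
    by rewrite eq_sym (negPf fa) mul0r.
  by rewrite mulr0.
have E : \sum_(S : {ffun 'I_k -> 'I_N}) (\prod_a cs a (S a)) *: Psi (1%g, (K, S)) =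
   (\sum_(s : 'S_k | fixes s K) (-1) ^+ s * f s)%:~R *: \prod_a dz C (al a).
  rewrite /Psi /=; under eq_bigr do rewrite scaler_sumr.
  rewrite exchange_big /= rmorph_sum scaler_suml (bigID (fun s => fixes s K)) /=.
  rewrite [X in _ + X]big1 ?addr0 => [|s /andP[sG fx]]; last first.
    under eq_bigr do rewrite scalerA mulrC -scalerA.
    by rewrite -scaler_sumr key // (negPf fx) scaler0.
  apply: eq_big => [s|s /andP[sG fx]]; first by apply/andP/idP => [[]//|fx]; split=> //; apply: fixT.
  under eq_bigr do rewrite scalerA mulrC -scalerA.
  rewrite -scaler_sumr key // fx scalerA mul1g schur_classV; congr (_ *: _).
  rewrite /twist_sign -[(-1) ^+ restr_perm T s in LHS](rmorph_sign intr) -rmorphM; congr (_%:~R).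
  by rewrite mulrAC; congr (_ * _); rewrite -mulrA -expr2 sqrr_sign mulr1.
have : (\sum_(S : {ffun 'I_k -> 'I_N}) (\prod_a cs a (S a)) *: Psi (1%g, (K, S))) * beta = 0.
  rewrite mulr_suml big1 // => S _; rewrite -scalerAl.
  by have := h (1%g, (K, S)); rewrite negbK => /eqP->; rewrite scaler0.
rewrite E -scalerAl => /eqP; rewrite scaler_eq0 => /orP[|->//].
by rewrite intr_eq0 gt_eqF.
Qed.

Theorem point_schur_positive : positive_form k (point_schur lam M).
Proof.
have [d d0 conv] := schur_class_conv_gt0 lam_anti sum_lam lam_le.
have sq := square_sum conv.
have kf : (k`!%:R != 0 :> C) by rewrite pnatr_eq0 -lt0n fact_gt0.
(* One k! comes from [schur_sum]; d and the product k! |stab| come from [square_sum], and kap^k from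
   [sig]. *)
pose c (j : 'S_k * Z) : C := kap ^+ k * d%:~R / (k`!%:R * (k`! * #|stab (types j.2.1)|)%:R).
have c0 j : 0 < c j.
  rewrite /c divr_gt0 ?mulr_gt0 ?exprn_gt0 ?ltr0z ?ltr0n ?muln_gt0 ?fact_gt0 ?cardG_gt0 //.
have := positive_form_sum le_kn c0 bideg_Psi detect; congr (positive_form k _).
rewrite -[RHS](scalerK kf) schur_sum.
rewrite (partition_big (fun z : Z => types z.1) xpredT) //=.
rewrite (partition_big (fun j : 'S_k * Z => types j.2.1) xpredT) //= !scaler_sumr.
apply: eq_bigr => T _.
have nT : (k`! * #|stab T|)%:R != 0 :> C by rewrite pnatr_eq0 -lt0n muln_gt0 fact_gt0 cardG_gt0.
rewrite [in RHS](eq_bigr (fun z : Z => \sum_(s in stab T)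
   (twist_sign T s * f s)%:~R *: (Phi (twist T s z) * form_conj (Phi z)))); last by move=> z /eqP->.
rewrite -[X in _ = _ *: (_ *: X)](scalerK nT) -sq.
rewrite pair_big_dep /= !scalerA !scaler_sumr; apply: eq_bigr => -[x z] /= /eqP zT.
rewrite !scalerA /c /= zT; congr (_ *: _).
rewrite /sig exprMn -iexp_sqr invfM.
move: (_ ^-1) => u1; move: (_ ^-1) => u2; move: ('i ^+ k) => u3; move: ((-1) ^+ _) => u4; ring.
Qed.

End BlockPositivity.

(** * Positive definite matrices and orthonormal bases *)

Section PositiveDefinite.
Variables (C : numClosedFieldType) (m : nat) (H : 'M[C]_m).

Let q (x y : 'I_m -> C) := \sum_i \sum_j H i j * x i * (y j)^*.

Hypothesis posH : forall x : 'I_m -> C, (exists i, x i != 0) -> 0 < q x x.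

Let q_real x : (q x x)^* = q x x.
Proof.
case: (boolP [exists i, x i != 0]) => [/existsP/posH/ltW/geC0_conj //|/existsPn h].
rewrite /q big1 ?conjC0 // => i _; rewrite big1 // => j _.
by have /eqP -> := negbNE (h i); rewrite mulr0 mul0r.
Qed.

Let qD x x' : q (fun i => x i + x' i) (fun i => x i + x' i) = q x x + q x x' + q x' x + q x' x'.
Proof.
rewrite /q -!big_split; apply: eq_bigr => i _; rewrite -!big_split; apply: eq_bigr => j _ /=.
rewrite rmorphD /=; ring.
Qed.

Let q_delta c i d j : q (fun l => c *+ (l == i)) (fun l => d *+ (l == j)) = H i j * c * d^*.
Proof.
rewrite /q (bigD1 i) //= (bigD1 j) //= !eqxx big1 => [|l nl]; last first.
  by rewrite (negPf nl) mulr0n conjC0 mulr0.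
rewrite addr0 big1 ?addr0 // => l nl; rewrite big1 // => l' _.
by rewrite (negPf nl) mulr0n mulr0 mul0r.
Qed.

(** Polarization: [0 < q x x] already says that the value is real, and reality at delta_i + c
    delta_j for c = 1 and c = 'i forces Hermitian symmetry. *)
Lemma posdef_herm i j : H j i = (H i j)^*.
Proof.
have cross (c : C) : (H i j * c^* + H j i * c)^* = H i j * c^* + H j i * c.
  have := q_real (fun l => 1 *+ (l == i) + c *+ (l == j)); rewrite qD !q_delta.
  have := q_real (fun l => 1 *+ (l == i)); rewrite q_delta.
  have := q_real (fun l => c *+ (l == j)); rewrite q_delta.
  rewrite !mulr1 !conjC1 !mulr1 !rmorphD /= => -> ->; set A := H i i; set B := _ * c * _.
  move=> e; have: A + B + (((H i j * c^*)^* + (H j i * c)^*) - (H i j * c^* + H j i * c)) = A + B.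
    by have -> : A + B + (((H i j * c^*)^* + (H j i * c)^*) - (H i j * c^* + H j i * c)) =
       (A + (H i j * c^*)^* + (H j i * c)^* + B) - (H i j * c^* + H j i * c); [ring | rewrite e; ring].
  by move/(canRL (addKr _)); rewrite addNr => /eqP; rewrite subr_eq0 => /eqP.
have := cross 1; have := cross 'i; rewrite !conjC1 !mulr1 !rmorphD !rmorphM /= !conjCK conjCi.
set a := H i j; set b := H j i => e1 e2.
have : 'i * (a^* - b^*) = 'i * (b - a) by rewrite mulrBr [RHS]mulrBr; apply: etrans (etrans e1 _); ring.
move/(mulfI (neq0Ci _)) => e3.
have : b + b = a^* + a^*.
  have -> : b + b = (a + b) + (b - a) by ring.
  by rewrite -e2 -e3; ring.
by rewrite -!mulr2n => /eqP; rewrite eqrMn2r // => /eqP.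
Qed.

Lemma posdef_factor : exists2 A : 'M[C]_m, A \in unitmx & 
  forall i j, H i j = \sum_s A i s * (A j s)^*.
Proof.
have Hherm : H \is hermsymmx.
  rewrite is_hermitianmxE expr0 scale1r; apply/eqP/matrixP => i j; rewrite !mxE.
  exact: posdef_herm.
have /hermitian_normalmx /orthomx_spectralP E := Hherm.
set P := spectralmx H in E; set d := spectral_diag H in E.
have uP : P \is unitarymx := spectral_unitarymx H.
have PU : P \in unitmx := spectral_unit H.
have HE i j : H i j = \sum_l d 0 l * (P l i)^* * P l j.
  rewrite {1}E invmx_unitary // mxE; apply: eq_bigr => l _; rewrite mxE (bigD1 l) //= big1 => [|l' nl].
    by rewrite !mxE eqxx mulr1n addr0 [(P l i)^* * _]mulrC.
  by rewrite !mxE (negPf nl) mulr0n mulr0.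
have PPt l l' : \sum_i P l i * (P l' i)^* = (l == l')%:R.
  have /unitarymxP/matrixP/(_ l l') := uP; rewrite !mxE => <-.
  by apply: eq_bigr => i _; rewrite !mxE.
(* The l-th eigenvalue is the value of q at the l-th row of the unitary matrix P. *)
have d_gt0 l : 0 < d 0 l.
  have -> : d 0 l = q (fun j => P l j) (fun j => P l j).
    transitivity (\sum_l' d 0 l' * (\sum_i P l i * (P l' i)^*) * (\sum_j P l' j * (P l j)^*)).
      rewrite (bigD1 l) //= !PPt eqxx !mulr1 big1 ?addr0 // => l' nl.
      by rewrite !PPt eq_sym (negPf nl) !mulr0.
    rewrite /q; under [RHS]eq_bigr do under eq_bigr do rewrite HE mulr_suml mulr_suml.
    under [RHS]eq_bigr do rewrite exchange_big /=.
    rewrite [RHS]exchange_big /=; apply: eq_bigr => l' _.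
    rewrite [X in X * _]mulr_sumr mulr_suml; apply: eq_bigr => i _.
    rewrite mulr_sumr; apply: eq_bigr => j _; ring.
  apply: posH; apply/existsP; apply: contraTT isT => /existsPn h.
  have := PPt l l; rewrite eqxx big1 => [/eqP|i _]; first by rewrite eq_sym oner_eq0.
  by have /eqP -> := negbNE (h i); rewrite mul0r.
exists (\matrix_(i, s) ((P s i)^* * sqrtC (d 0 s))).
  have -> : \matrix_(i, s) ((P s i)^* * sqrtC (d 0 s)) =
      (map_mx conjC P^T) *m diag_mx (\row_s sqrtC (d 0 s)).
    apply/matrixP => i s; rewrite !mxE (bigD1 s) //= big1 ?addr0 => [|l nl].
      by rewrite !mxE eqxx mulr1n.
    by rewrite !mxE (negPf nl) mulr0n mulr0.
  rewrite unitmx_mul map_unitmx unitmx_tr PU unitmxE det_diag unitfE.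
  by apply/prodf_neq0 => s _; rewrite mxE sqrtC_eq0 gt_eqF.
move=> i j; rewrite HE; apply: eq_bigr => s _; rewrite !mxE rmorphM /= conjCK.
rewrite (geC0_conj (x := sqrtC _)) ?sqrtC_ge0 ?ltW // mulrACA -expr2 sqrtCK; ring.
Qed.

End PositiveDefinite.

Section Orthonormal.
Variables (C : numClosedFieldType) (V : vectType C) (hp : V -> V -> C).
Hypothesis hpDl : forall u v w, hp (u + v) w = hp u w + hp v w.
Hypothesis hpZl : forall c u w, hp (c *: u) w = c * hp u w.
Hypothesis hpC : forall u v, hp v u = (hp u v)^*.
Hypothesis hp_gt0 : forall u, u != 0 -> 0 < hp u u.

Lemma hp0l w : hp 0 w = 0.
Proof. by rewrite -(scale0r (0 : V)) hpZl mul0r. Qed.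

Lemma hp_suml (I : Type) (r : seq I) (P : pred I) (F : I -> V) w :
  hp (\sum_(i <- r | P i) F i) w = \sum_(i <- r | P i) hp (F i) w.
Proof. by apply: (big_morph (fun u => hp u w)) => [u v|]; [exact: hpDl | exact: hp0l]. Qed.

Lemma hp_sumr (I : Type) (r : seq I) (P : pred I) (F : I -> V) w :
  hp w (\sum_(i <- r | P i) F i) = \sum_(i <- r | P i) hp w (F i).
Proof.
by rewrite hpC hp_suml rmorph_sum; apply: eq_bigr => i _; rewrite [RHS]hpC.
Qed.

Lemma hpZr c u w : hp w (c *: u) = c^* * hp w u.
Proof. by rewrite hpC hpZl rmorphM [hp w u]hpC. Qed.

Definition orthonormal (s : seq V) := forall i j, (i < size s)%N -> (j < size s)%N ->
  hp s`_i s`_j = (i == j)%:R.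

Lemma orthonormal_free s : orthonormal s -> free s.
Proof.
move=> os; suff : free (in_tuple s) by []; apply/freeP => c c0 i.
have := congr1 (fun u => hp u s`_i) c0; rewrite hp0l hp_suml => <-.
rewrite (bigD1 i) //= hpZl os ?ltn_ord // eqxx mulr1 big1 ?addr0 // => j nj.
by rewrite hpZl os ?ltn_ord // (negPf (nj : (j : nat) != i)) mulr0.
Qed.

(** Gram-Schmidt along a spanning list; a vector already in the span is skipped. *)
Lemma orthonormal_basis (U : {vspace V}) : exists2 s, orthonormal s & <<s>>%VS = U.
Proof.
have [X -> {U}] : exists X : seq V, U = <<X>>%VS by exists (vbasis U); rewrite (span_basis (vbasisP U)).
elim: X => [|v X [s os sX]]; first by exists [::].
have [vX|vX] := boolP (v \in <<X>>%VS).
  exists s => //; rewrite sX span_cons; apply/esym/addv_idPr.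
  by rewrite -memvE.
pose v' := v - \sum_(i < size s) hp v s`_i *: s`_i.
have sumX : \sum_(i < size s) hp v s`_i *: s`_i \in <<X>>%VS.
  by rewrite -sX; apply: memv_suml => i _; rewrite memvZ // memv_span // mem_nth.
have v'0 : v' != 0.
  by apply: contraNneq vX => /eqP; rewrite subr_eq0 => /eqP->.
have v's j : (j < size s)%N -> hp v' s`_j = 0.
  move=> lj; rewrite /v' -scaleN1r hpDl hpZl hp_suml (bigD1 (Ordinal lj)) //= hpZl os // eqxx mulr1.
  rewrite big1 ?addr0 ?mulN1r ?subrr // => i ni.
  by rewrite hpZl os // (negPf (ni : (i : nat) != j)) mulr0.
have n0 : sqrtC (hp v' v') != 0 by rewrite sqrtC_eq0 gt_eqF // hp_gt0.
pose u := (sqrtC (hp v' v'))^-1 *: v'.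
have us j : (j < size s)%N -> hp u s`_j = 0 by move=> lj; rewrite hpZl v's ?mulr0.
exists (u :: s).
  case=> [|i] [|j] /= li lj.
  - rewrite hpZl hpZr mulrA; set a := sqrtC _ in n0 *.
    have ra : a^* = a by apply/geC0_conj; rewrite sqrtC_ge0 ltW // hp_gt0.
    by rewrite fmorphV /= ra -(sqrtCK (hp v' v')) -/a expr2 mulrA -(mulrA a^-1) mulVf // mulr1 mulVf.
  - by rewrite us.
  - by rewrite hpC us // conjC0.
  by rewrite os // eqSS.
rewrite !span_cons sX; apply/eqP; rewrite eqEsubv !subv_add !addvSr !andbT -!memvE.
apply/andP; split.
  by rewrite memvZ // rpredB // ?(subvP (addvSl _ _) _ (memv_line v)) // (subvP (addvSr _ _)).
have -> : v = sqrtC (hp v' v') *: u + \sum_(i < size s) hp v s`_i *: s`_i.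
  by rewrite scalerA divff // scale1r subrK.
apply: rpredD; last exact: (subvP (addvSr _ _) _ sumX).
apply: memvZ; exact: (subvP (addvSl _ _) _ (memv_line u)).
Qed.

End Orthonormal.

(** * Curvature at a point in an adapted orthonormal frame *)

Section PointCurvature.
Variables (C : numClosedFieldType) (n r : nat) (V : vectType C).
Variables (e : r.-tuple V) (hp : V -> V -> C).
Hypothesis e_basis : basis_of fullv e.
Hypothesis hpDl : forall u v w, hp (u + v) w = hp u w + hp v w.
Hypothesis hpZl : forall c u w, hp (c *: u) w = c * hp u w.
Hypothesis hpC : forall u v, hp v u = (hp u v)^*.
Hypothesis hp_gt0 : forall u, u != 0 -> 0 < hp u u.

Definition gram : 'M[C]_r := \matrix_(i, j) hp (tnth e i) (tnth e j).

Variable R : 'I_r -> 'I_r -> 'I_n -> 'I_n -> C.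

Definition cend i l al be := \sum_(j < r) R i j al be * invmx gram j l.

Definition cop al be v :=
  \sum_(i < r) \sum_(l < r) (coord e i v * cend i l al be) *: tnth e l.

Variables E1 E2 : {vspace V}.
Hypothesis E12 : (E1 + E2)%VS = fullv.
Hypothesis orthE : forall v w, v \in E1 -> w \in E2 -> hp v w = 0.
Hypothesis stabE1 : forall al be v, v \in E1 -> cop al be v \in E1.
Hypothesis stabE2 : forall al be v, v \in E2 -> cop al be v \in E2.
Hypothesis pos1 : forall u : 'M[C]_(r, n), u != 0 ->
    (forall al, \sum_(i < r) u i al *: tnth e i \in E1) ->
    0 < \sum_(i < r) \sum_(j < r) \sum_(al < n) \sum_(be < n)
          R i j al be * u i al * (u j be)^*.
Hypothesis pos2 : forall v : 'M[C]_(r, n), v != 0 ->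
    (forall be, \sum_(i < r) v i be *: tnth e i \in E2) ->
    0 < \sum_(i < r) \sum_(j < r) \sum_(al < n) \sum_(be < n)
          R i j al be * v i be * (v j al)^*.

Let orthE' v w : v \in E2 -> w \in E1 -> hp v w = 0.
Proof. by move=> v2 w1; rewrite hpC orthE // conjC0. Qed.

(** Orthonormal bases of E1 and E2 are concatenated; orthogonality makes the list free, and [E12]
    then fixes its length as r. *)
Lemma adapted_basis : exists (b : 'I_r -> V) (t : 'I_r -> bool),
  (forall p q, hp (b p) (b q) = (p == q)%:R) /\
  (forall p, if t p then b p \in E1 else b p \in E2).
Proof.
have [s1 o1 span1] := orthonormal_basis hpDl hpZl hpC hp_gt0 E1.
have [s2 o2 span2] := orthonormal_basis hpDl hpZl hpC hp_gt0 E2.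
have in1 i : (i < size s1)%N -> s1`_i \in E1 by move=> li; rewrite -span1 memv_span // mem_nth.
have in2 i : (i < size s2)%N -> s2`_i \in E2 by move=> li; rewrite -span2 memv_span // mem_nth.
have os : orthonormal hp (s1 ++ s2).
  move=> i j; rewrite size_cat !nth_cat => li lj.
  case: ltnP => hi; case: ltnP => hj.
  - exact: o1.
  - rewrite orthE ?in1 ?in2 ?ltn_subLR //.
    by rewrite ltn_eqF // (leq_trans hi).
  - rewrite orthE' ?in1 ?in2 ?ltn_subLR //.
    by rewrite gtn_eqF // (leq_trans hj).
  by rewrite o2 ?ltn_subLR // -(eqn_add2l (size s1)) !subnKC.
have sz : size (s1 ++ s2) = r.
  have /eqP <- := orthonormal_free hpDl hpZl os.
  by rewrite span_cat span1 span2 E12 (size_basis e_basis).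
exists (fun p => (s1 ++ s2)`_p), (fun p : 'I_r => p < size s1)%N; split=> [p q|p].
  by rewrite os ?sz.
rewrite nth_cat; case: ltnP => hp1; first exact: in1.
by apply: in2; rewrite ltn_subLR // -size_cat sz.
Qed.

Variables (kap : C) (k : nat) (lam : 'I_k -> nat).
Hypothesis kap_gt0 : 0 < kap.
Hypothesis lam_anti : forall i j : 'I_k, (i <= j)%N -> (lam j <= lam i)%N.
Hypothesis sum_lam : (\sum_i lam i)%N = k.
Hypothesis lam_le : forall i, (lam i <= r)%N.
Hypothesis le_kn : (k <= n)%N.

Definition curv_form_mx : 'M[form C n]_r := \matrix_(i, l)
  (('i * kap) *: \sum_al \sum_be cend i l al be *: (dz C al * dzbar C be)).

Theorem curv_schur_positive : positive_form k (point_schur lam curv_form_mx).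
Proof.
have [b [t [hpb bE]]] := adapted_basis.
pose G : 'M[C]_r := \matrix_(p, i) coord e i (b p).
pose Gs : 'M[C]_r := map_mx conjC G^T.
have bG p : b p = \sum_i G p i *: tnth e i.
  rewrite {1}(coord_basis e_basis (memvf (b p))); apply: eq_bigr => i _.
  by rewrite mxE (tnth_nth 0).
have GhG : G *m (gram *m Gs) = 1%:M.
  apply/matrixP => p q; rewrite !mxE -hpb [in RHS]bG (hp_suml hpDl hpZl).
  apply: eq_bigr => i _; rewrite hpZl; congr (_ * _).
  rewrite [in RHS]bG (hp_sumr hpDl hpZl hpC) mxE; apply: eq_bigr => j _.
  by rewrite (hpZr hpZl hpC) !mxE mulrC.
have [uG _] := mulmx1_unit GhG.
(* With Gs the adjoint of G, the relation G h Gs = 1 gives h^-1 = Gs G, so the endomorphism R h^-1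
   becomes Rp = G R Gs in the orthonormal frame b. *)
have invh : invmx gram = Gs *m G.
  have E : gram *m (Gs *m G) = 1%:M by rewrite mulmxA (mulmx1C GhG).
  by have [uh _] := mulmx1_unit E; rewrite -[RHS](mulKmx uh) E mulmx1.
pose Rm al be : 'M[C]_r := \matrix_(i, j) R i j al be.
pose Rp al be : 'M[C]_r := G *m Rm al be *m Gs.
have cendE al be i l : cend i l al be = (Rm al be *m invmx gram) i l.
  by rewrite mxE; apply: eq_bigr => j _; rewrite mxE.
have GR al be : G *m (Rm al be *m invmx gram) = Rp al be *m G.
  by rewrite invh /Rp !mulmxA.
have copb al be p : cop al be (b p) = \sum_q Rp al be p q *: b q.
  rewrite /cop exchange_big /=.
  transitivity (\sum_l (Rp al be *m G) p l *: tnth e l).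
    apply: eq_bigr => l _; rewrite -GR mxE scaler_suml; apply: eq_bigr => i _.
    by rewrite cendE [G p i]mxE.
  under [RHS]eq_bigr do rewrite bG scaler_sumr.
  rewrite exchange_big /=; apply: eq_bigr => l _; rewrite mxE scaler_suml.
  by apply: eq_bigr => q _; rewrite scalerA.
have RpE al be p q : Rp al be p q = hp (cop al be (b p)) (b q).
  rewrite copb (hp_suml hpDl hpZl) (bigD1 q) //= hpZl hpb eqxx mulr1 big1 ?addr0 // => q' nq.
  by rewrite hpZl hpb (negPf nq) mulr0.
(* Invariance of E1 and E2 under the curvature operators, read through inner products. *)
have Rp0 al be p q : t p != t q -> Rp al be p q = 0.
  rewrite RpE; have := bE p; have := bE q.
  case: (t p); case: (t q) => //= bq bp _.
    by apply: orthE => //; apply: stabE1.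
  by apply: orthE' => //; apply: stabE2.
have bil al be (x y : 'I_r -> C) :
   \sum_i \sum_j R i j al be * (\sum_p x p * G p i) * (\sum_q y q * G q j)^* =
   \sum_p \sum_q Rp al be p q * x p * (y q)^*.
  transitivity (\sum_i \sum_j \sum_p \sum_q G p i * R i j al be * (G q j)^* * x p * (y q)^*).
    apply: eq_bigr => i _; apply: eq_bigr => j _.
    rewrite [X in X * _]mulr_sumr mulr_suml; apply: eq_bigr => p _.
    rewrite rmorph_sum mulr_sumr; apply: eq_bigr => q _; rewrite rmorphM /=; ring.
  under eq_bigr do rewrite exchange_big /=.
  rewrite exchange_big /=; apply: eq_bigr => p _.
  under eq_bigr do rewrite exchange_big /=.
  rewrite exchange_big /=; apply: eq_bigr => q _.
  rewrite exchange_big /= mxE !mulr_suml; apply: eq_bigr => j _.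
  rewrite !mxE !mulr_suml; apply: eq_bigr => i _.
  by rewrite !mxE.
pose T := ('I_r * 'I_n)%type.
(* One Hermitian form on pairs of a frame index and a coordinate index. On E2 the coordinate indices
   are exchanged, as in [pos2], so that both blocks are positive definite. *)
pose Hf (x y : T) : C := if t x.1 == t y.1 then
   (if t x.1 then Rp x.2 y.2 x.1 y.1 else Rp y.2 x.2 x.1 y.1) else 0.
pose H : 'M[C]_#|{: T}| := \matrix_(i, j) Hf (enum_val i) (enum_val j).
pose Q1 (v : 'I_r -> 'I_n -> C) := \sum_p \sum_q \sum_al \sum_be Rp al be p q * v p al * (v q be)^*.
pose Q2 (v : 'I_r -> 'I_n -> C) := \sum_p \sum_q \sum_al \sum_be Rp al be p q * v p be * (v q al)^*.
pose push (v : 'I_r -> 'I_n -> C) : 'M[C]_(r, n) := \matrix_(i, al) \sum_p v p al * G p i.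
have push0 v : (exists p al, v p al != 0) -> push v != 0.
  move=> [p [al nv]]; apply: contraNneq nv => pv0.
  have : G^T *m (\matrix_(p, al) v p al) = 0.
    rewrite -pv0; apply/matrixP => i al'; rewrite !mxE; apply: eq_bigr => p' _.
    by rewrite !mxE mulrC.
  move/(congr1 (mulmx (invmx G^T))); rewrite mulKmx ?unitmx_tr // mulmx0.
  by move/matrixP/(_ p al); rewrite !mxE => ->.
have push_in (v : 'I_r -> 'I_n -> C) (c : bool) (U : {vspace V}) :
    (forall p, t p = c -> b p \in U) -> (forall p al, t p != c -> v p al = 0) ->
    forall al, \sum_(i < r) push v i al *: tnth e i \in U.
  move=> bU v0 al; have -> : \sum_(i < r) push v i al *: tnth e i = \sum_p v p al *: b p.
    under [RHS]eq_bigr do rewrite bG scaler_sumr.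
    rewrite exchange_big /=; apply: eq_bigr => i _; rewrite mxE scaler_suml.
    by apply: eq_bigr => p _; rewrite scalerA.
  apply: memv_suml => p _; have [tp|tp] := eqVneq (t p) c; first by rewrite memvZ // bU.
  by rewrite v0 // scale0r mem0v.
have Q1_gt0 v : (exists p al, v p al != 0) -> (forall p al, ~~ t p -> v p al = 0) -> 0 < Q1 v.
  move=> nv v0; have := pos1 (push0 v nv).
  have in1 p : t p = true -> b p \in E1 by move=> tp; have := bE p; rewrite tp.
  have v0' p al : t p != true -> v p al = 0 by rewrite eqb_id; apply: v0.
  move=> /(_ (push_in v true E1 in1 v0')); congr (_ < _).
  rewrite /Q1; under eq_bigr do rewrite exchange_big /=.
  rewrite exchange_big /=; under [RHS]eq_bigr do rewrite exchange_big /=.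
  rewrite [RHS]exchange_big /=; apply: eq_bigr => al _.
  under eq_bigr do rewrite exchange_big /=.
  rewrite exchange_big /=; under [RHS]eq_bigr do rewrite exchange_big /=.
  rewrite [RHS]exchange_big /=; apply: eq_bigr => be _.
  rewrite -bil; apply: eq_bigr => i _; apply: eq_bigr => j _; by rewrite !mxE.
have Q2_gt0 v : (exists p al, v p al != 0) -> (forall p al, t p -> v p al = 0) -> 0 < Q2 v.
  move=> nv v0; have := pos2 (push0 v nv).
  have in2 p : t p = false -> b p \in E2 by move=> tp; have := bE p; rewrite tp.
  have v0' p al : t p != false -> v p al = 0 by rewrite eqbF_neg negbK; apply: v0.
  move=> /(_ (push_in v false E2 in2 v0')); congr (_ < _).
  rewrite /Q2; under eq_bigr do rewrite exchange_big /=.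
  rewrite exchange_big /=; under [RHS]eq_bigr do rewrite exchange_big /=.
  rewrite [RHS]exchange_big /=; apply: eq_bigr => al _.
  under eq_bigr do rewrite exchange_big /=.
  rewrite exchange_big /=; under [RHS]eq_bigr do rewrite exchange_big /=.
  rewrite [RHS]exchange_big /=; apply: eq_bigr => be _.
  rewrite -bil; apply: eq_bigr => i _; apply: eq_bigr => j _; by rewrite !mxE.
have posH (x : 'I_#|{: T}| -> C) : (exists i, x i != 0) ->
    0 < \sum_i \sum_j H i j * x i * (x j)^*.
  move=> [i0 nx].
  pose v p al := x (enum_rank ((p, al) : T)).
  pose v1 p al := if t p then v p al else 0.
  pose v2 p al := if t p then 0 else v p al.
  (* [Hf] vanishes between the blocks, so the form splits along the E1 part v1 and the E2 part
     v2. *)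
  have -> : \sum_i \sum_j H i j * x i * (x j)^* = Q1 v1 + Q2 v2.
    transitivity (\sum_(i : T) \sum_(j : T) Hf i j * v i.1 i.2 * (v j.1 j.2)^*).
      rewrite (reindex enum_rank) /=; last exact: onW_bij (enum_rank_bij T).
      apply: eq_bigr => i _; rewrite (reindex enum_rank) /=; last exact: onW_bij (enum_rank_bij T).
      by apply: eq_bigr => j _; rewrite mxE !enum_rankK /v -!surjective_pairing.
    transitivity (\sum_p \sum_q \sum_al \sum_be Hf (p, al) (q, be) * v p al * (v q be)^*).
      rewrite -(pair_bigA _ (fun p al => \sum_(j : T) Hf (p, al) j * v p al * (v j.1 j.2)^*)) /=.
      apply: eq_bigr => p _; rewrite exchange_big /=.
      rewrite -(pair_bigA _ (fun q be => \sum_al Hf (p, al) (q, be) * v p al * (v q be)^*)) /=.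
      by apply: eq_bigr => q _; rewrite exchange_big.
    rewrite /Q1 /Q2 -big_split; apply: eq_bigr => p _; rewrite -big_split; apply: eq_bigr => q _ /=.
    rewrite [X in _ = _ + X]exchange_big -big_split; apply: eq_bigr => al _ /=.
    rewrite -big_split; apply: eq_bigr => be _; rewrite /Hf /v1 /v2 /=.
    by case: (t p); case: (t q); rewrite /= ?conjC0 ?mulr0 ?mul0r ?addr0 ?add0r.
  have [y ey] : exists y : T, i0 = enum_rank y by exists (enum_val i0); rewrite enum_valK.
  have Q1_ge0 : 0 <= Q1 v1.
    case: (boolP [exists p, exists al, v1 p al != 0]) => [/existsP[p /existsP[al h]]|/existsPn h].
      by apply/ltW/Q1_gt0; [exists p, al | move=> ? ? /negPf; rewrite /v1 => ->].
    rewrite /Q1 big1 // => p _; rewrite big1 // => q _; rewrite big1 // => al _; rewrite big1 // => be _.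
    by have /existsPn/(_ al) := h p; rewrite negbK => /eqP->; rewrite mulr0 mul0r.
  have Q2_ge0 : 0 <= Q2 v2.
    case: (boolP [exists p, exists al, v2 p al != 0]) => [/existsP[p /existsP[al h]]|/existsPn h].
      by apply/ltW/Q2_gt0; [exists p, al | move=> ? ?; rewrite /v2 => ->].
    rewrite /Q2 big1 // => p _; rewrite big1 // => q _; rewrite big1 // => al _; rewrite big1 // => be _.
    by have /existsPn/(_ be) := h p; rewrite negbK => /eqP->; rewrite mulr0 mul0r.
  case: (boolP (t y.1)) => ty.
    apply: ltr_wpDr => //; apply: Q1_gt0; last by move=> ? ? /negPf; rewrite /v1 => ->.
    by exists y.1, y.2; rewrite /v1 ty /v -surjective_pairing -ey.
  apply: ltr_wpDl => //; apply: Q2_gt0; last by move=> ? ?; rewrite /v2 => ->.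
  by exists y.1, y.2; rewrite /v2 (negPf ty) /v -surjective_pairing -ey.
have [A uA HA] := posdef_factor posH.
(* On E2 the exchanged indices call for the conjugate of A: the sum over s of
   [W l s al * (W i s be)^*] is then [Rp al be i l]. *)
pose W p s al := let c := A (enum_rank ((p, al) : T)) s in if t p then c else c^*.
have span (i0 : 'I_r) (a0 : 'I_n) : exists cs : 'I_#|{: T}| -> C,
    forall i, t i = t i0 -> \sum_s cs s *: (\sum_a W i s a *: dz C a) = if i == i0 then dz C a0 else 0.
  (* The columns of the inverse of A provide the dual families. *)
  pose c0 s := invmx A s (enum_rank ((i0, a0) : T)).
  exists (fun s => if t i0 then c0 s else (c0 s)^*) => i ti.
  have AV a : \sum_s A (enum_rank ((i, a) : T)) s * c0 s = ((i, a) == (i0, a0))%:R.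
    have := mulmxV uA => /matrixP/(_ (enum_rank ((i, a) : T)) (enum_rank ((i0, a0) : T))).
    by rewrite !mxE (inj_eq enum_rank_inj).
  under eq_bigr do rewrite scaler_sumr.
  rewrite exchange_big /=.
  transitivity (\sum_a ((i, a) == (i0, a0))%:R *: dz C a).
    apply: eq_bigr => a _; rewrite -AV.
    under eq_bigr do rewrite scalerA.
    rewrite -scaler_suml; congr (_ *: _).
    rewrite /W ti; case: (t i0); first by apply: eq_bigr => s _; rewrite mulrC.
    rewrite -[RHS](_ : (\sum_s A (enum_rank ((i, a) : T)) s * c0 s)^* = _).
      by rewrite rmorph_sum; apply: eq_bigr => s _; rewrite rmorphM mulrC.
    by rewrite AV conjC_nat.
  rewrite (bigD1 a0) //= big1 ?addr0 => [|a na].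
    by rewrite xpair_eqE eqxx andbT; case: eqP; rewrite ?scale1r ?scale0r.
  by rewrite xpair_eqE (negPf na) andbF scale0r.
have pos := point_schur_positive kap_gt0 lam_anti sum_lam lam_le le_kn span.
suff -> : point_schur lam curv_form_mx = point_schur lam (block_mx_form t W kap) by exact: pos.
clear pos; apply: (@point_schur_conj C n r k lam curv_form_mx (block_mx_form t W kap) G) => //.
- move=> i' l'; rewrite mxE; apply/bidegreeZ/bidegree_sum => al _; apply: bidegree_sum => be _.
  apply: bidegreeZ; exact: (bidegreeM (@bidegree_dz C n al) (@bidegree_dzbar C n be)).
- move=> i' l'; rewrite mxE; apply: bidegreeZ; case: ifP => _; last exact: bidegree0.
  have bw p' s : bidegree 1 0 (\sum_a W p' s a *: dz C a).
    by apply: bidegree_sum => a _; apply/bidegreeZ/bidegree_dz.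
  apply: bidegree_sum => s _.
  by case: (t i'); apply: (bidegreeM (p := 1) (q := 0) (p' := 0) (q' := 1)) => //; apply: bidegree_conj.
move=> i' j'.
pose Mp : 'M[form C n]_r := \matrix_(i, l) \sum_al \sum_be Rp al be i l *: (dz C al * dzbar C be).
have MpE i l : block_mx_form t W kap i l = ('i * kap) *: Mp i l.
  have wM (p q : 'I_r) s : (\sum_a W p s a *: dz C a) * form_conj (\sum_a W q s a *: dz C a) =
      \sum_al \sum_be (W p s al * (W q s be)^*) *: (dz C al * dzbar C be).
    rewrite (form_conj_sum _ _ (fun a => W q s a *: dz C a)) mulr_suml; apply: eq_bigr => al _.
    rewrite mulr_sumr; apply: eq_bigr => be _.
    by rewrite form_conjZ form_conj_dz -scalerAl -scalerAr scalerA.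
  have wsum (p q : 'I_r) (c : 'I_n -> 'I_n -> C) :
      (forall al be, \sum_s W p s al * (W q s be)^* = c al be) ->
      \sum_s (\sum_a W p s a *: dz C a) * form_conj (\sum_a W q s a *: dz C a) =
      \sum_al \sum_be c al be *: (dz C al * dzbar C be).
    move=> hc; under eq_bigr do rewrite wM.
    rewrite exchange_big /=; apply: eq_bigr => al _.
    by rewrite exchange_big /=; apply: eq_bigr => be _; rewrite -scaler_suml hc.
  have HE (x y : T) : \sum_s A (enum_rank x) s * (A (enum_rank y) s)^* = Hf x y.
    by rewrite -HA mxE !enum_rankK.
  rewrite [LHS]mxE [in RHS]mxE; congr (_ *: _).
  case: eqP => [til|/eqP til]; last first.
    by rewrite big1 // => al _; rewrite big1 // => be _; rewrite Rp0 // scale0r.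
  case ti: (t i); apply: wsum => al be.
    have tl : t l by rewrite -til.
    by rewrite /W ti tl HE /Hf /= ti tl eqxx.
  have tl : t l = false by rewrite -til.
  rewrite /W ti tl; under eq_bigr do rewrite conjCK mulrC.
  by rewrite HE /Hf /= ti tl eqxx.
under [RHS]eq_bigr do rewrite MpE scalerA mulrC -scalerA.
under [LHS]eq_bigr do rewrite [curv_form_mx _ _]mxE scalerA mulrC -scalerA.
rewrite -!scaler_sumr; congr (_ *: _).
under [LHS]eq_bigr do rewrite scaler_sumr.
under [RHS]eq_bigr do rewrite [Mp _ _]mxE scaler_sumr.
rewrite exchange_big [RHS]exchange_big /=; apply: eq_bigr => al _.
under [LHS]eq_bigr do rewrite scaler_sumr.
under [RHS]eq_bigr do rewrite scaler_sumr.
rewrite exchange_big [RHS]exchange_big /=; apply: eq_bigr => be _.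
under [LHS]eq_bigr do rewrite scalerA.
under [RHS]eq_bigr do rewrite scalerA.
rewrite -!scaler_suml; congr (_ *: _).
transitivity ((G *m (Rm al be *m invmx gram)) i' j').
  by rewrite mxE; apply: eq_bigr => l _; rewrite cendE.
by rewrite GR mxE; apply: eq_bigr => l _; rewrite mulrC.
Qed.

End PointCurvature.

(* Reduction of the geometric statement to one point *)
From mathcomp Require Import all_classical all_reals all_analysis.
From mathcomp Require Import complex.

Theorem theorem1p4 (R : realType) (n r : nat) (X : complexManifold R n)
    (E : holomorphicBundle r X) (h : hermitianMetric E)
    (hE : strongly_decomposably_positive2 h)
    (k : nat) (hk : (1 <= k <= n)%N)
    (lam : k.-tuple nat) (hlam : bounded_partition r lam)
    (x : X) (a : chartI X) (b : frameI E)
    (xa : chart_dom a x) (xb : frame_dom b x) :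
  positive_form k (schur_form h a b lam x).
Proof.
have /and3P[slam /allP lam_le /eqP sumlam] := hlam.
have [E1 [E2 [E12 orthE /(_ a b xa xb)[st1 st2 p1 p2]]]] := hE x.
(* At the image of x in the chart, [chartK] brings the frame and the metric back to the fibre over
   x. *)
have hmxE : hmx h a b (chart a x) = gram (frame b x) (h x).
  by rewrite /hmx chartK.
(* Then ['i * kap] is the constant i/(2 pi) of the Chern forms. *)
pose kap : R[i] := (2 * (pi : R)%:C%C)^-1.
have kap_gt0 : 0 < kap.
  by rewrite invr_gt0 mulr_gt0 ?ltr0n // ltcR pi_gt0.
have cendE i l al be : curv_end h a b x i l al be = cend (frame b x) (h x) (curv h a b x) i l al be.
  by rewrite /curv_end hmxE.
have copE al be v : curv_op h a b al be v = cop (frame b x) (h x) (curv h a b x) al be v.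
  by apply: eq_bigr => i _; apply: eq_bigr => l _; rewrite cendE.
have lam_anti (i j : 'I_k) : (i <= j)%N -> (tnth lam j <= tnth lam i)%N.
  move=> ij; rewrite !(tnth_nth 0%N).
  by apply: (sorted_leq_nth (leT := geq)) => //; rewrite ?inE ?size_tuple //; [move=> y z w /= yz zw; exact: leq_trans zw yz | exact: leqnn].
have sum_lam : (\sum_i tnth lam i)%N = k by rewrite -[RHS]sumlam sumnE big_tuple.
have le_r i : (tnth lam i <= r)%N by apply: lam_le; apply: mem_tnth.
have /andP[_ le_kn] := hk.
have := @curv_schur_positive R[i] n r (E x) (frame b x) (h x) (frame_basis xb).
have hDl u v w : h x (u + v) w = h x u w + h x v w by rewrite linearDl.
have hZl c u w : h x (c *: u) w = c * h x u w by rewrite linearZl.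
have hC u v : h x v u = (h x u v)^*.
  by rewrite [LHS]hermC expr0 mul1r.
have h0 u : u != 0 -> 0 < h x u u by apply: neq0_dnorm_gt0.
move=> /(_ hDl hZl hC h0 (curv h a b x) E1 E2 E12 orthE).
have st1' al be v : v \in E1 -> cop (frame b x) (h x) (curv h a b x) al be v \in E1.
  by rewrite -copE; apply: st1.
have st2' al be v : v \in E2 -> cop (frame b x) (h x) (curv h a b x) al be v \in E2.
  by rewrite -copE; apply: st2.
move=> /(_ st1' st2' p1 p2 kap k (tnth lam) kap_gt0 lam_anti sum_lam le_r le_kn).
suff -> : schur_form h a b lam x = point_schur (tnth lam) (curv_form_mx (frame b x) (h x) (curv h a b x) kap) by [].
rewrite /schur_form /point_schur.
have curvE : map_mx ( *:%R ('i / (2 * (pi : R)%:C%C))) (curv_mx h a b x) = curv_form_mx (frame b x) (h x) (curv h a b x) kap.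
  apply/matrixP => i l; rewrite [LHS]mxE [RHS]mxE /curv_mx mxE -/kap; apply: congr1.
  by apply: eq_bigr => al _; apply: eq_bigr => be _; rewrite cendE.
have chernE z : chern h a b x z = point_chern (curv_form_mx (frame b x) (h x) (curv h a b x) kap) z.
  by rewrite /chern /total_chern curvE.
apply: congr1; apply/matrixP => i j; rewrite [LHS]mxE [RHS]mxE; exact: chernE.
Qed.
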